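(* Let $p=3$. For every integer $n\ge1$, the $3$-adic Mazur–Tate element $\theta_{n,\Delta}\in\mathbb{Z}_3[\mathcal{G}_n]$ of level $n$ attached to $\Delta$ satisfies $\lambda(\theta_{n,\Delta})=3^n-2$.
   Context: $\Delta=\sum_{n\ge1}\tau(n)q^n=q\prod_{n\ge1}(1-q^n)^{24}$. $V_k(R)$ is the module of homogeneous degree-$k$ polynomials in $X,Y$ over a ring $R$. $\varphi^+_\Delta$ is the sign-$+1$ (plus) part of the modular symbol $\{r\}-\{s\}\mapsto 2\pi i\int_s^r\Delta(z)(zX+Y)^{10}dz$ on degree-zero divisors of $\mathbb{P}^1(\mathbb{Q})$, with values in $V_{10}(\mathbb{C})$, divided by its cohomological period at $3$ (Pollack–Weston), so that it takes values in $V_{10}(\mathbb{Z}_{(3)})$ and not all values lie in $3V_{10}(\mathbb{Z}_{(3)})$. For $m\ge1$, $G_m=\mathrm{Gal}(\mathbb{Q}(\mu_{3^m})/\mathbb{Q})\cong(\mathbb{Z}/3^m\mathbb{Z})^\times$ via $a\mapsto\sigma_a$, $\sigma_a(\zeta)=\zeta^a$; $K_n\subset\mathbb{Q}(\mu_{3^{n+1}})$ is the subfield of degree $3^n$, $\mathcal{G}_n=\mathrm{Gal}(K_n/\mathbb{Q})$, $\pi_n:G_{n+1}\to\mathcal{G}_n$ restriction. $\theta_{n,\Delta}$ is the image under $\pi_n$ of $\sum_{a\in(\mathbb{Z}/3^{n+1}\mathbb{Z})^\times}\varphi^+_\Delta(\{\infty\}-\{a/3^{n+1}\})(0,1)\,\sigma_a$.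 For $F\in\mathbb{Z}_3[\mathcal{G}_n]$, choose a generator $\gamma_n$ of $\mathcal{G}_n$, set $T=\gamma_n-1$, write $F=\sum_{i=0}^{3^n-1}a_iT^i$ with $a_i\in\mathbb{Z}_3$; $\mu(F)=\min_i\mathrm{ord}_3(a_i)$ and $\lambda(F)=\min\{i:\mathrm{ord}_3(a_i)=\mu(F)\}$ (both $\infty$ if $F=0$); these are independent of $\gamma_n$. *)

(* Defs.v *)
From HB Require Import structures.
From mathcomp Require Import all_boot all_order all_algebra.
From mathcomp Require Import all_classical all_reals.
From mathcomp Require Import topology normedtype sequences exp trigo.
From mathcomp Require Import measure lebesgue_measure lebesgue_integral.
From mathcomp Require Import Rstruct Rstruct_topology.
From mathcomp Require Import complex.

Set Implicit Arguments.
Unset Strict Implicit.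
Unset Printing Implicit Defensive.

Import Order.TTheory GRing.Theory Num.Theory.
Import numFieldNormedType.Exports.
Local Open Scope classical_set_scope.
Local Open Scope ring_scope.

Notation R := Rdefinitions.R.

Definition ReC (z : R[i]) : R := complex.Re z.
Definition ImC (z : R[i]) : R := complex.Im z.

Definition qexp (z : R[i]) : R[i] :=
  ((expR (- (2 * pi) * ImC z))%:C *
   (cos (2 * pi * ReC z) +i* sin (2 * pi * ReC z)))%C.

Definition Delta_partial (N : nat) (z : R[i]) : R[i] :=
  qexp z * \prod_(1 <= k < N.+1) (1 - qexp z ^+ k) ^+ 24.

Definition Delta (z : R[i]) : R[i] :=
  (limn (fun N => ReC (Delta_partial N z)) +i*
   limn (fun N => ImC (Delta_partial N z)))%C.

(* For a cusp s in Q, Pj s = Re( 2 pi i \int_s^{i oo} Delta(z) z^j dz ), *)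
(* computed along the vertical path z = s + i t, t in ]0,+oo[ (dz = i dt). *)
(* For the cusp oo (None) the integral is 0.                           *)
Definition Pj (j : nat) (s : option rat) : R :=
  match s with
  | None => 0
  | Some s =>
    \int[lebesgue_measure]_(t in `]0%R, +oo[)
       ReC ((2 * pi)%:C * 'i * Delta (ratr s +i* t)%C
           * (ratr s +i* t)%C ^+ j * 'i)%C
  end.

(* phi^+_Delta({r} - {s}) = Re( 2 pi i \int_s^r Delta(z)(zX+Y)^10 dz ):
   its coefficient of X^j Y^(10-j), for j <= 10.  (The plus part, i.e.
   the average with the action of diag(-1,1), is the coefficientwise real
   part.)  Cusps of P^1(Q) are  option rat, None = oo. *)
Definition phiplus_coef (r s : option rat) (j : nat) : R :=
  ('C(10, j))%:R * (Pj j s - Pj j r).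

Definition in_Z3loc (x : R) : Prop :=
  exists a b : int, ~~ (3 %| b)%Z /\ x = a%:~R / b%:~R.
Definition in_3Z3loc (x : R) : Prop :=
  exists a b : int, ~~ (3 %| b)%Z /\ x = 3 * a%:~R / b%:~R.

(* Omega is a cohomological period at 3 (Pollack--Weston) for phi^+_Delta:
   phi^+_Delta / Omega takes values in V_10(Z_(3)) on all degree-zero
   divisors (generated by the {r}-{s}), and not all values lie in
   3 V_10(Z_(3)). *)
Definition cohomological_period (Omega : R) : Prop :=
  Omega != 0 /\
  (forall (r s : option rat) (j : nat), (j <= 10)%N ->
      in_Z3loc (phiplus_coef r s j / Omega)) /\
  (exists (r s : option rat) (j : nat), (j <= 10)%N /\
      ~ in_3Z3loc (phiplus_coef r s j / Omega)).

(* Group ring side.  G_{n+1} = (Z/3^{n+1})^x, a |-> sigma_a;            *)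
(* calG_n = Gal(K_n/Q) = G_{n+1}/{sigma_1, sigma_{-1}} (cyclic of order 3^n), *)
(* pi_n the projection.  A generator gamma_n of calG_n is the image of   *)
(* sigma_g for an integer g such that every unit a mod 3^{n+1} is congruent *)
(* to +- g^k for some k < 3^n.  Then gamma_n^k is the image of the        *)
(* sigma_a with a = +- g^k.                                             *)
Definition is_generator_class (n g : nat) : Prop :=
  forall a : nat, coprime a 3 ->
    exists k : nat, (k < 3 ^ n)%N /\
      (a = g ^ k %[mod 3 ^ n.+1] \/ a + g ^ k = 0 %[mod 3 ^ n.+1]).

(* Coefficient of gamma_n^k in pi_n (sum_a c a sigma_a). *)
Definition MT_coef (n g : nat) (c : nat -> rat) (k : nat) : rat :=
  \sum_(a < 3 ^ n.+1 | coprime a 3 &&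
          ((a == g ^ k %[mod 3 ^ n.+1]) || (a + g ^ k == 0 %[mod 3 ^ n.+1])))
     c a.

(* Element of Q[calG_n] as a polynomial in gamma_n (degree < 3^n). *)
Definition MT_poly_gamma (n g : nat) (c : nat -> rat) : {poly rat} :=
  \sum_(k < 3 ^ n) MT_coef n g c k *: 'X^k.

(* Coefficients a_i of F = sum_i a_i T^i, T = gamma_n - 1:
   substitute gamma = 1 + T. *)
Definition T_coefs (F : {poly rat}) (i : nat) : rat :=
  (F \Po ('X + 1))`_i.

Definition ord3 (x : rat) : int :=
  (logn 3 `|numq x|)%:Z - (logn 3 `|denq x|)%:Z.

(* lambda-invariant of F = sum_{i < N} a_i T^i:  mu = min_i ord_3(a_i),
   lambda = least i with ord_3(a_i) = mu; None encodes infinity (F = 0). *)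
Definition lambda_inv (a : nat -> rat) (N : nat) : option nat :=
  let P := fun i => (a i != 0) &&
             all (fun j => (a j != 0) ==> (ord3 (a i) <= ord3 (a j))%R)
                 (iota 0 N) in
  let i := find P (iota 0 N) in
  if (i < N)%N then Some i else None.

(* Main.v *)
Require Import Defs.
From HB Require Import structures.
From mathcomp Require Import all_boot all_order all_algebra.
From mathcomp Require Import all_classical all_reals.
From mathcomp Require Import Rstruct complex.
From mathcomp Require Import topology normedtype ereal sequences exp trigo derive.
From mathcomp Require Import measure measurable_realfun lebesgue_measure lebesgue_integral ftc.
From mathcomp Require Import zify ring lra.

(** Write [R(x,y) = Re (2 pi i int_0^{i oo} Delta(z)(zx+y)^10 dz)] for the plus part
    of the period polynomial of Delta. It is even and antisymmetric, and satisfies the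
    three-term relation, whence [R = A (y^10 - x^10) + B x^2 y^2 (x^2 - y^2)^3];
    the Hecke relation [T_2 Delta = -24 Delta], integrated along the imaginary axis,
    gives [691 A = 36 B].
    Following the cocycle of SL_2(Z) along the Euclidean algorithm, all values of the
    symbol lie in [Z A + Z B], and the value at the cusp [a/m], with [9 | m] and
    [a d = 1 mod m], is [m^10 A - 9 (d^2 - 1) B] modulo [81 B].
    The normalization of the period makes [B / Omega] a 3-adic unit. As
    [(g^2)^k = 1 + 3 s k mod 9] with [s] prime to 3 for a generator [g], the
    coefficient of [gamma^k] is, up to a unit, [27 k] modulo [81]. Finally
    [sum_{k < 3^n} k C(k,i) = (i+1) C(3^n,i+2) + i C(3^n,i+1)] is divisible by 3 for
    [i < 3^n - 2] but not for [i = 3^n - 2].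

    The analytic input is elementary. The triple product makes Delta a product of
    eighth powers of theta constants, whose inversion formulas come from a discrete
    Poisson summation; Jacobi's quartic identity between the theta constants yields
    the relation for [T_2]. *)

Set Implicit Arguments.
Unset Strict Implicit.
Unset Printing Implicit Defensive.

Import Order.TTheory GRing.Theory Num.Theory.
Import numFieldNormedType.Exports.
Local Open Scope classical_set_scope.
Local Open Scope ring_scope.

(** The precision 81 is forced. As 3 divides d^2 - 1, the term 9 (d^2 - 1) B is a multiple of 27 B,
    and its dependence on d shows only modulo 81. The term m^10 A is invisible there because 9 | m,
    which is where n >= 1 enters. The relation between A and B also controls the normalization: 3
    divides 36 but not 691, so Z A + Z B spans only Z_(3) B over Z_(3). Since B is up to sign itself
    a value of the symbol, integrality and primitivity leave B / Omega no choice but to be a unit,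
    and the period is never computed. On the analytic side there is no contour integration.
    Integrals up to i oo are replaced by primitives that decay at i oo, and such functions are
    identified by comparing derivatives. Contours of Gaussians are shifted in the same spirit: the
    derivative of the Gaussian in its parameters is exact in x, so its Riemann sums telescope. The
    integrals of the definitions return only at the end, as limits at cusps. *)

Local Notation cm := (@ComplexField.Normc.normc _).
Local Notation Re := complex.Re.
Local Notation Im := complex.Im.

(** * Modulus, real part and imaginary part *)

Section ComplexNorm.
Variable R : realType.
Local Notation C := R[i].
Implicit Types (z w : C) (x y : R).

Lemma cm0 : cm (0 : C) = 0. Proof. exact: ComplexField.Normc.normc0. Qed.
Lemma cm1 : cm (1 : C) = 1. Proof. exact: ComplexField.Normc.normc1. Qed.
Lemma cmM z w : cm (z * w) = cm z * cm w.
Proof. exact: ComplexField.Normc.normcM. Qed.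
Lemma cmV z : cm z^-1 = (cm z)^-1.
Proof. exact: ComplexField.Normc.normcV. Qed.
Lemma cmN z : cm (- z) = cm z. Proof. exact: normcN. Qed.
Lemma cmD z w : cm (z + w) <= cm z + cm w. Proof. exact: le_normcD. Qed.
Lemma cmB z w : cm (z - w) <= cm z + cm w.
Proof. by rewrite -[cm w]cmN; exact: cmD. Qed.
Lemma cm_dist z w : cm (z - w) = cm (w - z).
Proof. by rewrite -cmN opprB. Qed.
Lemma cm_ge0 z : 0 <= cm z.
Proof. by case: z => a b; exact: sqrtr_ge0. Qed.
Lemma cm_eq0 z : (cm z == 0) = (z == 0).
Proof.
apply/eqP/eqP => [/ComplexField.Normc.eq0_normc //|->]; exact: cm0.
Qed.
Lemma cm_gt0 z : (0 < cm z) = (z != 0).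
Proof. by rewrite lt_def cm_eq0 cm_ge0 andbT. Qed.
Lemma cmX z n : cm (z ^+ n) = cm z ^+ n.
Proof. by elim: n => [|n IH]; rewrite ?expr0 ?cm1 // !exprS cmM IH. Qed.
Lemma cm_real x : cm (x%:C)%C = `|x|.
Proof. by rewrite /= expr0n addr0 sqrtr_sqr. Qed.
Lemma real_complex_nat n : (n%:R%:C)%C = n%:R :> C.
Proof. by rewrite rmorph_nat. Qed.
Lemma cm_nat n : cm (n%:R : C) = n%:R.
Proof. by rewrite -real_complex_nat cm_real normr_nat. Qed.
Lemma cm_i : cm ('i%C : C) = 1.
Proof. by rewrite /= expr0n expr1n add0r sqrtr1. Qed.
Lemma cm_sum (I : Type) (r : seq I) (P : pred I) (F : I -> C) :
  cm (\sum_(i <- r | P i) F i) <= \sum_(i <- r | P i) cm (F i).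
Proof.
elim/big_rec2: _ => [|i x y _ le]; first by rewrite cm0.
by apply: le_trans (cmD _ _) _; rewrite lerD2l.
Qed.
Lemma cm_prod (I : Type) (r : seq I) (P : pred I) (F : I -> C) :
  cm (\prod_(i <- r | P i) F i) = \prod_(i <- r | P i) cm (F i).
Proof.
by elim/big_rec2: _ => [|i x y _ <-]; rewrite ?cm1 ?cmM.
Qed.

Lemma ReD z w : Re (z + w) = Re z + Re w. Proof. by case: z w => ? ? []. Qed.
Lemma ImD z w : Im (z + w) = Im z + Im w. Proof. by case: z w => ? ? []. Qed.
Lemma ReN z : Re (- z) = - Re z. Proof. by case: z. Qed.
Lemma ImN z : Im (- z) = - Im z. Proof. by case: z. Qed.
Lemma ReB z w : Re (z - w) = Re z - Re w. Proof. by rewrite ReD ReN. Qed.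
Lemma ImB z w : Im (z - w) = Im z - Im w. Proof. by rewrite ImD ImN. Qed.
Lemma ReMc z w : Re (z * w) = Re z * Re w - Im z * Im w.
Proof. by case: z w => ? ? []. Qed.
Lemma ImMc z w : Im (z * w) = Re z * Im w + Im z * Re w.
Proof. by case: z w => ? ? []. Qed.
Lemma Re_realM x z : Re ((x%:C)%C * z) = x * Re z.
Proof. by rewrite ReMc /= mul0r subr0. Qed.
Lemma Im_realM x z : Im ((x%:C)%C * z) = x * Im z.
Proof. by rewrite ImMc /= mul0r addr0. Qed.
Lemma Re_sum (I : Type) (r : seq I) (P : pred I) (F : I -> C) :
  Re (\sum_(i <- r | P i) F i) = \sum_(i <- r | P i) Re (F i).
Proof. by apply: (big_morph (@complex.Re R)) => // ? ?; rewrite ReD. Qed.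
Lemma Re_nat n : Re (n%:R : C) = n%:R.
Proof. by rewrite -real_complex_nat. Qed.
Lemma Im_nat n : Im (n%:R : C) = 0.
Proof. by rewrite -real_complex_nat. Qed.
Lemma complex_ext z w : Re z = Re w -> Im z = Im w -> z = w.
Proof. by case: z w => ? ? [? ?] /= -> ->. Qed.

Lemma cm_sqr z : cm z ^+ 2 = Re z ^+ 2 + Im z ^+ 2.
Proof. by case: z => a b; rewrite /= sqr_sqrtr// addr_ge0 ?sqr_ge0. Qed.
Lemma cm_Re z : `|Re z| <= cm z.
Proof.
rewrite -(ler_pXn2r (n := 2)) ?nnegrE ?cm_ge0// cm_sqr real_normK ?num_real//.
by rewrite lerDl sqr_ge0.
Qed.
Lemma cm_Im z : `|Im z| <= cm z.
Proof.
rewrite -(ler_pXn2r (n := 2)) ?nnegrE ?cm_ge0// cm_sqr real_normK ?num_real//.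
by rewrite lerDr sqr_ge0.
Qed.
Lemma cm_ReIm z : cm z <= `|Re z| + `|Im z|.
Proof.
have -> : z = ((Re z)%:C + 'i * (Im z)%:C)%C by exact: complexE.
apply: le_trans (cmD _ _) _.
by rewrite cmM cm_i mul1r !cm_real -complexE.
Qed.
Lemma cm_sub_le z w : cm z - cm w <= cm (z - w).
Proof. by rewrite lerBlDr; apply: le_trans (cmD _ _); rewrite subrK. Qed.

End ComplexNorm.

(** * Real derivatives and elementary bounds for sin, cos and exp *)

Section RealBounds.
Variable R : realType.

(** The passage from quadratic remainder estimates to the derivatives of the library: after division
    by [h] the error is at most |M| |h|. *)
Lemma quad_is_derive (f : R -> R) (x l M d : R) : 0 < d ->
  (forall h, `|h| <= d -> `|f (x + h) - f x - l * h| <= M * h ^+ 2) ->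
  is_derive x 1 f l.
Proof.
move=> d0 H.
have cv : h^-1 *: (f (h *: (1 : R) + x) - f x) @[h --> (0 : R)^'] --> l.
  apply/cvgrPdist_lt => e e0.
  have M1 : 0 < `|M| + 1 by rewrite ltr_wpDl.
  near=> h.
  have h0 : h != 0 by near: h; exact: nbhs_dnbhs_neq.
  have hd : `|h| < Num.min d (e / (`|M| + 1)).
    near: h; apply: dnbhs0_lt; rewrite lt_min d0 divr_gt0//.
  move: hd; rewrite lt_min => /andP[/ltW hd he].
  rewrite /GRing.scale /= mulr1 [h + x]addrC distrC.
  have -> : h^-1 * (f (x + h) - f x) - l = h^-1 * (f (x + h) - f x - l * h).
    by rewrite [RHS]mulrBr [l * h]mulrC mulKf.
  rewrite normrM normfV mulrC ltr_pdivrMr ?normr_gt0//.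
  apply: le_lt_trans (H _ hd) _.
  apply: (@le_lt_trans _ _ ((`|M| + 1) * (`|h| * `|h|))).
    rewrite -normrM -expr2 (ger0_norm (sqr_ge0 _)) ler_wpM2r ?sqr_ge0//.
    by rewrite (le_trans (ler_norm _))// lerDl.
  rewrite mulrA ltr_pM2r ?normr_gt0// mulrC -ltr_pdivlMr//.
apply: DeriveDef; first by apply/cvg_ex; exists l.
exact: cvg_lim.
Unshelve. all: by end_near. Qed.

Lemma is_derive_continuous (f : R -> R) (x l : R) :
  is_derive x 1 f l -> {for x, continuous f}.
Proof.
move=> [+ _] => /derivable1_diffP df.
exact: differentiable_continuous.
Qed.

Lemma mvt_bound (f df : R -> R) (a b K : R) : a <= b ->
  (forall x, a <= x <= b -> is_derive x 1 f (df x)) ->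
  (forall x, a <= x <= b -> `|df x| <= K) -> `|f b - f a| <= K * (b - a).
Proof.
move=> ab fd dfK.
have h1 x : x \in `]a, b[%R -> is_derive x 1 f (df x).
  by rewrite in_itv/= => /andP[/ltW ax /ltW xb]; apply: fd; rewrite ax xb.
have h2 : {within `[a, b], continuous f}.
  apply: continuous_in_subspaceT => x; rewrite inE/= in_itv/= => xab.
  exact: is_derive_continuous (fd _ xab).
have [c] := MVT_segment ab h1 h2.
rewrite in_itv/= => cab ->.
by rewrite normrM [`|b - a|]ger0_norm ?subr_ge0// ler_wpM2r ?subr_ge0// dfK.
Qed.

Lemma abs_sin_le (y : R) : `|sin y| <= `|y|.
Proof.
wlog y0 : y / 0 <= y.
  move=> H; have [/H //|/ltW y0] := leP 0 y.
  by rewrite -normrN -sinN -[`|y|]normrN H// oppr_ge0.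
have h1 x : 0 <= x <= y -> is_derive x 1 (@sin R) (cos x).
  by move=> _; exact: is_derive_sin.
have h2 x : 0 <= x <= y -> `|cos x| <= 1 by move=> _; exact: cos_max.
by have := mvt_bound y0 h1 h2; rewrite sin0 !subr0 mul1r (ger0_norm y0).
Qed.

Lemma cos_sub1 (y : R) : `|cos y - 1| <= y ^+ 2.
Proof.
have -> : cos y = cos (y / 2) ^+ 2 *+ 2 - 1.
  by rewrite -cos_mulr2n; congr cos; field.
rewrite cos2sin2.
have -> : (1 - sin (y / 2) ^+ 2) *+ 2 - 1 - 1 = - (sin (y / 2) ^+ 2 *+ 2) by ring.
rewrite normrN ger0_norm ?mulrn_wge0 ?sqr_ge0//.
have : sin (y / 2) ^+ 2 <= (y / 2) ^+ 2.
  rewrite -real_normK ?num_real// -[X in _ <= X]real_normK ?num_real//.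
  by rewrite lerXn2r ?nnegrE// abs_sin_le.
have := sqr_ge0 y; nra.
Qed.

Lemma sin_subid (y : R) : `|y| <= 1 -> `|sin y - y| <= y ^+ 2.
Proof.
wlog y0 : y / 0 <= y.
  move=> H y1; have [y0|/ltW y0] := leP 0 y; first exact: H.
  rewrite -normrN -[y ^+ 2]sqrrN.
  have -> : - (sin y - y) = sin (- y) - - y by rewrite sinN; ring.
  by rewrite H ?oppr_ge0// normrN.
rewrite (ger0_norm y0) => y1.
have h1 x : 0 <= x <= y -> is_derive x 1 (fun t => sin t - t) (cos x - 1).
  by move=> _; apply: is_deriveB.
have h2 x : 0 <= x <= y -> `|cos x - 1| <= y.
  by move=> /andP[x0 xy]; apply: le_trans (cos_sub1 _) _; nra.
by have := mvt_bound y0 h1 h2; rewrite sin0 !subr0 expr2.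
Qed.

Lemma expR_sub1 (x : R) : `|x| <= 2^-1 -> `|expR x - 1 - x| <= 2 * x ^+ 2.
Proof.
move=> x1; have := expR_ge1Dx x => h1; have := expR_ge1Dx (- x) => h2.
have [xl xu] : - 2^-1 <= x /\ x <= 2^-1 by move: x1; rewrite ler_norml => /andP.
rewrite ger0_norm; last by lra.
have : expR x * (1 - x) <= 1.
  by rewrite -[leRHS](expRxMexpNx_1 x) ler_wpM2l ?expR_ge0.
have : 0 <= x ^+ 2 := sqr_ge0 _.
set E := expR x in h1 *; move=> x2 hE.
(* As e^x (1 - x) <= 1, this product is at most - x^2 (1 - 2 x); this is where x <= 1/2 enters. *)
suff : (E - 1 - x - 2 * x ^+ 2) * (1 - x) <= 0.
  move=> h; rewrite -subr_le0 -(pmulr_lle0 _ (_ : 0 < 1 - x))//; lra.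
nra.
Qed.
End RealBounds.

(* Unification must not unfold complex arithmetic; the same holds for the analytic
   functions made opaque below. *)
#[global] Opaque ComplexField.Normc.normc.

(** * Complex limits, series and dominated convergence *)

Section Convergence.
Variable R : realType.
Local Notation C := R[i].

(** Only an upper bound is asked, because it is applied to norms and to sequences that dominate
    norms. *)
Definition tends0 (b : nat -> R) :=
  forall e : R, 0 < e -> exists N, forall n, (N <= n)%N -> b n < e.

Definition ccvg (u : nat -> C) (l : C) := tends0 (fun n => cm (u n - l)).

Lemma tends0_le (a b : nat -> R) N0 :
  (forall n, (N0 <= n)%N -> a n <= b n) -> tends0 b -> tends0 a.
Proof.
move=> ab b0 e e0; have [N HN] := b0 _ e0; exists (maxn N0 N) => n.
by rewrite geq_max => /andP[h1 h2]; apply: le_lt_trans (HN _ h2); exact: ab.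
Qed.

Lemma tends0D (a b : nat -> R) :
  tends0 a -> tends0 b -> tends0 (fun n => a n + b n).
Proof.
move=> a0 b0 e e0; have e2 : 0 < e / 2 by lra.
have [N1 H1] := a0 _ e2; have [N2 H2] := b0 _ e2.
exists (maxn N1 N2) => n; rewrite geq_max => /andP[/H1 + /H2]; lra.
Qed.

Lemma tends0Z (a : nat -> R) (c : R) :
  tends0 a -> 0 <= c -> tends0 (fun n => c * a n).
Proof.
move=> a0 c0 e e0; have c1 : 0 < c + 1 by lra.
have [N HN] := a0 (e / (c + 1)) (divr_gt0 e0 c1); exists N => n /HN.
rewrite ltr_pdivlMr// => h; have [an0|an0] := leP 0 (a n); first nra.
by apply: le_lt_trans e0; nra.
Qed.

Lemma tends0_comp (a : nat -> R) (f : nat -> nat) :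
  tends0 a -> (forall n, (n <= f n)%N) -> tends0 (fun n => a (f n)).
Proof.
move=> a0 fn e e0; have [N HN] := a0 _ e0; exists N => n nN.
by apply: HN; exact: leq_trans nN (fn n).
Qed.

Lemma tends0_inv (K : R) : tends0 (fun n => K / n.+1%:R).
Proof.
move=> e e0; exists (Num.truncn (`|K| / e)) => n nN.
rewrite ltr_pdivrMr ?ltr0n//; apply: le_lt_trans (ler_norm _) _.
rewrite mulrC -ltr_pdivrMr//; apply: lt_le_trans (truncnS_gt _) _.
by rewrite ler_nat.
Qed.

(** Each of the n + 1 terms of the geometric sum up to r^n is at least r^n. This gives the decay of
    r^n, and that of n r^n at a slightly larger radius, without logarithms. *)
Lemma geom_le_inv (r : R) n : 0 <= r < 1 -> n.+1%:R * r ^+ n * (1 - r) <= 1.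
Proof.
move=> /andP[r0 r1].
have : n.+1%:R * r ^+ n <= \sum_(k < n.+1) r ^+ k.
  have -> : n.+1%:R * r ^+ n = \sum_(k < n.+1) r ^+ n.
    by rewrite sumr_const card_ord mulr_natl.
  by apply: ler_sum => k _; rewrite ler_wiXn2l// ?ltW// -ltnS.
have := subrX1 r n.+1; set S := \sum_(k < _) _ => e h.
have := exprn_ge0 n.+1 r0; nra.
Qed.

Lemma tends0_geom (B r : R) : 0 <= r < 1 -> tends0 (fun n => B * r ^+ n).
Proof.
move=> r01; have r1 : 0 < 1 - r by lra.
apply: (@tends0_le _ (fun n => (`|B| / (1 - r)) / n.+1%:R) 0%N); last exact: tends0_inv.
move=> n _; have h := geom_le_inv n r01.
have r0 : 0 <= r ^+ n by rewrite exprn_ge0//; lra.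
have : r ^+ n <= (1 - r)^-1 / n.+1%:R.
  by rewrite ler_pdivlMr ?ltr0n// -[leRHS]mul1r ler_pdivlMr//; lra.
move: (ler_norm B) (normr_ge0 B); rewrite -!mulrA; set X := _ / n.+1%:R; nra.
Qed.

Lemma ccvg_squeeze (u : nat -> C) l b N0 :
  (forall n, (N0 <= n)%N -> cm (u n - l) <= b n) -> tends0 b -> ccvg u l.
Proof. exact: tends0_le. Qed.

Lemma ccvg_uniq (u : nat -> C) l l' : ccvg u l -> ccvg u l' -> l = l'.
Proof.
move=> h h'; apply/eqP; rewrite -subr_eq0 -cm_eq0.
rewrite eq_le cm_ge0 andbT leNgt; apply/negP => e0.
have [N1 H1] := tends0D h h' e0.
have := H1 _ (leqnn _); rewrite ltNge => /negP; apply.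
rewrite (cm_dist _ l); apply: le_trans (cmD _ _).
by rewrite [l - _ + _]addrC subrKA subrr add0r cm_dist lexx || rewrite subrKA lexx.
Qed.

Lemma ccvg_cst (l : C) : ccvg (fun=> l) l.
Proof. by move=> e e0; exists 0%N => n _; rewrite subrr cm0. Qed.

Lemma ccvg_ext (u v : nat -> C) l N0 :
  (forall n, (N0 <= n)%N -> u n = v n) -> ccvg u l -> ccvg v l.
Proof. by move=> uv; apply: (@tends0_le _ _ N0) => n /uv ->. Qed.

Lemma ccvg_eq (u v : nat -> C) l : (forall n, u n = v n) -> ccvg u l -> ccvg v l.
Proof. by move=> uv; apply: (@ccvg_ext _ _ _ 0%N). Qed.

Lemma ccvgD (u v : nat -> C) l m :
  ccvg u l -> ccvg v m -> ccvg (fun n => u n + v n) (l + m).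
Proof.
move=> hu hv; apply: (ccvg_squeeze (N0 := 0%N) _ (tends0D hu hv)) => n _.
by rewrite opprD addrACA; exact: cmD.
Qed.

Lemma ccvgZ (c : C) (u : nat -> C) l :
  ccvg u l -> ccvg (fun n => c * u n) (c * l).
Proof.
move=> hu; apply: (ccvg_squeeze (N0 := 0%N) _ (tends0Z hu (cm_ge0 c))) => n _.
by rewrite -mulrBr cmM.
Qed.

Lemma ccvgN (u : nat -> C) l : ccvg u l -> ccvg (fun n => - u n) (- l).
Proof.
by move=> /(ccvgZ (-1)); rewrite mulN1r; apply: ccvg_eq => n; rewrite mulN1r.
Qed.

Lemma ccvgB (u v : nat -> C) l m :
  ccvg u l -> ccvg v m -> ccvg (fun n => u n - v n) (l - m).
Proof. by move=> hu hv; apply: ccvgD => //; exact: ccvgN. Qed.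

Lemma ccvg_comp (u : nat -> C) l (f : nat -> nat) :
  ccvg u l -> (forall n, (n <= f n)%N) -> ccvg (fun n => u (f n)) l.
Proof. by move=> hu hf; exact: tends0_comp hu hf. Qed.

Lemma ccvgM (u v : nat -> C) l m :
  ccvg u l -> ccvg v m -> ccvg (fun n => u n * v n) (l * m).
Proof.
move=> hu hv.
have [N HN] := hv 1 ltr01.
have h1 : tends0 (fun n => (1 + cm m) * cm (u n - l) + cm l * cm (v n - m)).
  apply: tends0D; last by apply: tends0Z => //; exact: cm_ge0.
  by apply: tends0Z => //; rewrite addr_ge0 ?ler01 ?cm_ge0.
apply: (ccvg_squeeze (N0 := N) _ h1) => n nN.
have -> : u n * v n - l * m = v n * (u n - l) + l * (v n - m) by ring.
apply: le_trans (cmD _ _) _; rewrite !cmM lerD2r ler_wpM2r ?cm_ge0//.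
have := HN _ nN => /ltW h; rewrite -lerBlDr; apply: le_trans h; exact: cm_sub_le.
Qed.

Lemma ccvgX (u : nat -> C) l k : ccvg u l -> ccvg (fun n => u n ^+ k) (l ^+ k).
Proof.
move=> hu; elim: k => [|k IH].
  by rewrite expr0; apply: ccvg_eq (ccvg_cst 1) => n; rewrite expr0.
rewrite exprS; apply: (ccvg_eq _ (ccvgM hu IH)) => n.
by rewrite exprS.
Qed.

Lemma ccvg_sum (u : nat -> nat -> C) (l : nat -> C) K :
  (forall k, (k < K)%N -> ccvg (fun n => u n k) (l k)) ->
  ccvg (fun n => \sum_(k < K) u n k) (\sum_(k < K) l k).
Proof.
elim: K => [|K IH] h.
  by rewrite big_ord0; apply: ccvg_eq (ccvg_cst 0) => n; rewrite big_ord0.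
rewrite big_ord_recr/=; apply: ccvg_eq; last first.
  by apply: ccvgD; [apply: IH => k kK; apply: h; exact: ltnW|exact: h].
by move=> n; rewrite big_ord_recr.
Qed.

Lemma ccvg_le (u : nat -> C) l B : (forall n, cm (u n) <= B) -> ccvg u l -> cm l <= B.
Proof.
move=> uB hu; rewrite leNgt; apply/negP => lB.
have [N HN] : exists N, forall n, (N <= n)%N -> cm (u n - l) < cm l - B.
  by apply: hu; rewrite subr_gt0.
have := HN _ (leqnn N); have := uB N; have := cm_sub_le l (u N).
rewrite (cm_dist l); lra.
Qed.

Lemma ccvg_ge (u : nat -> C) l B : (forall n, B <= cm (u n)) -> ccvg u l -> B <= cm l.
Proof.
move=> uB hu; rewrite leNgt; apply/negP => lB.
have [N HN] : exists N, forall n, (N <= n)%N -> cm (u n - l) < B - cm l.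
  by apply: hu; rewrite subr_gt0.
have := HN _ (leqnn N); have := uB N; have := cm_sub_le (u N) l; lra.
Qed.

Lemma ccvgV (u : nat -> C) l : l != 0 -> ccvg u l -> ccvg (fun n => (u n)^-1) l^-1.
Proof.
rewrite -cm_gt0 => l0 hu.
have l2 : 0 < cm l / 2 by lra.
have [N HN] := hu _ l2.
have h1 : tends0 (fun n => 2 / (cm l ^+ 2) * cm (u n - l)).
  by apply: tends0Z => //; rewrite divr_ge0// sqr_ge0.
apply: (ccvg_squeeze (N0 := N) _ h1) => n nN.
have un : cm l / 2 < cm (u n).
  by have := HN _ nN; have := cm_sub_le l (u n); rewrite (cm_dist l); lra.
have un0 : u n != 0 by rewrite -cm_gt0; apply: lt_trans un; lra.
have ll0 : l != 0 by rewrite -cm_gt0.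
have -> : (u n)^-1 - l^-1 = - (u n - l) / (u n * l) by field; rewrite un0 ll0.
rewrite cmM cmN cmV cmM mulrC ler_wpM2r ?cm_ge0// expr2 invfM mulrC.
rewrite (_ : 2 / (cm l * cm l) = (cm l)^-1 * (2 / cm l)); last first.
  by field; rewrite gt_eqF.
by rewrite ler_wpM2l ?invr_ge0 ?cm_ge0// -[2 / cm l]invf_div lef_pV2 ?posrE//; [exact: ltW|lra].
Qed.

Definition summ (b : nat -> R) :=
  (forall k, 0 <= b k) /\ exists S : R, forall n, \sum_(k < n) b k <= S.

Lemma summ_tail b : summ b ->
  forall e : R, 0 < e -> exists K, forall n, \sum_(K <= k < n) b k <= e.
Proof.
move=> [b0 [S HS]] e e0.
have nd : nondecreasing_seq (fun n => \sum_(k < n) b k).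
  by apply/nondecreasing_seqP => n; rewrite big_ord_recr/= lerDl.
have cv : cvgn (fun n => \sum_(k < n) b k).
  by apply: nondecreasing_is_cvgn => //; exists S => _ [n _ <-].
have le_lim n : \sum_(k < n) b k <= limn (fun n => \sum_(k < n) b k).
  exact: nondecreasing_cvgn_le.
have /cvgrPdist_lt /(_ _ e0) [K _ HK] := cv.
exists K => n; have [nK|Kn] := leqP n K; first by rewrite big_geq// ltW.
have := HK K (leqnn K); rewrite /= => h1.
have := le_lim n; rewrite -(big_mkord xpredT) (big_cat_nat (n := K))//=; last exact: ltnW.
rewrite big_mkord; move: h1 (ler_norm (limn (fun n => \sum_(k < n) b k) - \sum_(k < K) b k)).
lra.
Qed.

Lemma summ_le a b : (forall k, 0 <= a k <= b k) -> summ b -> summ a.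
Proof.
move=> ab [b0 [S HS]]; split; first by move=> k; case/andP: (ab k).
exists S => n; apply: le_trans (HS n); apply: ler_sum => k _.
by case/andP: (ab k).
Qed.

Lemma summZ c b : 0 <= c -> summ b -> summ (fun k => c * b k).
Proof.
move=> c0 [b0 [S HS]]; split; first by move=> k; rewrite mulr_ge0.
by exists (c * S) => n; rewrite -mulr_sumr ler_wpM2l.
Qed.

Lemma summD a b : summ a -> summ b -> summ (fun k => a k + b k).
Proof.
move=> [a0 [S HS]] [b0 [T HT]]; split; first by move=> k; rewrite addr_ge0.
by exists (S + T) => n; rewrite big_split/=; apply: (lerD (HS n) (HT n)).
Qed.

Lemma summ_geom r : 0 <= r < 1 -> summ (fun k => r ^+ k).
Proof.
move=> /andP[r0 r1]; split; first by move=> k; exact: exprn_ge0.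
exists (1 - r)^-1 => n; rewrite -[leRHS]mul1r ler_pdivlMr ?subr_gt0//.
by have := subrX1 r n; have := exprn_ge0 n r0; lra.
Qed.

Lemma summ_inv2 : summ (fun k => (k.+1%:R ^+ 2)^-1).
Proof.
split; first by move=> k; rewrite invr_ge0 sqr_ge0.
exists 2 => -[|n]; first by rewrite big_ord0.
(* The stronger bound carries the induction: 1/(n+2)^2 <= 1/(n+1) - 1/(n+2). *)
suff : \sum_(k < n.+1) (k.+1%:R ^+ 2)^-1 <= 2 - n.+1%:R^-1 :> R.
  by move/le_trans; apply; rewrite gerDl oppr_le0 invr_ge0.
elim: n => [|n IH]; first by rewrite big_ord_recr big_ord0/= expr1n; lra.
rewrite big_ord_recr/=; apply: le_trans (lerD IH (lexx _)) _.
rewrite -subr_ge0.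
have n1 : 0 < n.+1%:R :> R by rewrite ltr0n.
rewrite [n.+2%:R]mulrS;  set x := n.+1%:R in n1 *; clearbody x.
have x1 : 0 < 1 + x by lra.
have -> : 2 - (1 + x)^-1 - (2 - x^-1 + ((1 + x) ^+ 2)^-1) = (x * (1 + x) ^+ 2)^-1.
  by field; rewrite !gt_eqF.
by rewrite invr_ge0 mulr_ge0 ?ltW// exprn_gt0.
Qed.

Definition csumto (a : nat -> C) (l : C) := ccvg (fun n => \sum_(k < n) a k) l.

Lemma cauchy_ccvg (u : nat -> C) :
  (forall e : R, 0 < e -> exists K, forall n, (K <= n)%N -> cm (u n - u K) <= e) ->
  exists l, ccvg u l.
Proof.
move=> H.
have cv (f : C -> R) : (forall z w, f (z - w) = f z - f w) ->
    (forall z, `|f z| <= cm z) -> cvgn (fun n => f (u n)).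
  move=> fB fle; apply: cauchy_cvg; apply: cauchy_exP => e e0.
  have [K HK] := H _ (divr_gt0 e0 (ltr0Sn _ 1)).
  exists (f (u K)); exists K => // n /= Kn; rewrite /ball/= distrC -fB.
  by apply: le_lt_trans (fle _) _; apply: le_lt_trans (HK _ Kn) _; lra.
have /cvgrPdist_lt cR := cv _ (@ReB R) (@cm_Re R).
have /cvgrPdist_lt cI := cv _ (@ImB R) (@cm_Im R).
exists (limn (fun n => Re (u n)) +i* limn (fun n => Im (u n)))%C => e e0.
have [N1 _ H1] := cR _ (divr_gt0 e0 (ltr0Sn _ 1)).
have [N2 _ H2] := cI _ (divr_gt0 e0 (ltr0Sn _ 1)).
exists (maxn N1 N2) => n; rewrite geq_max => /andP[n1 n2].
apply: le_lt_trans (cm_ReIm _) _; rewrite ReB ImB /=.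
move: (H1 n n1) (H2 n n2) => /=; rewrite distrC [in X in _ -> X -> _]distrC; lra.
Qed.

Lemma summ_csumto (a : nat -> C) b : summ b -> (forall k, cm (a k) <= b k) ->
  exists l, csumto a l.
Proof.
move=> sb ab; apply: cauchy_ccvg => e e0.
have [K HK] := summ_tail sb e0; exists K => n Kn.
rewrite -!(big_mkord xpredT) (big_cat_nat (n := K))//= addrAC subrr add0r.
by apply: le_trans (cm_sum _ _ _) _; apply: le_trans (HK n); apply: ler_sum => k _.
Qed.

Lemma csumto_tail (a : nat -> C) b l K e : (forall k, cm (a k) <= b k) ->
  (forall n, \sum_(K <= k < n) b k <= e) -> csumto a l ->
  cm (l - \sum_(k < K) a k) <= e.
Proof.
move=> ab He al.
apply: (@ccvg_le (fun n => \sum_(K <= k < n + K) a k)) => [n|].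
  by apply: le_trans (cm_sum _ _ _) _; apply: le_trans (He (n + K)%N); apply: ler_sum.
apply: ccvg_eq (ccvgB (ccvg_comp al (fun n => leq_addr K n)) (ccvg_cst _)) => n.
rewrite -!(big_mkord xpredT) (big_cat_nat (n := K))//= ?leq_addl//.
by rewrite addrAC subrr add0r.
Qed.

(** Dominated convergence for series. Beyond a cut-off [K] chosen from [b], both tails are at most
    e/4; before it, finitely many terms converge one by one. *)
Lemma tannery (a : nat -> nat -> C) (l : nat -> C) (b : nat -> R) (s : nat -> C) sl :
  summ b -> (forall n k, cm (a n k) <= b k) -> (forall k, ccvg (a^~ k) (l k)) ->
  csumto l sl -> (forall n, csumto (a n) (s n)) -> ccvg s sl.
Proof.
move=> sb ab al lsl asn e e0.
have e4 : 0 < e / 4 by lra.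
have [K HK] := summ_tail sb e4.
have lb k : cm (l k) <= b k by apply: ccvg_le (al k) => n; exact: ab.
have [N HN] := ccvg_sum (K := K) (fun k _ => al k) e4.
exists N => n /HN h.
have h1 := csumto_tail (ab n) HK (asn n).
have h2 := csumto_tail lb HK lsl; rewrite cm_dist in h2.
have -> : s n - sl = (s n - \sum_(k < K) a n k) +
   (\sum_(k < K) a n k - \sum_(k < K) l k) + (\sum_(k < K) l k - sl) by ring.
have := cmD (s n - \sum_(k < K) a n k + (\sum_(k < K) a n k - \sum_(k < K) l k))
  (\sum_(k < K) l k - sl).
have := cmD (s n - \sum_(k < K) a n k) (\sum_(k < K) a n k - \sum_(k < K) l k).
lra.
Qed.

Lemma csumto_fin (a : nat -> C) K : (forall k, (K <= k)%N -> a k = 0) ->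
  csumto a (\sum_(k < K) a k).
Proof.
move=> aK; apply: (ccvg_ext (N0 := K)) (ccvg_cst _) => n Kn.
rewrite -!(big_mkord xpredT) [RHS](big_cat_nat (n := K))//=.
have -> : \sum_(K <= i < n) a i = 0 by rewrite big_nat; apply: big1 => k /andP[/aK].
by rewrite addr0.
Qed.

(** The same for finite sums of growing length, extended by zero past [K n]. *)
Lemma tannery_fin (a : nat -> nat -> C) (l : nat -> C) (b : nat -> R) (K : nat -> nat) sl :
  summ b -> (forall n k, (k < K n)%N -> cm (a n k) <= b k) -> (forall n, (n <= K n)%N) ->
  (forall k, ccvg (a^~ k) (l k)) ->
  csumto l sl -> ccvg (fun n => \sum_(k < K n) a n k) sl.
Proof.
move=> sb ab nK al lsl.
pose a' n k := if (k < K n)%N then a n k else 0.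
have h1 n k : cm (a' n k) <= b k.
  by rewrite /a'; case: ifP => [/ab //|_]; rewrite cm0; case: sb.
have h2 k : ccvg (a'^~ k) (l k).
  apply: (ccvg_ext (N0 := k.+1)) (al k) => n kn.
  by rewrite /a' (leq_trans kn (nK n)).
have h3 n : csumto (a' n) (\sum_(k < K n) a n k).
  have -> : \sum_(k < K n) a n k = \sum_(k < K n) a' n k.
    by apply: eq_bigr => k _; rewrite /a' ltn_ord.
  by apply: csumto_fin => k kK; rewrite /a' ltnNge kK.
exact: tannery sb h1 h2 lsl h3.
Qed.

Lemma csumtoZ c a l : csumto a l -> csumto (fun k => c * a k) (c * l).
Proof. by move=> /(ccvgZ c); apply: ccvg_eq => n; rewrite mulr_sumr. Qed.

Lemma csumtoD a b l m : csumto a l -> csumto b m -> csumto (fun k => a k + b k) (l + m).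
Proof. by move=> ha hb; apply: ccvg_eq (ccvgD ha hb) => n; rewrite big_split. Qed.

Lemma csumto_eq a b l : (forall k, a k = b k) -> csumto a l -> csumto b l.
Proof. by move=> ab; apply: ccvg_eq => n; apply: eq_bigr. Qed.

Lemma csumto_shift a l : csumto a l -> csumto (fun k => a k.+1) (l - a 0%N).
Proof.
move=> h; apply: ccvg_eq (ccvgB (ccvg_comp h (f := S) (fun n => leqnSn n)) (ccvg_cst _)) => n.
by rewrite big_ord_recl/= addrC addKr.
Qed.

Lemma csumto_cm (a : nat -> C) b l S : (forall k, cm (a k) <= b k) ->
  (forall n, \sum_(k < n) b k <= S) -> csumto a l -> cm l <= S.
Proof.
move=> ab bS; apply: ccvg_le => n; apply: le_trans (cm_sum _ _ _) _.
by apply: le_trans (bS n); apply: ler_sum.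
Qed.

(** Total functions with default value 0, so that series can be written before their convergence is
    known; [csumP] and [climP] give them their meaning. *)
Definition csum (a : nat -> C) : C := xget 0 [set l | csumto a l].
Definition clim (u : nat -> C) : C := xget 0 [set l | ccvg u l].

Lemma csumP a l : csumto a l -> csumto a (csum a).
Proof. by move=> al; rewrite /csum; case: xgetP => [x _ //|/(_ l)]. Qed.
Lemma csumE a l : csumto a l -> csum a = l.
Proof. by move=> al; exact: ccvg_uniq (csumP al) al. Qed.
Lemma climP a l : ccvg a l -> ccvg a (clim a).
Proof. by move=> al; rewrite /clim; case: xgetP => [x _ //|/(_ l)]. Qed.
End Convergence.

#[global] Opaque csum clim.

(** * The complex exponential and its Taylor bounds *)

Section ComplexExp.
Variable R : realType.
Local Notation C := R[i].

Definition cexp (z : C) : C := ((expR (Re z))%:C * (cos (Im z) +i* sin (Im z)))%C.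

Lemma cexpE z : cexp z = ((expR (Re z))%:C * (cos (Im z) +i* sin (Im z)))%C.
Proof. by []. Qed.

Lemma cexp0 : cexp 0 = 1.
Proof. by rewrite /cexp /= expR0 cos0 sin0 mul1r. Qed.

Lemma cexpD z w : cexp (z + w) = cexp z * cexp w.
Proof.
apply: complex_ext; rewrite /cexp ?ReMc ?ImMc ?ReD ?ImD !expRD cosD sinD /=; ring.
Qed.

Lemma cm_cexp z : cm (cexp z) = expR (Re z).
Proof.
rewrite cmM cm_real ger0_norm ?expR_ge0//.
suff /eqP -> : cm (cos (Im z) +i* sin (Im z))%C == 1 by rewrite mulr1.
by rewrite -sqrp_eq1 ?cm_ge0// cm_sqr/= cos2Dsin2.
Qed.

Lemma cexp_neq0 z : cexp z != 0.
Proof. by rewrite -cm_gt0 cm_cexp expR_gt0. Qed.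

Lemma cexpN z : cexp (- z) = (cexp z)^-1.
Proof.
apply: (mulfI (cexp_neq0 z)); rewrite divff ?cexp_neq0//.
by rewrite -cexpD subrr cexp0.
Qed.

Lemma cexpMn z n : cexp (n%:R * z) = cexp z ^+ n.
Proof.
elim: n => [|n IH]; first by rewrite mul0r cexp0 expr0.
by rewrite -natr1 mulrDl mul1r cexpD IH exprSr.
Qed.

Lemma cexp_real (x : R) : cexp (x%:C)%C = (expR x)%:C%C.
Proof. by rewrite /cexp /= cos0 sin0 mulr1. Qed.

Lemma cexp_le (z : C) : cm (cexp z) <= expR (cm z).
Proof. by rewrite cm_cexp ler_expR (le_trans (ler_norm _) (cm_Re z)). Qed.

Lemma expR_le2 (x : R) : x <= 2^-1 -> expR x <= 2.
Proof.
move=> x2; have [x0|x0] := leP 0 x; last first.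
  by rewrite (le_trans (_ : _ <= 1)) ?expR_le1 ?ltW//; lra.
have /expR_sub1 : `|x| <= 2^-1 by rewrite ger0_norm.
move: (ler_norm (expR x - 1 - x)); nra.
Qed.

Lemma cexp_taylor_small (h : C) : cm h <= 2^-1 ->
  cm (cexp h - 1 - h) <= 5 * cm h ^+ 2.
Proof.
move=> hh; rewrite cm_sqr.
have hx : `|Re h| <= 2^-1 by apply: le_trans hh; exact: cm_Re.
have hy : `|Im h| <= 2^-1 by apply: le_trans hh; exact: cm_Im.
apply: le_trans (cm_ReIm _) _.
have -> : Re (cexp h - 1 - h) = expR (Re h) * cos (Im h) - 1 - Re h.
  by rewrite !ReB Re_realM.
have -> : Im (cexp h - 1 - h) = expR (Re h) * sin (Im h) - Im h.
  by rewrite !ImB Im_realM /= subr0.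
move: (Re h) (Im h) hx hy => x y hx hy.
have E1 := expR_sub1 hx.
have E2 : expR x <= 2 by apply: expR_le2; apply: le_trans hx; exact: ler_norm.
have E0 := expR_ge0 x.
have C1 := cos_sub1 y.
have S1 : `|sin y - y| <= y ^+ 2 by apply: sin_subid; lra.
have -> : expR x * cos y - 1 - x = (expR x - 1 - x) + expR x * (cos y - 1) by ring.
have -> : expR x * sin y - y = expR x * (sin y - y) + (expR x - 1 - x) * y + x * y by ring.
have F1 : `|expR x * (cos y - 1)| <= 2 * y ^+ 2.
  by rewrite normrM (ger0_norm E0) ler_pM.
have F2 : `|expR x * (sin y - y)| <= 2 * y ^+ 2.
  by rewrite normrM (ger0_norm E0) ler_pM.
have F3 : `|(expR x - 1 - x) * y| <= x ^+ 2.
  rewrite normrM; apply: le_trans (ler_pM _ _ E1 hy) _ => //; lra.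
have F4 : `|x * y| <= (x ^+ 2 + y ^+ 2) / 2.
  rewrite normrM; rewrite -(real_normK (num_real x)) -(real_normK (num_real y)).
  have := sqr_ge0 (`|x| - `|y|); nra.
move: (ler_normD (expR x - 1 - x) (expR x * (cos y - 1))).
move: (ler_normD (expR x * (sin y - y) + (expR x - 1 - x) * y) (x * y)).
move: (ler_normD (expR x * (sin y - y)) ((expR x - 1 - x) * y)).
have := sqr_ge0 x; have := sqr_ge0 y; lra.
Qed.

Lemma expR_ge_id (x : R) : x <= expR x.
Proof. by have := expR_ge1Dx x; lra. Qed.

Lemma expR_ge_1 (x : R) : 0 <= x -> 1 <= expR x.
Proof. by have := expR_ge1Dx x; lra. Qed.

(** Beyond |h| = 1/2 each of e^h, 1 and h is at most e^|h| in modulus and 1 <= 4 |h|^2; hence 12 = 3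
    * 4. *)
Lemma cexp_taylor (h : C) :
  cm (cexp h - 1 - h) <= 12 * cm h ^+ 2 * expR (cm h).
Proof.
have e1 := expR_ge_1 (cm_ge0 h).
have := sqr_ge0 (cm h) => s0.
have [/cexp_taylor_small|hb] := leP (cm h) 2^-1; first by move=> h1; nra.
have := cmB (cexp h - 1) h; have := cmB (cexp h) 1; have := cexp_le h.
rewrite cm1; have := expR_ge_id (cm h) => *.
have : 1 <= 4 * cm h ^+ 2 by nra.
nra.
Qed.

Lemma cexp_sub1 (h : C) : cm (cexp h - 1) <= 13 * cm h * expR (2 * cm h).
Proof.
have h0 := cm_ge0 h; have := cexp_taylor h.
have := cmD (cexp h - 1 - h) h; rewrite subrK.
have -> : 2 * cm h = cm h + cm h by ring.
rewrite expRD; have := expR_ge_1 h0; have := expR_ge_id (cm h).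
set E := expR _; set x := cm h in h0 * => a b c d.
have : x ^+ 2 * E <= x * (E * E) by rewrite expr2 -mulrA ler_wpM2l// ler_wpM2r//; lra.
have : x <= x * (E * E) by rewrite ler_peMr//; nra.
nra.
Qed.
End ComplexExp.

#[global] Opaque cexp.

(** * Complex differentiability with quadratic remainder *)

Section ComplexDerivative.
Variable R : realType.
Local Notation C := R[i].
Implicit Types (F G : C -> C) (z w f g : C).

(* A quadratic remainder, stronger than complex differentiability, keeps all
   estimates elementary and is stable under the operations used here. *)
Definition CD F z f := exists M d : R, [/\ 0 <= M, 0 < d &
  forall h, cm h <= d -> cm (F (z + h) - F z - f * h) <= M * cm h ^+ 2].

Lemma CD_lip F z f : CD F z f -> exists M d : R, [/\ 0 <= M, 0 < d &
  forall h, cm h <= d -> cm (F (z + h) - F z) <= M * cm h].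
Proof.
move=> [M [d [M0 d0 H]]]; exists (M * d + cm f), d; split => //.
  by rewrite addr_ge0 ?cm_ge0// mulr_ge0// ltW.
move=> h hd; have := H h hd; have := cmD (F (z + h) - F z - f * h) (f * h).
rewrite subrK cmM; have := cm_ge0 h => h0 a b.
have : M * cm h ^+ 2 <= M * d * cm h by rewrite expr2 mulrA ler_wpM2r// ler_wpM2l.
by lra.
Qed.

Lemma CD_eq F G z f g : (forall z, F z = G z) -> f = g -> CD F z f -> CD G z g.
Proof.
move=> FG <- [M [d [M0 d0 H]]]; exists M, d; split => // h /H.
by rewrite !FG.
Qed.

Lemma CD_cst (c z : C) : CD (fun=> c) z 0.
Proof.
by exists 0, 1; split => // h _; rewrite subrr mul0r subr0 cm0 mul0r.
Qed.

Lemma CD_id z : CD id z 1.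
Proof.
exists 0, 1; split => // h _.
by rewrite (_ : _ - _ = 0) ?cm0 ?mul0r//; ring.
Qed.

Lemma CD_add F G z f g : CD F z f -> CD G z g -> CD (fun z => F z + G z) z (f + g).
Proof.
move=> [M [d [M0 d0 H]]] [N [e [N0 e0 K]]].
exists (M + N), (Num.min d e); split; rewrite ?addr_ge0 ?lt_min ?d0//.
move=> h; rewrite le_min => /andP[hd he].
have -> : F (z + h) + G (z + h) - (F z + G z) - (f + g) * h =
  (F (z + h) - F z - f * h) + (G (z + h) - G z - g * h) by ring.
by apply: le_trans (cmD _ _) _; rewrite [leRHS]mulrDl lerD// ?H ?K.
Qed.

Lemma CD_scale (c : C) F z f : CD F z f -> CD (fun z => c * F z) z (c * f).
Proof.
move=> [M [d [M0 d0 H]]]; exists (cm c * M), d; split => //.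
  by rewrite mulr_ge0 ?cm_ge0.
move=> h hd; rewrite -mulrA -!mulrBr cmM -mulrA ler_wpM2l ?cm_ge0//; exact: H.
Qed.

Lemma CD_opp F z f : CD F z f -> CD (fun z => - F z) z (- f).
Proof. by move=> /(CD_scale (-1)); apply: CD_eq => [?|]; rewrite mulN1r. Qed.

Lemma CD_sub F G z f g : CD F z f -> CD G z g -> CD (fun z => F z - G z) z (f - g).
Proof. by move=> hF hG; apply: CD_add => //; exact: CD_opp. Qed.

Lemma CD_mul F G z f g : CD F z f -> CD G z g ->
  CD (fun z => F z * G z) z (f * G z + F z * g).
Proof.
move=> hF hG; have [L1 [d1 [L10 d10 HL1]]] := CD_lip hF.
have [L2 [d2 [L20 d20 HL2]]] := CD_lip hG.
case: hF hG => [M [d [M0 d0 H]]] [N [e [N0 e0 K]]].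
exists (M * cm (G z) + cm (F z) * N + L1 * L2), (Num.min (Num.min d e) (Num.min d1 d2)).
split; rewrite ?lt_min ?d0 ?e0 ?d10 ?d20//.
  by rewrite !addr_ge0// mulr_ge0// cm_ge0.
move=> h; rewrite !le_min => /andP[/andP[hd he] /andP[hd1 hd2]].
have -> : F (z + h) * G (z + h) - F z * G z - (f * G z + F z * g) * h =
  (F (z + h) - F z - f * h) * G z + F z * (G (z + h) - G z - g * h) +
  (F (z + h) - F z) * (G (z + h) - G z) by ring.
apply: le_trans (cmD _ _) _; rewrite [leRHS]mulrDl; apply: lerD.
  apply: le_trans (cmD _ _) _; rewrite [leRHS]mulrDl !cmM; apply: lerD.
    by rewrite mulrAC ler_wpM2r ?cm_ge0// H.
  by rewrite -mulrA ler_wpM2l ?cm_ge0// K.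
rewrite cmM expr2 mulrACA ler_pM ?cm_ge0//; [exact: HL1|exact: HL2].
Qed.

Lemma CD_comp G F z f g : CD F z f -> CD G (F z) g -> CD (fun z => G (F z)) z (g * f).
Proof.
move=> hF; have [L [d1 [L0 d10 HL]]] := CD_lip hF.
case: hF => [M [d [M0 d0 H]]] [N [e [N0 e0 K]]].
exists (N * L ^+ 2 + cm g * M), (Num.min (Num.min d d1) (e / (L + 1))).
have L1 : 0 < L + 1 by lra.
split; rewrite ?lt_min ?d0 ?d10 ?divr_gt0//.
  by rewrite addr_ge0// mulr_ge0 ?cm_ge0 ?sqr_ge0.
move=> h; rewrite !le_min ler_pdivlMr// => /andP[/andP[hd hd1] he].
set k := F (z + h) - F z.
have kL : cm k <= L * cm h by exact: HL.
have ke : cm k <= e by apply: le_trans kL _; have := cm_ge0 h; lra.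
have -> : F (z + h) = F z + k by rewrite /k; ring.
have -> : G (F z + k) - G (F z) - g * f * h =
  (G (F z + k) - G (F z) - g * k) + g * (k - f * h) by ring.
apply: le_trans (cmD _ _) _; rewrite [leRHS]mulrDl; apply: lerD.
  apply: le_trans (K _ ke) _; rewrite -mulrA ler_wpM2l// -exprMn.
  by rewrite lerXn2r ?nnegrE ?mulr_ge0 ?cm_ge0.
by rewrite cmM -mulrA ler_wpM2l ?cm_ge0// H.
Qed.

Lemma CD_exp F z f n : CD F z f -> CD (fun z => F z ^+ n.+1) z (n.+1%:R * F z ^+ n * f).
Proof.
move=> hF; elim: n => [|n IH].
  by apply: CD_eq hF => [w|]; [rewrite expr1|rewrite expr0 !mul1r].
apply: CD_eq (CD_mul hF IH) => [w|]; first by rewrite [RHS]exprS.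
by rewrite -[n.+2%:R]natr1 exprS; ring.
Qed.

Lemma CD_sum (I : Type) (r : seq I) (F : I -> C -> C) (f : I -> C) z :
  (forall i, CD (F i) z (f i)) ->
  CD (fun z => \sum_(i <- r) F i z) z (\sum_(i <- r) f i).
Proof.
move=> H; elim: r => [|i r IH].
  by rewrite big_nil; apply: CD_eq (CD_cst 0 z) => // w; rewrite big_nil.
rewrite big_cons; apply: CD_eq (CD_add (H i) IH) => // w.
by rewrite big_cons.
Qed.

Lemma CD_cexp z : CD (@cexp R) z (cexp z).
Proof.
exists (cm (cexp z) * 5), 2^-1; split; [by rewrite mulr_ge0 ?cm_ge0|by rewrite invr_gt0|].
move=> h hh; rewrite cexpD.
have -> : cexp z * cexp h - cexp z - cexp z * h = cexp z * (cexp h - 1 - h) by ring.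
by rewrite cmM -mulrA ler_wpM2l ?cm_ge0// cexp_taylor_small.
Qed.

Lemma CD_inv z : z != 0 -> CD (fun z => z^-1) z (- (z ^- 2)).
Proof.
move=> z0; have zz : 0 < cm z by rewrite cm_gt0.
exists (2 / cm z ^+ 3), (cm z / 2); split; rewrite ?divr_gt0 ?divr_ge0 ?exprn_ge0 ?cm_ge0//.
move=> h hh.
have zh : cm z / 2 <= cm (z + h).
  by have := cm_sub_le z (- h); rewrite cmN opprK; lra.
have zh0 : z + h != 0 by rewrite -cm_gt0; lra.
have -> : (z + h)^-1 - z^-1 - - z ^- 2 * h = h ^+ 2 / (z ^+ 2 * (z + h)).
  by field; rewrite z0 zh0.
rewrite cmM cmX cmV cmM cmX mulrC ler_wpM2r ?sqr_ge0//.
rewrite (_ : 2 / cm z ^+ 3 = (cm z ^+ 2 * (cm z / 2))^-1); last by field; rewrite gt_eqF.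
by rewrite lef_pV2 ?posrE ?mulr_gt0 ?exprn_gt0 ?ler_wpM2l ?sqr_ge0//; lra.
Qed.

Lemma CD_Re_derive F z0 w f (t : R) : CD F (z0 + (t%:C)%C * w) f ->
  is_derive t 1 (fun t => Re (F (z0 + (t%:C)%C * w))) (Re (f * w)).
Proof.
move=> [M [d [M0 d0 H]]]; have w1 : 0 < cm w + 1 by rewrite ltr_wpDl ?cm_ge0.
apply: (@quad_is_derive _ _ _ _ (M * cm w ^+ 2) (d / (cm w + 1))); first by rewrite divr_gt0.
move=> h; rewrite ler_pdivlMr// => hd.
have hw : cm ((h%:C)%C * w) <= d by rewrite cmM cm_real; have := normr_ge0 h; lra.
have := H _ hw; rewrite cmM cm_real exprMn real_normK ?num_real// => h1.
have -> : M * cm w ^+ 2 * h ^+ 2 = M * (h ^+ 2 * cm w ^+ 2) by ring.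
apply: le_trans h1.
apply: le_trans (cm_Re _); rewrite !ReB rmorphD mulrDl addrA.
by rewrite [f * (_ * _)]mulrCA Re_realM [_ * h]mulrC.
Qed.

Lemma CD_Im_derive F z0 w f (t : R) : CD F (z0 + (t%:C)%C * w) f ->
  is_derive t 1 (fun t => Im (F (z0 + (t%:C)%C * w))) (Im (f * w)).
Proof.
move=> /(CD_scale (- 'i%C)) /CD_Re_derive.
have E v : Re (- 'i%C * v) = Im v by case: v => a b /=; ring.
rewrite -mulrA E; suff -> : (fun t => Re (- 'i%C * F (z0 + (t%:C)%C * w))) =
  (fun t => Im (F (z0 + (t%:C)%C * w))) by [].
by apply/funext => x; rewrite E.
Qed.

(** The mean value theorem is applied to real and imaginary parts separately along the segment,
    which costs the factor 2. *)
Lemma CD_mvt F (f : C -> C) z0 z1 (K : R) :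
  (forall t : R, 0 <= t <= 1 -> CD F (z0 + (t%:C)%C * (z1 - z0)) (f (z0 + (t%:C)%C * (z1 - z0)))) ->
  (forall t : R, 0 <= t <= 1 -> cm (f (z0 + (t%:C)%C * (z1 - z0)) * (z1 - z0)) <= K) ->
  cm (F z1 - F z0) <= 2 * K.
Proof.
move=> H HK.
have [h1 h2] : (forall t : R, 0 <= t <= 1 -> is_derive t 1 (fun t => Re (F (z0 + (t%:C)%C * (z1 - z0))))
    (Re (f (z0 + (t%:C)%C * (z1 - z0)) * (z1 - z0)))) /\
  (forall t : R, 0 <= t <= 1 -> is_derive t 1 (fun t => Im (F (z0 + (t%:C)%C * (z1 - z0))))
    (Im (f (z0 + (t%:C)%C * (z1 - z0)) * (z1 - z0)))).
  by split=> t /H; [exact: CD_Re_derive|exact: CD_Im_derive].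
have k1 := mvt_bound ler01 h1 (fun t ht => le_trans (cm_Re _) (HK t ht)).
have k2 := mvt_bound ler01 h2 (fun t ht => le_trans (cm_Im _) (HK t ht)).
have e1 : z0 + (1%:C)%C * (z1 - z0) = z1 by rewrite rmorph1; ring.
have e0 : z0 + (0%:C)%C * (z1 - z0) = z0 by rewrite rmorph0; ring.
move: k1 k2; rewrite e1 e0 subr0 mulr1.
rewrite -ReB -ImB => k1 k2; apply: le_trans (cm_ReIm _) _; lra.
Qed.

Lemma CD_zero_const F z0 z1 :
  (forall t : R, 0 <= t <= 1 -> CD F (z0 + (t%:C)%C * (z1 - z0)) 0) -> F z1 = F z0.
Proof.
move=> H; apply/eqP; rewrite -subr_eq0 -cm_eq0 eq_le cm_ge0 andbT.
have := @CD_mvt F (fun=> 0) z0 z1 0 H; rewrite mulr0; apply => t _.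
by rewrite mul0r cm0.
Qed.
End ComplexDerivative.

(** * The Euler product and the q-binomial theorem *)

Section EulerProduct.
Variable R : realType.
Local Notation C := R[i].
Implicit Types (p q x y : C).

Lemma ccvg_telescope (u : nat -> C) (b : nat -> R) : summ b ->
  (forall n, cm (u n.+1 - u n) <= b n) -> exists l, ccvg u l.
Proof.
move=> sb ub; have [l hl] := summ_csumto sb ub.
exists (l + u 0%N); apply: ccvg_eq (ccvgD hl (ccvg_cst (u 0%N))) => n.
elim: n => [|n IH]; first by rewrite big_ord0 add0r.
by rewrite big_ord_recr/= addrAC IH addrC subrK.
Qed.

Definition Eu (N : nat) q := \prod_(k < N) (1 - q ^+ k.+1).
Definition Eul q := clim (fun N => Eu N q).

Lemma Eu_le N q : cm q < 1 -> cm (Eu N q) <= expR (1 - cm q)^-1.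
Proof.
move=> q1; have q0 := cm_ge0 q.
have r01 : 0 <= cm q < 1 by rewrite q0.
have : cm (Eu N q) <= expR (\sum_(k < N) cm q ^+ k).
  rewrite cm_prod; elim: N => [|N IH]; first by rewrite !big_ord0 expR0.
  rewrite !big_ord_recr/= expRD ler_pM ?cm_ge0//; first by apply: prodr_ge0 => *; exact: cm_ge0.
  apply: le_trans (cmB _ _) _; rewrite cm1 cmX; apply: le_trans (expR_ge1Dx _).
  by rewrite lerD2l exprS ler_piMl ?exprn_ge0// ltW.
move/le_trans; apply; rewrite ler_expR.
rewrite -[leRHS]mul1r ler_pdivlMr ?subr_gt0//.
by have := subrX1 (cm q) N; have := exprn_ge0 N q0; lra.
Qed.

(** Each factor satisfies 1 - a >= exp (- a / (1 - a)), because 1/(1 - a) = 1 + a/(1 - a) <= exp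
    (a/(1 - a)). The bound does not depend on [N], so the infinite product is nonzero. *)
Lemma Eu_ge N q : cm q < 1 -> expR (- (1 - cm q) ^- 2) <= cm (Eu N q).
Proof.
move=> q1; have q0 := cm_ge0 q; have d0 : 0 < 1 - cm q by rewrite subr_gt0.
have : expR (- ((1 - cm q)^-1 * \sum_(k < N) cm q ^+ k)) <= cm (Eu N q).
  rewrite cm_prod mulr_sumr -sumrN.
  elim: N => [|N IH]; first by rewrite !big_ord0 expR0.
  rewrite !big_ord_recr/= expRD ler_pM ?expR_ge0//.
  apply: le_trans (cm_sub_le _ _); rewrite cm1 cmX.
  set a := cm q ^+ N.+1.
  have aq : a <= cm q by rewrite /a exprS ler_piMr// exprn_ile1// ltW.
  have a0 : 0 <= a by exact: exprn_ge0.
  have a1 : 0 < 1 - a by lra.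
  have e1 : 1 + a / (1 - a) = (1 - a)^-1.
    by clearbody a; field; rewrite gt_eqF.
  apply: (@le_trans _ _ (expR (- (a / (1 - a))))).
    rewrite ler_expR lerN2 mulrC; apply: ler_pM => //; first by rewrite invr_ge0 ltW.
      by rewrite lef_pV2 ?posrE//; lra.
    by rewrite /a exprS ler_piMl ?exprn_ge0// ltW.
  rewrite expRN -[leRHS]invrK lef_pV2 ?posrE ?expR_gt0 ?invr_gt0//.
  apply: le_trans (expR_ge1Dx _).
  by rewrite e1.
move=> h; apply: le_trans h; rewrite ler_expR lerN2.
rewrite expr2 invfM; apply: ler_wpM2l; first by rewrite invr_ge0 ltW.
rewrite -[leRHS]mul1r ler_pdivlMr//.
by have := subrX1 (cm q) N; have := exprn_ge0 N q0; lra.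
Qed.

Lemma Eu_neq0 N q : cm q < 1 -> Eu N q != 0.
Proof.
by move=> q1; rewrite -cm_gt0; apply: lt_le_trans (Eu_ge N q1); exact: expR_gt0.
Qed.

Lemma EuS N q : Eu N.+1 q = Eu N q * (1 - q ^+ N.+1).
Proof. by rewrite /Eu big_ord_recr. Qed.

Lemma Eu_cvg q : cm q < 1 -> ccvg (fun N => Eu N q) (Eul q).
Proof.
move=> q1; have q01 : 0 <= cm q < 1 by rewrite cm_ge0.
have := summZ (expR_ge0 (1 - cm q)^-1) (summ_geom q01).
move=> /(@ccvg_telescope (fun N => Eu N q)) h.
have [|l hl] := h; last exact: climP hl.
move=> n; rewrite EuS (_ : _ - _ = - (Eu n q * q ^+ n.+1)); last by ring.
rewrite cmN cmM ler_pM ?cm_ge0 ?Eu_le// cmX exprS ler_piMl ?exprn_ge0 ?cm_ge0//.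
exact: ltW.
Qed.

Lemma Eul_neq0 q : cm q < 1 -> Eul q != 0.
Proof.
move=> q1; rewrite -cm_gt0; apply: lt_le_trans (expR_gt0 (- (1 - cm q) ^- 2)) _.
by apply: ccvg_ge (Eu_cvg q1) => n; exact: Eu_ge.
Qed.

Lemma cmX_lt1 q n : cm q < 1 -> cm (q ^+ n.+1) < 1.
Proof. by move=> q1; rewrite cmX exprn_ilt1 ?cm_ge0. Qed.

Definition Odd (N : nat) q := \prod_(k < N) (1 - q ^+ k.*2.+1).

Lemma EuOdd N q : Eu N.*2 q = Odd N q * Eu N (q ^+ 2).
Proof.
elim: N => [|N IH]; first by rewrite /Eu /Odd !big_ord0 mul1r.
rewrite doubleS !EuS IH /Odd big_ord_recr/= -exprM mul2n doubleS; ring.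
Qed.

Lemma Odd_cvg q : cm q < 1 -> ccvg (Odd^~ q) (Eul q / Eul (q ^+ 2)).
Proof.
move=> q1; have q2 := cmX_lt1 1 q1.
have h := ccvgM (ccvg_comp (Eu_cvg q1) (f := double) _) (ccvgV (Eul_neq0 q2) (Eu_cvg q2)).
apply: ccvg_eq (h _) => [n|n]; first by rewrite EuOdd mulfK ?Eu_neq0.
by rewrite -addnn leq_addr.
Qed.

(** From (1 + x)(1 - x) = 1 - x^2 for each odd power x of q: the product is the quotient of [Odd] at
    q^2 by [Odd] at q. *)
Lemma OddN_cvg q : cm q < 1 ->
  ccvg (fun N => \prod_(k < N) (1 + q ^+ k.*2.+1)) (Eul (q ^+ 2) ^+ 2 / (Eul q * Eul (q ^+ 4))).
Proof.
move=> q1; have q2 := cmX_lt1 1 q1; have q4 := cmX_lt1 3 q1.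
have OddN0 N : Odd N q != 0.
  have := Eu_neq0 N.*2 q1; rewrite EuOdd mulf_eq0 negb_or => /andP[]//.
have l0 : Eul q / Eul (q ^+ 2) != 0 by rewrite mulf_neq0 ?invr_eq0 ?Eul_neq0.
have h := ccvgM (Odd_cvg q2) (ccvgV l0 (Odd_cvg q1)).
have -> : Eul (q ^+ 2) ^+ 2 / (Eul q * Eul (q ^+ 4)) =
  Eul (q ^+ 2) / Eul ((q ^+ 2) ^+ 2) / (Eul q / Eul (q ^+ 2)).
  have -> : (q ^+ 2) ^+ 2 = q ^+ 4 by rewrite -exprM.
  move: (Eul_neq0 q1) (Eul_neq0 q2) (Eul_neq0 q4).
  move: (Eul q) (Eul (q ^+ 2)) (Eul (q ^+ 4)) => a b c a0 b0 c0.
  by field; rewrite a0 b0 c0.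
apply: ccvg_eq h => n; apply: (mulIf (OddN0 n)); rewrite mulfVK//.
rewrite /Odd -big_split/=; apply: eq_bigr => k _.
by rewrite -exprM mulnC exprM; ring.
Qed.

Lemma Pos_cvg q : cm q < 1 ->
  ccvg (fun N => \prod_(k < N) (1 + q ^+ k.+1)) (Eul (q ^+ 2) / Eul q).
Proof.
move=> q1; have q2 := cmX_lt1 1 q1.
apply: ccvg_eq (ccvgM (Eu_cvg q2) (ccvgV (Eul_neq0 q1) (Eu_cvg q1))) => n.
apply: (mulIf (Eu_neq0 n q1)); rewrite mulfVK ?Eu_neq0//.
rewrite /Eu -big_split/=; apply: eq_bigr => k _.
by rewrite -exprM mulnC exprM; ring.
Qed.

(** Gaussian binomial coefficient. The value 0 for j > n makes Pascal's rule hold up to the boundary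
    j = n. *)
Definition qb q n j := if (j <= n)%N then Eu n q / (Eu j q * Eu (n - j) q) else 0.

Lemma qb_pascal q n j : cm q < 1 -> (j <= n)%N ->
  qb q n.+1 j.+1 = qb q n j.+1 + q ^+ (n - j) * qb q n j.
Proof.
move=> q1 jn; rewrite /qb ltnS jn subSS; have [jn'|nj] := ltnP j n; last first.
  have -> : j = n by apply/eqP; rewrite eqn_leq jn nj.
  by rewrite subnn add0r expr0 mul1r /Eu !big_ord0 !mulr1 !divff// Eu_neq0.
have -> : (n - j = (n - j.+1).+1)%N by rewrite subnSK.
set m := (n - j.+1)%N.
have -> : n = (j + m.+1)%N by rewrite /m subnSK// subnKC.
rewrite !EuS.
have k1 k : 1 - q ^+ k.+1 != 0.
  have := Eu_neq0 k.+1 q1; rewrite EuS mulf_eq0 negb_or => /andP[]//.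
have -> : q ^+ (j + m.+1).+1 = q ^+ j.+1 * q ^+ m.+1 by rewrite -exprD addSn.
by field; rewrite !k1 !Eu_neq0.
Qed.

Lemma qb0 q n : cm q < 1 -> qb q n 0 = 1.
Proof. by move=> q1; rewrite /qb/= subn0 /Eu big_ord0 mul1r divff// Eu_neq0. Qed.

(** Stated with q = p^2, so that the exponent j (j - 1) / 2 of q becomes j (j - 1) for p. *)
Lemma qbinomial p y n : cm p < 1 ->
  \prod_(k < n) (1 + y * p ^+ (2 * k)) =
  \sum_(j < n.+1) qb (p ^+ 2) n j * p ^+ (j * j.-1) * y ^+ j.
Proof.
move=> p1; have q1 := cmX_lt1 1 p1.
elim: n => [|n IH].
  by rewrite big_ord0 big_ord_recr big_ord0/= qb0// !expr0 add0r !mulr1.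
rewrite big_ord_recr/= IH [RHS]big_ord_recl/= qb0// expr0 expr0 !mulr1.
rewrite mulrDr mulr1 mulr_suml.
have -> : \sum_(i < n.+1) qb (p ^+ 2) n.+1 (bump 0 i) * p ^+ (bump 0 i * (bump 0 i).-1) * y ^+ bump 0 i
  = \sum_(i < n.+1) (qb (p ^+ 2) n i.+1 * p ^+ (i.+1 * i) * y ^+ i.+1) +
    \sum_(i < n.+1) (qb (p ^+ 2) n i * p ^+ (i * i.-1) * y ^+ i * (y * p ^+ (2 * n))).
  rewrite -big_split/=; apply: eq_bigr => i _; rewrite /bump/= add1n/=.
  have ile : (i <= n)%N by rewrite -ltnS.
  rewrite qb_pascal// -exprM mulrDl mulrDl; congr (_ + _).
  have -> : p ^+ (i.+1 * i) = p ^+ (i * i.-1) * p ^+ (2 * i).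
    rewrite -exprD; congr (_ ^+ _); case: (nat_of_ord i) => //= k; lia.
  have -> : p ^+ (2 * n) = p ^+ (2 * i) * p ^+ (2 * (n - i)).
    by rewrite -exprD -mulnDr subnKC.
  rewrite [y ^+ _.+1]exprS; ring.
rewrite addrA; congr (_ + _).
rewrite big_ord_recl/= qb0// expr0 expr0 !mulr1; congr (_ + _).
rewrite [RHS]big_ord_recr/= [qb _ n n.+1]/qb ltnn !mul0r addr0.
by apply: eq_bigr => i _.
Qed.
End EulerProduct.

#[global] Opaque Eul.

(** * The Jacobi triple product *)

Section TripleProduct.
Variable R : realType.
Local Notation C := R[i].
Implicit Types (p q x y : C).

Lemma ccvg_comp_infty (u : nat -> C) l (f : nat -> nat) :
  ccvg u l -> (forall m, exists N, forall n, (N <= n)%N -> (m <= f n)%N) ->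
  ccvg (fun n => u (f n)) l.
Proof.
move=> hu hf e e0; have [M HM] := hu _ e0; have [N HN] := hf M.
by exists N => n /HN /HM.
Qed.

(** The general term is (r^i X)^i, and r^i X <= 1/2 from some index [K] on; the constant (2 (1 +
    X))^K covers the earlier terms. *)
Lemma summ_gauss (r X : R) : 0 <= r < 1 -> 0 <= X ->
  summ (fun i => r ^+ (i * i) * X ^+ i).
Proof.
move=> r01 X0; have /andP[r0 r1] := r01.
have h2 : 0 < 2^-1 :> R by rewrite invr_gt0.
have [K HK] := tends0_geom X r01 h2.
apply: (@summ_le _ _ (fun k => (2 * (1 + X)) ^+ K * 2^-1 ^+ k)); last first.
  apply: summZ; first by rewrite exprn_ge0// mulr_ge0// addr_ge0.
  by apply: summ_geom; lra.
move=> k; rewrite mulr_ge0 ?exprn_ge0//= exprM -exprMn.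
have rk : 0 <= r ^+ k by rewrite exprn_ge0.
have X1 : 1 <= 2 * (1 + X) by lra.
have [Kk|kK] := leqP K k.
  apply: (@le_trans _ _ (2^-1 ^+ k)); last by rewrite ler_peMl ?exprn_ege1// exprn_ge0// invr_ge0.
  rewrite lerXn2r ?nnegrE ?mulr_ge0 ?invr_ge0//.
  by rewrite mulrC ltW ?HK.
have : (r ^+ k * X) ^+ k <= (1 + X) ^+ k.
  rewrite lerXn2r ?nnegrE ?mulr_ge0 ?addr_ge0//.
  apply: le_trans (_ : X <= _); last by lra.
  by rewrite ler_piMl// exprn_ile1// ltW.
move/le_trans; apply.
apply: (@le_trans _ _ ((2 * (1 + X)) ^+ k * 2^-1 ^+ k)).
  by rewrite -exprMn mulrAC divff ?mul1r// pnatr_eq0.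
by rewrite ler_wpM2r ?exprn_ge0 ?invr_ge0// ler_weXn2l// ltnW.
Qed.

Lemma sum_sym (V : zmodType) (g : nat -> V) N :
  \sum_(j < (2 * N).+1) g j = g N + \sum_(i < N) (g (N + i.+1)%N + g (N - i.+1)%N).
Proof.
have -> : ((2 * N).+1 = N + N.+1)%N by lia.
rewrite big_split_ord/= big_split/= [X in _ + X]big_ord_recl/= addn0.
rewrite addrCA; congr (_ + _); rewrite addrC; congr (_ + _).
by rewrite (reindex_inj rev_ord_inj)/=.
Qed.

Lemma prod_sym (F : comRingType) (g : nat -> F) N :
  \prod_(j < 2 * N) g j = \prod_(i < N) (g (N + i)%N * g (N - i.+1)%N).
Proof.
have -> : (2 * N = N + N)%N by lia.
rewrite big_split_ord/= big_split/= mulrC; congr (_ * _).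
by rewrite (reindex_inj rev_ord_inj)/=.
Qed.

Lemma qb_sym q n j : (j <= n)%N -> qb q n (n - j) = qb q n j.
Proof. by move=> jn; rewrite /qb jn leq_subr subKn//; congr (_ / _); exact: mulrC. Qed.

(** The q-binomial theorem with 2N factors and y = x / p^(2N-1). The factor of index N + i is 1 + x
    p^(2i+1); that of index N - i - 1 is 1 + x / p^(2i+1), which is x / p^(2i+1) times 1 + p^(2i+1)
    / x. *)
Lemma triple_finite p x N : p != 0 -> x != 0 -> cm p < 1 ->
  \prod_(i < N) ((1 + x * p ^+ (2 * i + 1)) * (1 + x^-1 * p ^+ (2 * i + 1))) =
  qb (p ^+ 2) (2 * N) N + \sum_(i < N) qb (p ^+ 2) (2 * N) (N + i.+1) *
    (p ^+ (i.+1 * i.+1) * (x ^+ i.+1 + x^-1 ^+ i.+1)).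
Proof.
move=> p0 x0 p1; case: N => [|M].
  by rewrite !big_ord0 addr0 qb0//; exact: cmX_lt1.
have pp n : \prod_(i < n) p ^+ (2 * i + 1) = p ^+ (n * n).
  elim: n => [|n IH]; first by rewrite big_ord0.
  by rewrite big_ord_recr/= IH -exprD; congr (_ ^+ _); lia.
set N := M.+1; have := qbinomial (x / p ^+ (2 * M + 1)) (2 * N) p1.
rewrite (prod_sym (fun k => 1 + _ * p ^+ (2 * k))).
move=> e.
have pn n : p ^+ n != 0 by rewrite expf_neq0.
have xn n : x ^+ n != 0 by rewrite expf_neq0.
have -> : \prod_(i < N) ((1 + x * p ^+ (2 * i + 1)) * (1 + x^-1 * p ^+ (2 * i + 1))) =
   (p ^+ (N * N) / x ^+ N) * \prod_(i < N) ((1 + x / p ^+ (2 * M + 1) * p ^+ (2 * (N + i)))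
      * (1 + x / p ^+ (2 * M + 1) * p ^+ (2 * (N - i.+1)))).
  have -> : p ^+ (N * N) / x ^+ N = \prod_(i < N) (p ^+ (2 * i + 1) / x).
    by rewrite -pp big_split/= prodr_const card_ord exprVn.
  rewrite -big_split/=; apply: eq_bigr => i _.
  have -> : x / p ^+ (2 * M + 1) * p ^+ (2 * (N + i)) = x * p ^+ (2 * i + 1).
    have -> : (2 * (N + i) = (2 * i + 1) + (2 * M + 1))%N by rewrite /N; lia.
    rewrite (exprD p (2 * i + 1)); move: (pn (2 * M + 1)%N).
    by move: (p ^+ (2 * M + 1)) (p ^+ _) => u v u0; field.
  have -> : x / p ^+ (2 * M + 1) * p ^+ (2 * (N - i.+1)) = x / p ^+ (2 * i + 1).
    have -> : (2 * M + 1 = 2 * (N - i.+1) + (2 * i + 1))%N.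
      by have := ltn_ord i; rewrite /N; lia.
    rewrite (exprD p (2 * (N - i.+1))); move: (pn (2 * (N - i.+1))%N) (pn (2 * i + 1)%N).
    by move: (p ^+ (2 * (N - i.+1))) (p ^+ _) => u v u0 v0; field; rewrite u0 v0.
  rewrite [RHS]mulrCA; congr (_ * _); move: (pn (2 * i + 1)%N).
  by move: (p ^+ _) => u u0; field; rewrite u0 x0.
rewrite e (sum_sym (fun j => qb (p ^+ 2) (2 * N) j * p ^+ (j * j.-1) * (x / p ^+ (2 * M + 1)) ^+ j)).
rewrite mulrDr mulr_sumr.
(* Completion of the square: N^2 + j (j - 1) - (2N - 1) j = (j - N)^2, so [i] is the distance from
   [j] to [N]. *)
have gE i j : ((N * N + j * j.-1) = (i * i) + (2 * M + 1) * j)%N ->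
   p ^+ (N * N) / x ^+ N * (qb (p ^+ 2) (2 * N) j * p ^+ (j * j.-1) * (x / p ^+ (2 * M + 1)) ^+ j) =
   qb (p ^+ 2) (2 * N) j * (p ^+ (i * i) * (x ^+ j / x ^+ N)).
  move=> ij; have : p ^+ (N * N) * p ^+ (j * j.-1) = p ^+ (i * i) * (p ^+ (2 * M + 1)) ^+ j.
    by rewrite -exprM -!exprD ij.
  rewrite exprMn exprVn; set Q := qb _ _ _; move: (xn N) (xn j) (pn (2 * M + 1)%N).
  move: (x ^+ N) (x ^+ j) (p ^+ (2 * M + 1)) => a b c a0 b0 c0.
  have := expf_neq0 j c0; move: (c ^+ j) (p ^+ (N * N)) (p ^+ (j * j.-1)) (p ^+ (i * i)) => u v w t u0 h.
  have -> : v / a * (Q * w * (b / u)) = Q * (v * w) * b / (a * u) by field; rewrite a0 u0.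
  by rewrite h; field; rewrite a0 u0.
congr (_ + _).
  by rewrite (gE 0%N)/=; [rewrite expr0 mul1r divff// mulr1|rewrite /N; lia].
apply: eq_bigr => i _; have iN := ltn_ord i.
rewrite mulrDr (gE i.+1)/=; last by rewrite /N; nia.
rewrite (gE i.+1)/=; last first.
  have -> : (N - i.+1 = M - i)%N by rewrite /N subSS.
  rewrite /N in iN *; move: (nat_of_ord i) iN => j jM.
  have [k ->] : exists k, M = (j + k)%N by exists (M - j)%N; rewrite subnKC// -ltnS.
  by rewrite addKn; case: k => [|k] /=; nia.
have -> : qb (p ^+ 2) (2 * N) (N - i.+1) = qb (p ^+ 2) (2 * N) (N + i.+1).
  rewrite -[RHS]qb_sym; last by lia.
  by congr (qb _ _ _); lia.
rewrite -mulrDr -mulrDr; congr (_ * (_ * (_ + _))).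
  by rewrite exprD; field; rewrite xn.
have -> : x ^+ N = x ^+ (N - i.+1) * x ^+ i.+1 by rewrite -exprD subnK.
rewrite exprVn; move: (xn (N - i.+1)%N) (xn i.+1).
by move: (x ^+ (N - i.+1)) (x ^+ i.+1) => a b a0 b0; field; rewrite a0 b0.
Qed.

Lemma qb_cvg p i : cm p < 1 ->
  ccvg (fun N => qb p (2 * N) (N + i)) (Eul p)^-1.
Proof.
move=> p1; have E0 := Eul_neq0 p1; have EC := Eu_cvg p1.
have h1 : ccvg (fun N => Eu (2 * N) p) (Eul p).
  by apply: (ccvg_comp EC) => n; lia.
have h2 : ccvg (fun N => Eu (N + i) p) (Eul p).
  by apply: (ccvg_comp EC) => n; lia.
have h3 : ccvg (fun N => Eu (2 * N - (N + i)) p) (Eul p).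
  by apply: (ccvg_comp_infty EC) => m; exists (m + i)%N => n; lia.
have := ccvgM h1 (ccvgV (mulf_neq0 E0 E0) (ccvgM h2 h3)).
have -> : Eul p / (Eul p * Eul p) = (Eul p)^-1 by field.
apply: (ccvg_ext (N0 := i)) => n ni.
by rewrite /qb; have -> : (n + i <= 2 * n)%N by lia.
Qed.

Lemma qb_bound p : cm p < 1 -> exists K : R, forall n j, cm (qb p n j) <= K.
Proof.
move=> p1; set c := expR (- (1 - cm p) ^- 2); set B := expR (1 - cm p)^-1.
have c0 : 0 < c by exact: expR_gt0.
exists (B / c ^+ 2) => n j; rewrite /qb; case: ifP => _; last first.
  by rewrite cm0 divr_ge0 ?expR_ge0// sqr_ge0.
rewrite cmM cmV cmM; apply: ler_pM; rewrite ?cm_ge0 ?invr_ge0 ?mulr_ge0 ?cm_ge0//.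
  exact: Eu_le.
rewrite lef_pV2 ?posrE ?exprn_gt0 ?mulr_gt0 ?cm_gt0 ?Eu_neq0//.
by rewrite expr2; apply: ler_pM; [exact: ltW|exact: ltW|exact: Eu_ge|exact: Eu_ge].
Qed.

Lemma triple_term_summ p x : cm p < 1 ->
  summ (fun i => cm (p ^+ (i.+1 * i.+1) * (x ^+ i.+1 + x^-1 ^+ i.+1))).
Proof.
move=> p1; have p01 : 0 <= cm p < 1 by rewrite cm_ge0.
have h := summD (summ_gauss p01 (cm_ge0 x)) (summ_gauss p01 (cm_ge0 x^-1)).
have h' : summ (fun i => cm p ^+ (i.+1 * i.+1) * cm x ^+ i.+1 +
    cm p ^+ (i.+1 * i.+1) * cm x^-1 ^+ i.+1).
  case: h => [h0 [S HS]]; split; first by move=> k; exact: (h0 k.+1).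
  exists S => n; apply: le_trans (HS n.+1); rewrite [leRHS]big_ord_recl/=.
  by rewrite lerDr; exact: (h0 0%N).
apply: summ_le h' => i; rewrite cm_ge0/= cmM cmX -mulrDr ler_wpM2l ?exprn_ge0 ?cm_ge0//.
by rewrite -!cmX; exact: cmD.
Qed.

(** The limit of [triple_finite]: the coefficients [qb] are uniformly bounded and those near the
    middle tend to 1 / Eul (p^2). *)
Lemma triple_product p x l : p != 0 -> x != 0 -> cm p < 1 ->
  csumto (fun i => p ^+ (i.+1 * i.+1) * (x ^+ i.+1 + x^-1 ^+ i.+1)) l ->
  ccvg (fun N => \prod_(i < N) ((1 + x * p ^+ (2 * i + 1)) * (1 + x^-1 * p ^+ (2 * i + 1))))
    ((Eul (p ^+ 2))^-1 * (1 + l)).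
Proof.
move=> p0 x0 p1 hl; have q1 := cmX_lt1 1 p1; have [K HK] := qb_bound q1.
have K0 : 0 <= K by apply: le_trans (HK 0%N 0%N); exact: cm_ge0.
pose t i := p ^+ (i.+1 * i.+1) * (x ^+ i.+1 + x^-1 ^+ i.+1).
have b1 n k : (k < n)%N -> cm (qb (p ^+ 2) (2 * n) (n + k.+1) * t k) <= K * cm (t k).
  by move=> _; rewrite cmM ler_wpM2r ?cm_ge0.
have c1 k : ccvg (fun n => qb (p ^+ 2) (2 * n) (n + k.+1) * t k) ((Eul (p ^+ 2))^-1 * t k).
  rewrite mulrC; apply: ccvg_eq (ccvgZ (t k) (qb_cvg k.+1 q1)) => n.
  exact: mulrC.
have h := tannery_fin (a := fun n k => qb (p ^+ 2) (2 * n) (n + k.+1) * t k) (K := id)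
  (summZ K0 (triple_term_summ x p1)) b1 (fun n => leqnn n) c1 (csumtoZ _ hl).
rewrite mulrDr mulr1; apply: ccvg_eq (ccvgD (qb_cvg 0 q1) h) => n.
by rewrite triple_finite// addn0.
Qed.
End TripleProduct.

(** * Theta constants as quotients of Euler products *)

Section Theta.
Variable R : realType.
Local Notation C := R[i].
Implicit Types (p q x y : C).

(* Theta constants in the nome p: th3 p is the sum of p^(n^2) over the integers,
   theta_4 is th3 (- p), and theta_2 is 2 p^(1/4) ps p. *)
Definition th3 p := 1 + 2 * csum (fun i => p ^+ (i.+1 * i.+1)).
Lemma th3_def p : th3 p = 1 + 2 * csum (fun i => p ^+ (i.+1 * i.+1)).
Proof. by []. Qed.

Definition ps p := csum (fun i => p ^+ (i * i.+1)).

Lemma square_summ p : cm p < 1 -> summ (fun i => cm p ^+ (i * i)).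
Proof.
move=> p1; have p01 : 0 <= cm p < 1 by rewrite cm_ge0.
apply: summ_le (summ_gauss p01 ler01) => i.
by rewrite expr1n mulr1 exprn_ge0 ?cm_ge0/=.
Qed.

Lemma th3_csum p : cm p < 1 ->
  csumto (fun i => p ^+ (i.+1 * i.+1)) (csum (fun i => p ^+ (i.+1 * i.+1))).
Proof.
move=> p1; have [|l hl] := summ_csumto (a := fun i => p ^+ (i.+1 * i.+1)) (square_summ p1).
  move=> k; rewrite cmX; apply: ler_wiXn2l; rewrite ?cm_ge0 ?ltW//; lia.
exact: csumP hl.
Qed.

Lemma ps_csum p : cm p < 1 -> csumto (fun i => p ^+ (i * i.+1)) (ps p).
Proof.
move=> p1; have [|l hl] := summ_csumto (a := fun i => p ^+ (i * i.+1)) (square_summ p1).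
  move=> k; rewrite cmX; apply: ler_wiXn2l; rewrite ?cm_ge0 ?ltW//; lia.
exact: csumP hl.
Qed.

Lemma th3E p : p != 0 -> cm p < 1 ->
  th3 p = Eul (p ^+ 2) ^+ 5 / (Eul p ^+ 2 * Eul (p ^+ 4) ^+ 2).
Proof.
move=> p0 p1; have E0 := Eul_neq0 p1.
have E2 := Eul_neq0 (cmX_lt1 1 p1); have E4 := Eul_neq0 (cmX_lt1 3 p1).
have h : csumto (fun i => p ^+ (i.+1 * i.+1) * (1 ^+ i.+1 + 1^-1 ^+ i.+1))
    (2 * csum (fun i => p ^+ (i.+1 * i.+1))).
  apply: csumto_eq (csumtoZ 2 (th3_csum p1)) => i.
  by rewrite invr1 !expr1n; ring.
have := triple_product p0 (oner_neq0 _) p1 h; rewrite -/(th3 p).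
have h2 : ccvg (fun N => \prod_(i < N) ((1 + 1 * p ^+ (2 * i + 1)) * (1 + 1^-1 * p ^+ (2 * i + 1))))
    ((Eul (p ^+ 2) ^+ 2 / (Eul p * Eul (p ^+ 4))) ^+ 2).
  apply: ccvg_eq (ccvgX 2 (OddN_cvg p1)) => N; rewrite -prodrXl.
  apply: eq_bigr => i _; rewrite invr1 !mul1r expr2.
  by have -> : ((i : nat).*2.+1 = 2 * i + 1)%N by lia.
move=> /ccvg_uniq/(_ h2); move: E0 E2 E4; move: (Eul p) (Eul (p ^+ 2)) (Eul (p ^+ 4)) => a b c a0 b0 c0 e.
have -> : th3 p = b * (b^-1 * th3 p) by field.
by rewrite e; field; rewrite a0 c0.
Qed.

Lemma EulN p : cm p < 1 -> Eul (- p) = Eul (p ^+ 2) ^+ 3 / (Eul p * Eul (p ^+ 4)).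
Proof.
move=> p1; have E0 := Eul_neq0 p1.
have E2 := Eul_neq0 (cmX_lt1 1 p1); have E4 := Eul_neq0 (cmX_lt1 3 p1).
have q1 : cm (- p) < 1 by rewrite cmN.
have := Odd_cvg q1; rewrite sqrrN.
have h : ccvg (fun N => Odd N (- p)) (Eul (p ^+ 2) ^+ 2 / (Eul p * Eul (p ^+ 4))).
  apply: ccvg_eq (OddN_cvg p1) => N; rewrite /Odd; apply: eq_bigr => k _.
  by rewrite [in RHS]exprNn -signr_odd/= odd_double expr1 mulN1r opprK.
move=> /ccvg_uniq/(_ h) e.
have := congr1 (fun z => z * Eul (p ^+ 2)) e; rewrite /= (divfK E2) => ->.
move: E0 E2 E4; move: (Eul p) (Eul (p ^+ 2)) (Eul (p ^+ 4)) => a b c a0 b0 c0.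
by field; rewrite ?a0 ?b0 ?c0.
Qed.

Lemma th3NE p : p != 0 -> cm p < 1 -> th3 (- p) = Eul p ^+ 2 / Eul (p ^+ 2).
Proof.
move=> p0 p1; have E0 := Eul_neq0 p1.
have E2 := Eul_neq0 (cmX_lt1 1 p1); have E4 := Eul_neq0 (cmX_lt1 3 p1).
rewrite th3E ?oppr_eq0 ?cmN// EulN// sqrrN (exprNn p 4) -signr_odd expr0 mul1r.
move: E0 E2 E4; move: (Eul p) (Eul (p ^+ 2)) (Eul _) => a b c a0 b0 c0.
by field; rewrite ?a0 ?b0 ?c0.
Qed.

(** The triple product at x = p. The two halves of its series are both [ps p], one of them without
    its first term; on the product side the first factor 1 + p / p is 2. *)
Lemma psE p : p != 0 -> cm p < 1 -> ps p = Eul (p ^+ 4) ^+ 2 / Eul (p ^+ 2).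
Proof.
move=> p0 p1; have q1 := cmX_lt1 1 p1.
have E2 := Eul_neq0 q1; have E4 := Eul_neq0 (cmX_lt1 3 p1).
have h : csumto (fun i => p ^+ (i.+1 * i.+1) * (p ^+ i.+1 + p^-1 ^+ i.+1)) (2 * ps p - 1).
  have := csumtoD (ps_csum p1) (csumto_shift (ps_csum p1)).
  have -> : ps p + (ps p - p ^+ (0 * 1)) = 2 * ps p - 1 by rewrite mul0n expr0; ring.
  apply: csumto_eq => i; rewrite mulrDr -exprD addrC; congr (_ + _).
    by congr (_ ^+ _); lia.
  rewrite exprVn; have -> : (i.+1 * i.+1 = i * i.+1 + i.+1)%N by lia.
  by rewrite exprD mulfK// expf_neq0.
have := triple_product p0 p0 p1 h; rewrite [1 + _]addrC subrK.
have h2 : ccvg (fun N => \prod_(i < N) ((1 + p * p ^+ (2 * i + 1)) * (1 + p^-1 * p ^+ (2 * i + 1))))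
    (2 * (Eul (p ^+ 4) / Eul (p ^+ 2)) ^+ 2).
  have e4 : p ^+ 4 = (p ^+ 2) ^+ 2 by rewrite -exprM.
  have Q := ccvgX 2 (Pos_cvg q1); rewrite -e4 in Q.
  have inv N : 1 + (p ^+ 2) ^+ N.+1 != 0.
    rewrite -cm_gt0; have := cm_sub_le 1 (- ((p ^+ 2) ^+ N.+1)).
    by rewrite opprK cm1 cmN; have := cmX_lt1 N q1; lra.
  have one : ccvg (fun N => 1 + (p ^+ 2) ^+ N) (1 : C).
    apply: (@ccvg_squeeze _ _ _ (fun n => 1 * cm (p ^+ 2) ^+ n) 0%N) => [n _|].
      by rewrite addrC addKr cmX mul1r.
    by apply: tends0_geom; rewrite cm_ge0.
  have := ccvgM (ccvgZ 2 Q) (ccvgV (oner_neq0 _) one).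
  rewrite invr1 mulr1; apply: (ccvg_ext (N0 := 1%N)) => -[//|N] _.
  rewrite big_split/= -prodrXl.
  have -> : \prod_(i < N.+1) (1 + p * p ^+ (2 * i + 1)) = \prod_(k < N.+1) (1 + (p ^+ 2) ^+ k.+1).
    by apply: eq_bigr => i _; rewrite -exprS -exprM; congr (_ + _ ^+ _); lia.
  have -> : \prod_(i < N.+1) (1 + p^-1 * p ^+ (2 * i + 1)) = 2 * \prod_(k < N) (1 + (p ^+ 2) ^+ k.+1).
    rewrite big_ord_recl/= expr1 mulVf//; congr (_ * _); apply: eq_bigr => i _.
    rewrite -exprM [in LHS]addn1 exprS mulKf//.
  have -> : \prod_(i < N.+1) (1 + (p ^+ 2) ^+ i.+1) ^+ 2 = (\prod_(i < N.+1) (1 + (p ^+ 2) ^+ i.+1)) ^+ 2.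
    by rewrite prodrXl.
  rewrite big_ord_recr/=; move: (inv N); move: (1 + _) (\prod_(i < N) _) => u v u0.
  by field.
move=> /ccvg_uniq/(_ h2); move: E2 E4; move: (Eul (p ^+ 2)) (Eul (p ^+ 4)) => b c b0 c0 e.
have -> : ps p = b * (b^-1 * (2 * ps p)) / 2 by field; rewrite ?b0 ?c0.
by rewrite e; field; rewrite ?b0 ?c0.
Qed.

(** Separates even and odd squares, (2m)^2 = 4 m^2 and (2m + 1)^2 = 4 m (m + 1) + 1. *)
Lemma th3_split p : cm p < 1 -> th3 p = th3 (p ^+ 4) + 2 * (p * ps (p ^+ 4)).
Proof.
move=> p1; have q1 := cmX_lt1 3 p1.
have h := csumtoD (csumtoZ p (ps_csum q1)) (th3_csum q1).
rewrite /th3 -addrA -mulrDr [csum (fun i => (p ^+ 4) ^+ _) + _]addrC.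
congr (1 + 2 * _); apply: csumE.
have h0 : ccvg (fun n => \sum_(k < n.*2) p ^+ (k.+1 * k.+1)) (csum (fun i => p ^+ (i.+1 * i.+1))).
  by apply: (ccvg_comp (th3_csum p1) (f := double)) => n; lia.
have e : csum (fun i => p ^+ (i.+1 * i.+1)) = p * ps (p ^+ 4) + csum (fun i => (p ^+ 4) ^+ (i.+1 * i.+1)).
  apply: ccvg_uniq h0 _; apply: ccvg_eq h => n.
  elim: n => [|n IH]; first by rewrite !big_ord0.
  rewrite doubleS !big_ord_recr/= IH -!addrA; congr (_ + (_ + _)).
    by rewrite -exprM -exprS; congr (_ ^+ _); lia.
  by rewrite -exprM; congr (_ ^+ _); lia.
by rewrite -e; exact: th3_csum.
Qed.

(** Classically theta_2 theta_3 theta_4 = 2 eta^3, the link between theta constants and Delta =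
    eta^24. *)
Lemma theta_mul p : p != 0 -> cm p < 1 -> ps p * th3 p * th3 (- p) = Eul (p ^+ 2) ^+ 3.
Proof.
move=> p0 p1; rewrite (psE p0 p1) (th3E p0 p1) (th3NE p0 p1).
move: (Eul_neq0 p1) (Eul_neq0 (cmX_lt1 1 p1)) (Eul_neq0 (cmX_lt1 3 p1)).
move: (Eul p) (Eul (p ^+ 2)) (Eul _) => a b c a0 b0 c0.
by field; rewrite ?a0 ?b0 ?c0.
Qed.

Lemma th34_mul p : p != 0 -> cm p < 1 -> th3 p * th3 (- p) = th3 (- (p ^+ 2)) ^+ 2.
Proof.
move=> p0 p1; have p20 : p ^+ 2 != 0 by rewrite expf_neq0.
rewrite (th3NE p0 p1) (th3NE p20 (cmX_lt1 1 p1)).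
have -> : (p ^+ 2) ^+ 2 = p ^+ 4 by rewrite -exprM.
rewrite (th3E p0 p1).
move: (Eul_neq0 p1) (Eul_neq0 (cmX_lt1 1 p1)) (Eul_neq0 (cmX_lt1 3 p1)).
move: (Eul p) (Eul (p ^+ 2)) (Eul _) => a b c a0 b0 c0.
by field; rewrite ?a0 ?b0 ?c0.
Qed.

(** The duplication formula theta_2(tau)^2 = 2 theta_2(2 tau) theta_3(2 tau). *)
Lemma ps_sqr p : p != 0 -> cm p < 1 -> ps p ^+ 2 = ps (p ^+ 2) * th3 (p ^+ 2).
Proof.
move=> p0 p1; have p20 : p ^+ 2 != 0 by rewrite expf_neq0.
have q1 := cmX_lt1 1 p1.
rewrite (psE p0 p1) (psE p20 q1) (th3E p20 q1).
have -> : (p ^+ 2) ^+ 2 = p ^+ 4 by rewrite -exprM.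
have -> : (p ^+ 2) ^+ 4 = p ^+ 8 by rewrite -exprM.
move: (Eul_neq0 (cmX_lt1 1 p1)) (Eul_neq0 (cmX_lt1 3 p1)) (Eul_neq0 (cmX_lt1 7 p1)).
move: (Eul (p ^+ 2)) (Eul (p ^+ 4)) (Eul _) => a b c a0 b0 c0.
by field; rewrite ?a0 ?b0 ?c0.
Qed.
End Theta.

#[global] Opaque th3 ps.

(** * Jacobi's quartic identity and the relation for T_2 in the nome *)

Section Jacobi.
Variable R : realType.
Local Notation C := R[i].
Implicit Types (p : C).

(* Jacobi's quartic identity is [jac = 0]. The duplication formulas bound [jac p] by a
   multiple of [p * jac (p ^ 2)], and this is iterated. *)
Definition jac p := th3 p ^+ 4 - th3 (- p) ^+ 4 - 16 * (p * ps p ^+ 4).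

(** Put a, b for theta_3, theta_4 at p, and t, s for [th3], [ps] at p^2. Then a^2 - b^2 = 8 p s^2,
    so jac p = 8 p s^2 (a^2 + b^2 - 2 t^2). Multiplying by the conjugate gives (a^2 - b^2)^2 + 4 (a
    b)^2 - 4 t^4, which is - 4 jac (p^2). *)
Lemma jac_rec p : p != 0 -> cm p < 1 ->
  jac p * (th3 p ^+ 2 + th3 (- p) ^+ 2 + 2 * th3 (p ^+ 2) ^+ 2) =
  - 32 * (p * (ps (p ^+ 2) ^+ 2 * jac (p ^+ 2))).
Proof.
move=> p0 p1; have p20 : p ^+ 2 != 0 by rewrite expf_neq0.
have q1 := cmX_lt1 1 p1; have pN1 : cm (- p) < 1 by rewrite cmN.
have e1 := th3_split p1; have e2 := th3_split pN1.
have e3 := ps_sqr p0 p1; have e4 := ps_sqr p20 q1; have e5 := th34_mul p0 p1.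
have e24 : (p ^+ 2) ^+ 2 = p ^+ 4 by rewrite -exprM.
have eN4 : (- p) ^+ 4 = p ^+ 4 by rewrite exprNn -signr_odd expr0 mul1r.
rewrite e24 in e4; rewrite eN4 in e2; rewrite /jac.
move: e1 e2 e3 e4 e5.
move: (th3 p) (th3 (- p)) (th3 (p ^+ 4)) (ps (p ^+ 4)) (ps p) (ps (p ^+ 2))
  (th3 (p ^+ 2)) (th3 (- (p ^+ 2))) => a b A s4 s s2 t t' e1 e2 e3 e4 e5.
have d : a ^+ 2 - b ^+ 2 = 8 * p * s2 ^+ 2 by rewrite e4 e1 e2; ring.
have -> : a ^+ 4 - b ^+ 4 - 16 * (p * s ^+ 4) = 8 * p * s2 ^+ 2 * (a ^+ 2 + b ^+ 2 - 2 * t ^+ 2).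
  rewrite (_ : s ^+ 4 = (s ^+ 2) ^+ 2); last by rewrite -exprM.
  by rewrite e3 -d; transitivity ((a ^+ 2 - b ^+ 2) * (a ^+ 2 + b ^+ 2) - 2 * (8 * p * s2 ^+ 2) * t ^+ 2);
    [ring|rewrite -d; ring].
have -> : t' ^+ 4 = (a * b) ^+ 2 by rewrite e5 -exprM.
transitivity (8 * p * s2 ^+ 2 * ((a ^+ 2 - b ^+ 2) ^+ 2 + 4 * (a * b) ^+ 2 - 4 * t ^+ 4)); first by ring.
by rewrite d; ring.
Qed.

Lemma sum_half n : \sum_(k < n) 2^-1 ^+ k <= 2 :> R.
Proof.
have : 0 <= 2^-1 ^+ n :> R by rewrite exprn_ge0// invr_ge0.
by have := subrX1 (2^-1 : R) n; lra.
Qed.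

Lemma th3_le p : cm p <= 2^-1 -> cm (th3 p) <= 3.
Proof.
move=> ph; have p1 : cm p < 1 by lra.
have : cm (csum (fun i => p ^+ (i.+1 * i.+1))) <= 2^-1 * 2.
  apply: (@csumto_cm _ _ (fun i => 2^-1 * 2^-1 ^+ i)) (th3_csum p1) => [k|n].
    rewrite cmX -exprS; apply: (@le_trans _ _ (cm p ^+ k.+1)).
      by apply: ler_wiXn2l; rewrite ?cm_ge0 ?ltW//; lia.
    by rewrite lerXn2r ?nnegrE ?cm_ge0 ?invr_ge0.
  by rewrite -mulr_sumr ler_wpM2l ?invr_ge0 ?sum_half.
move=> h; rewrite th3_def; apply: le_trans (cmD _ _) _; rewrite cm1 cmM cm_nat; lra.
Qed.

Lemma ps_le p : cm p <= 2^-1 -> cm (ps p) <= 2.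
Proof.
move=> ph; have p1 : cm p < 1 by lra.
apply: (@csumto_cm _ _ (fun i => 2^-1 ^+ i)) (ps_csum p1) => [k|n]; last exact: sum_half.
rewrite cmX; apply: (@le_trans _ _ (cm p ^+ k)).
  by apply: ler_wiXn2l; rewrite ?cm_ge0 ?ltW//; lia.
by rewrite lerXn2r ?nnegrE ?cm_ge0 ?invr_ge0.
Qed.

Lemma ccvg_Im0 (u : nat -> C) l : (forall n, Im (u n) = 0) -> ccvg u l -> Im l = 0.
Proof.
move=> h hu; apply/eqP; rewrite -normr_eq0 eq_le normr_ge0 andbT leNgt; apply/negP => e0.
have [N /(_ N (leqnn N))] := hu _ e0; rewrite ltNge => /negP; apply.
by apply: le_trans (cm_Im _); rewrite ImB h sub0r normrN.
Qed.

Lemma ccvg_Re_ge0 (u : nat -> C) l : (forall n, 0 <= Re (u n)) -> ccvg u l -> 0 <= Re l.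
Proof.
move=> h hu; rewrite leNgt; apply/negP => e0.
have e1 : 0 < - Re l by rewrite oppr_gt0.
have [N /(_ N (leqnn N))] := hu _ e1; rewrite ltNge => /negP; apply.
apply: le_trans (cm_Re _); apply: le_trans (ler_norm _); rewrite ReB.
by rewrite lerDr.
Qed.

Lemma th3_real (x : R) : `|x| < 1 -> th3 (x%:C)%C = ((Re (th3 (x%:C)%C))%:C)%C.
Proof.
move=> x1; apply: complex_ext => //=.
have p1 : cm (x%:C)%C < 1 by rewrite cm_real.
rewrite th3_def ImD -[2]real_complex_nat Im_realM.
have -> : Im (csum (fun i => (x%:C)%C ^+ (i.+1 * i.+1))) = 0.
  apply: ccvg_Im0 (th3_csum p1) => n.
  by under eq_bigr do rewrite -rmorphXn; rewrite -rmorph_sum.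
by rewrite mulr0 addr0.
Qed.

Lemma th3_ge1 (x : R) : 0 <= x < 1 -> 1 <= Re (th3 (x%:C)%C).
Proof.
move=> /andP[x0 x1].
have p1 : cm (x%:C)%C < 1 by rewrite cm_real ger0_norm.
rewrite th3_def ReD -[2]real_complex_nat Re_realM lerDl mulr_ge0//.
apply: ccvg_Re_ge0 (th3_csum p1) => n.
under eq_bigr do rewrite -rmorphXn; rewrite -rmorph_sum /=.
by apply: sumr_ge0 => i _; rewrite exprn_ge0.
Qed.

(** For a real nome the conjugate factor in [jac_rec] is at least 1 + 0 + 2 = 3, hence can be
    divided out. *)
Lemma jac_step (x : R) : 0 < x < 1 ->
  cm (jac (x%:C)%C) * 3 <= 32 * (x * (cm (ps ((x ^+ 2)%:C)%C) ^+ 2 * cm (jac ((x ^+ 2)%:C)%C))).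
Proof.
move=> /andP[x0 x1]; have xa : `|x| < 1 by rewrite ger0_norm// ltW.
have p0 : (x%:C)%C != 0 by rewrite -cm_gt0 cm_real normr_gt0 gt_eqF.
have p1 : cm (x%:C)%C < 1 by rewrite cm_real.
have := congr1 (@ComplexField.Normc.normc R) (jac_rec p0 p1).
have -> : ((x%:C)%C ^+ 2 = (x ^+ 2)%:C)%C by rewrite rmorphXn.
rewrite [RHS]cmM cmN cm_nat (cmM (x%:C)%C) cm_real (ger0_norm (ltW x0)).
rewrite (cmM (ps _ ^+ 2)) cmX.
move=> <-; rewrite cmM ler_wpM2l ?cm_ge0//.
have x2 : 0 <= x ^+ 2 < 1 by rewrite exprn_ge0 ?exprn_ilt1// ltW.
have x01 : 0 <= x < 1 by rewrite ltW.
have xN : `|- x| < 1 by rewrite normrN.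
have x2a : `|x ^+ 2| < 1 by rewrite normrX exprn_ilt1.
have -> : - (x%:C)%C = ((- x)%:C)%C :> C by rewrite rmorphN.
rewrite (th3_real xa) (th3_real xN) (th3_real x2a).
have := th3_ge1 x01; have := th3_ge1 x2.
rewrite -[2]real_complex_nat -!rmorphXn -rmorphM -!rmorphD cm_real => ha hb.
apply: le_trans (ler_norm _).
have := sqr_ge0 (Re (th3 ((- x)%:C)%C)); nra.
Qed.

(** Below 1/128 the recursion contracts, since 32 * 4 / (3 * 128) = 1/3 <= 1/2, while [jac] stays
    bounded by 500; so it vanishes there. Any other x is brought below 1/128 by repeated squaring.
    Real nomes suffice, as T_2 is integrated along the imaginary axis. *)
Lemma jac0 (x : R) : 0 < x < 1 -> jac (x%:C)%C = 0.
Proof.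
pose P (x : R) := jac (x%:C)%C = 0.
have small x1 : 0 < x1 <= 128^-1 -> P x1.
  move=> hx1.
  have half y : 0 < y <= 128^-1 -> cm (jac (y%:C)%C) <= 2^-1 * cm (jac ((y ^+ 2)%:C)%C).
    move=> /andP[y0 y1]; have y01 : 0 < y < 1 by lra.
    have := jac_step y01.
    have yy : cm ((y ^+ 2)%:C)%C <= 2^-1.
      by rewrite cm_real ger0_norm ?sqr_ge0//; nra.
    have := ps_le yy; have := cm_ge0 (ps ((y ^+ 2)%:C)%C).
    have := cm_ge0 (jac ((y ^+ 2)%:C)%C).
    move: (cm (jac (y%:C)%C)) (cm (jac ((y ^+ 2)%:C)%C)) (cm (ps ((y ^+ 2)%:C)%C)) => u v w v0 w0 w2 h.
    have : y * (w ^+ 2 * v) <= 128^-1 * (4 * v).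
      apply: ler_pM => //; [exact: ltW|by rewrite mulr_ge0 ?sqr_ge0|].
      by apply: ler_wpM2r => //; nra.
    lra.
  have bnd n : forall y, 0 < y <= 128^-1 -> cm (jac (y%:C)%C) <= 500 * 2^-1 ^+ n.
    elim: n => [|n IH] y hy.
      have yy : cm (y%:C)%C <= 2^-1 by rewrite cm_real ger0_norm; lra.
      have yN : cm (- (y%:C)%C) <= 2^-1 by rewrite cmN.
      have := th3_le yy; have := th3_le yN; have := ps_le yy => h1 h2 h3.
      rewrite expr0 mulr1 /jac; apply: le_trans (cmB _ _) _.
      apply: le_trans (lerD (cmB _ _) (lexx _)) _.
      rewrite !cmX cmM cm_nat cmM cmX.
      have e1 : cm (th3 (y%:C)%C) ^+ 4 <= 3 ^+ 4 by rewrite lerXn2r ?nnegrE ?cm_ge0.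
      have e2 : cm (th3 (- (y%:C)%C)) ^+ 4 <= 3 ^+ 4 by rewrite lerXn2r ?nnegrE ?cm_ge0.
      have e3 : cm (ps (y%:C)%C) ^+ 4 <= 2 ^+ 4 by rewrite lerXn2r ?nnegrE ?cm_ge0.
      have : cm (y%:C)%C * cm (ps (y%:C)%C) ^+ 4 <= 2^-1 * 2 ^+ 4.
        by apply: ler_pM; rewrite ?cm_ge0 ?exprn_ge0 ?cm_ge0.
      lra.
    apply: le_trans (half _ hy) _; rewrite [2^-1 ^+ n.+1]exprS [leRHS]mulrCA ler_wpM2l ?invr_ge0//.
    apply: IH; apply/andP; case/andP: hy => y0 y1; split; first by rewrite exprn_gt0.
    nra.
  apply/eqP; rewrite -cm_eq0 eq_le cm_ge0 andbT leNgt; apply/negP => e0.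
  have h01 : 0 <= (2^-1 : R) < 1 by lra.
  have [N /(_ N (leqnn N))] := tends0_geom 500 h01 e0.
  by rewrite ltNge bnd.
have step y : 0 < y < 1 -> P (y ^+ 2) -> P y.
  move=> hy Py; have := jac_step hy; rewrite Py cm0 !mulr0 => h.
  apply/eqP; rewrite -cm_eq0 eq_le cm_ge0 andbT; lra.
move=> hx; have x01 : 0 <= x < 1 by case/andP: hx => /ltW ->.
have e0 : 0 < 128^-1 :> R by rewrite invr_gt0.
have [N /(_ N (leqnn N))] := tends0_geom 1 x01 e0; rewrite mul1r => hN.
have iter_sq n : forall y, 0 < y < 1 -> P (y ^+ (2 ^ n)) -> P y.
  elim: n => [|n IH] y hy; first by rewrite expn0 expr1.
  rewrite expnS exprM => h; apply: step => //; apply: IH => //.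
  by case/andP: hy => y0 y1; rewrite exprn_gt0// exprn_ilt1// ltW.
apply: (iter_sq N) => //; apply: small; case/andP: hx => y0 y1.
rewrite exprn_gt0//=; apply: le_trans (ltW hN).
by apply: ler_wiXn2l; [exact: ltW|exact: ltW|exact: ltnW (ltn_expl _ _)].
Qed.

(* Jacobi's identity A = B + 16 p S between A = th3^4, B = th4^4, S = ps^4 is what
   makes the three terms of T_2 add up. *)
Lemma hecke2_algebra (F : fieldType) (p e1 eN e4 E a b s : F) : (2 : F) != 0 -> E != 0 ->
  b = e1 ^+ 2 / E -> a = eN ^+ 2 / E -> s = e4 ^+ 2 / E -> s * a * b = E ^+ 3 ->
  a ^+ 4 - b ^+ 4 - 16 * (p * s ^+ 4) = 0 ->
  2048 * (p ^+ 4 * e4 ^+ 24) + 2^-1 * (p * e1 ^+ 24 - p * eN ^+ 24) =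
  - 24 * (p ^+ 2 * E ^+ 24).
Proof.
move=> F2 E0 eb ea es e J.
have f1 : e1 ^+ 24 = (b * E) ^+ 12 by rewrite eb (divfK E0) -exprM.
have f2 : eN ^+ 24 = (a * E) ^+ 12 by rewrite ea (divfK E0) -exprM.
have f3 : e4 ^+ 24 = (s * E) ^+ 12 by rewrite es (divfK E0) -exprM.
rewrite f1 f2 f3 !exprMn.
have J' : a ^+ 4 = b ^+ 4 + 16 * (p * s ^+ 4).
  by apply/eqP; rewrite -subr_eq0 -J; apply/eqP; ring.
have E12 : E ^+ 12 = s ^+ 4 * a ^+ 4 * b ^+ 4 by rewrite -!exprMn e -exprM.
have -> : E ^+ 24 = E ^+ 12 * (s ^+ 4 * a ^+ 4 * b ^+ 4) by rewrite -E12 -exprD.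
have c3 (z : F) : z ^+ 12 = (z ^+ 4) ^+ 3 by rewrite -exprM.
rewrite (c3 a) (c3 b) (c3 s) J'.
move: (E ^+ 12) (b ^+ 4) (s ^+ 4) => G B S.
by field.
Qed.

(** With p = e^(pi i z) the terms are Delta at 2z, z/2, (z + 1)/2 and z, in the relation 2^11
    Delta(2z) + (Delta(z/2) + Delta((z+1)/2)) / 2 = - 24 Delta(z). The translate by 1/2 changes the
    sign of p, whence the minus sign. *)
Lemma hecke2_nome (x : R) (p := (x%:C)%C) : 0 < x < 1 ->
  2048 * (p ^+ 4 * Eul (p ^+ 4) ^+ 24) + 2^-1 * (p * Eul p ^+ 24 - p * Eul (- p) ^+ 24) =
  - 24 * (p ^+ 2 * Eul (p ^+ 2) ^+ 24).
Proof.
move=> hx; have J := jac0 hx; rewrite -/p /jac in J.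
have [x0 x1] := andP hx.
have p0 : p != 0 by rewrite -cm_gt0 cm_real normr_gt0 gt_eqF.
have p1 : cm p < 1 by rewrite cm_real ger0_norm// ltW.
clearbody p; have pN0 : - p != 0 by rewrite oppr_eq0.
have pN1 : cm (- p) < 1 by rewrite cmN.
have e2 := th3NE pN0 pN1; rewrite opprK sqrrN in e2.
apply: (hecke2_algebra _ (Eul_neq0 (cmX_lt1 1 p1)) (th3NE p0 p1) e2 (psE p0 p1)
  (theta_mul p0 p1) J).
by rewrite pnatr_eq0.
Qed.
End Jacobi.

(** * Taylor bounds for complex Gaussians, uniform in the parameters *)

Section GaussianSums.
Variable R : realType.
Local Notation C := R[i].
Local Notation "x %:C" := (real_complex _ x) : ring_scope.

Lemma rcX (x : R) n : (x ^+ n)%:C = x%:C ^+ n. Proof. exact: rmorphXn. Qed.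
Lemma rcD (x y : R) : (x + y)%:C = x%:C + y%:C. Proof. exact: rmorphD. Qed.
Lemma rcB (x y : R) : (x - y)%:C = x%:C - y%:C. Proof. exact: rmorphB. Qed.
Lemma rcN (x : R) : (- x)%:C = - x%:C. Proof. exact: rmorphN. Qed.
Lemma rcM (x y : R) : (x * y)%:C = x%:C * y%:C. Proof. exact: rmorphM. Qed.
Lemma rcV (x : R) : x^-1%:C = x%:C^-1. Proof. exact: fmorphV. Qed.
Lemma rc1 : 1%:C = 1 :> C. Proof. exact: rmorph1. Qed.
Lemma rc0 : 0%:C = 0 :> C. Proof. exact: rmorph0. Qed.

Lemma gauss_real_bound (c K : R) : 0 < c ->
  exists2 M : R, 0 <= M & forall x, expR (- (c * x ^+ 2) + K * (1 + `|x|)) <= M * expR (- `|x|).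
Proof.
move=> c0; exists (expR (K + (K + 1) ^+ 2 / (4 * c))); first exact: expR_ge0.
move=> x; rewrite -expRD ler_expR -(real_normK (num_real x)).
set u := `|x|; rewrite -subr_ge0.
have -> : K + (K + 1) ^+ 2 / (4 * c) + - u - (- (c * u ^+ 2) + K * (1 + u)) =
  (2 * c * u - (K + 1)) ^+ 2 / (4 * c) by clearbody u; field; rewrite gt_eqF.
by rewrite divr_ge0 ?sqr_ge0// mulr_ge0// ltW.
Qed.

Definition gwt (la ze : C) (x : R) : C := cexp (- (pi%:C * (la * x%:C + ze) ^+ 2)).
(** The affine factor is the velocity (ze' + la' x) of the argument la x + ze along a path of
    parameters; [gF'] is the derivative in [x]. See [CD_path]. *)
Definition gF (al be la ze : C) (x : R) : C := (al + be * x%:C) * gwt la ze x.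
Definition gF' (al be la ze : C) (x : R) : C :=
  (be + (al + be * x%:C) * (- 2 * pi%:C * la * (la * x%:C + ze))) * gwt la ze x.

Lemma gwt_bound (B c : R) (la ze : C) (x : R) : cm la <= B -> cm ze <= B -> c <= Re (la ^+ 2) ->
  cm (gwt la ze x) <= expR (- (pi * c * x ^+ 2) + pi * (2 * B ^+ 2) * (1 + `|x|)).
Proof.
move=> laB zeB cla; have B0 : 0 <= B by apply: le_trans laB; exact: cm_ge0.
rewrite /gwt cm_cexp ler_expR ReN Re_realM.
suff /(ler_wpM2l (pi_ge0 R)) : c * x ^+ 2 - 2 * B ^+ 2 * (1 + `|x|) <= Re ((la * x%:C + ze) ^+ 2).
  lra.
have -> : (la * x%:C + ze) ^+ 2 = (x ^+ 2)%:C * la ^+ 2 + (2 * x%:C * la * ze + ze ^+ 2).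
  by rewrite rcX; move: (x%:C) => y; ring.
rewrite ReD Re_realM.
have h : `|Re (2 * x%:C * la * ze + ze ^+ 2)| <= 2 * (B ^+ 2 * (1 + `|x|)).
  apply: le_trans (cm_Re _) _; apply: le_trans (cmD _ _) _.
  rewrite cmX !cmM cm_nat cm_real.
  have h1 : cm la * cm ze <= B ^+ 2 by rewrite expr2 ler_pM ?cm_ge0.
  have h2 : cm ze ^+ 2 <= B ^+ 2 by rewrite lerXn2r ?nnegrE ?cm_ge0.
  rewrite -!mulrA; have := ler_wpM2l (normr_ge0 x) h1.
  have := sqr_ge0 B; lra.
move: h; rewrite ler_norml => /andP[h _].
have := ler_wpM2r (sqr_ge0 x) cla; lra.
Qed.

Lemma le1_expR (u : R) : u <= expR u. Proof. exact: expR_ge_id. Qed.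

(** One constant serves all parameters bounded by [B]: the decay forced by [c <= Re (la ^+ 2)] beats
    every polynomial and every exponential in |x|, with e^(-|x|) to spare for summation. *)
Lemma gauss_taylor (B c : R) : 0 < c -> exists2 K : R, 0 <= K &
  forall al be la ze : C, cm al <= B -> cm be <= B -> cm la <= B -> cm ze <= B ->
    c <= Re (la ^+ 2) -> forall x : R,
    cm (gF al be la ze x) <= K * expR (- `|x|) /\
    forall h : R, `|h| <= 1 ->
      cm (gF al be la ze (x + h) - gF al be la ze x - h%:C * gF' al be la ze x)
        <= K * h ^+ 2 * expR (- `|x|).
Proof.
move=> c0.
have [B0|B0] := ltP B 0.
  exists 0 => // al be la ze h; have := le_trans (cm_ge0 al) h; lra.
have pc : 0 < pi * c by rewrite mulr_gt0 ?pi_gt0.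
pose K1 := pi * (5 * B ^+ 2).
have p0 : 0 <= pi :> R := pi_ge0 R.
have BB := sqr_ge0 B.
have K10 : 0 <= K1 by rewrite /K1 !mulr_ge0.
pose K2 := pi * (2 * B ^+ 2).
have K20 : 0 <= K2 by rewrite /K2 !mulr_ge0.
have [M M0 HM] := gauss_real_bound (K2 + 3 + 2 * K1) pc.
pose K3 := 2 * B * (12 * K1 ^+ 2) + 2 * B * (pi * B ^+ 2) + B * (13 * K1).
have K30 : 0 <= K3 by rewrite /K3 !addr_ge0// !mulr_ge0 ?sqr_ge0.
exists ((2 * B + K3) * M); first by rewrite mulr_ge0// addr_ge0// mulr_ge0.
move=> al be la ze alB beB laB zeB cla x.
have W := gwt_bound x laB zeB cla; rewrite -/K2 in W.
set u := 1 + `|x|; have u1 : 1 <= u by rewrite lerDl.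
have {}HM := HM x; rewrite -/u in HM W.
set ex := expR (- `|x|) in HM *; have ex0 : 0 <= ex by exact: expR_ge0.
have u0 : 0 <= u by lra.
(* A common majorant of the growing factors met below, u^3 e^(K1 u) and u e^(2 K1 u). *)
set EU := expR ((3 + 2 * K1) * u).
have WE : cm (gwt la ze x) * EU <= M * ex.
  apply: le_trans HM; apply: le_trans (ler_wpM2r (expR_ge0 _) W) _.
  by rewrite -expRD ler_expR; lra.
have eu : u <= expR u := le1_expR u.
have eu2 k : 0 <= k -> expR (k * u) >= 1 by move=> k0; apply: expR_ge_1; rewrite mulr_ge0.
have albe : cm (al + be * x%:C) <= 2 * B * u.
  apply: le_trans (cmD _ _) _; rewrite cmM cm_real /u.
  have := ler_wpM2r (normr_ge0 x) beB; have := normr_ge0 x; nra.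
have uEU : u <= EU.
  by apply: le_trans eu _; rewrite ler_expR; nra.
split.
  rewrite /gF cmM; apply: le_trans (_ : 2 * B * EU * cm (gwt la ze x) <= _).
    by rewrite ler_wpM2r ?cm_ge0//; apply: le_trans albe _; rewrite ler_wpM2l// mulr_ge0.
  rewrite -mulrA [EU * _]mulrC.
  have := ler_wpM2l (mulr_ge0 (ler0n R 2) B0) WE.
  have : 0 <= K3 * (M * ex) by rewrite !mulr_ge0.
  lra.
move=> h h1.
(* The increment of the exponent of the Gaussian from x to x + h. *)
pose eta := - (pi%:C * (2 * h%:C * la * (la * x%:C + ze) + la ^+ 2 * h%:C ^+ 2)).
have -> : gF al be la ze (x + h) - gF al be la ze x - h%:C * gF' al be la ze x =
  gwt la ze x * ((al + be * x%:C) * (cexp eta - 1 - eta) +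
     (al + be * x%:C) * (- (pi%:C * la ^+ 2 * h%:C ^+ 2)) + be * h%:C * (cexp eta - 1)).
  have e : gwt la ze (x + h) = gwt la ze x * cexp eta.
    rewrite /gwt -cexpD; congr cexp; rewrite /eta rcD.
    by move: (pi%:C) (h%:C) (x%:C) => ? ? ?; ring.
  rewrite /gF /gF' e rcD; move: (gwt la ze x) (cexp eta) => w v; rewrite /eta.
  by move: (pi%:C) (h%:C) (x%:C) => ? ? ?; ring.
have h0 := normr_ge0 h.
have hh : h ^+ 2 = `|h| ^+ 2 by rewrite real_normK ?num_real.
have etaB : cm eta <= K1 * `|h| * u.
  rewrite /eta cmN cmM cm_real (ger0_norm p0) /K1.
  have -> : pi * (5 * B ^+ 2) * `|h| * u = pi * (5 * B ^+ 2 * `|h| * u) by ring.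
  apply: ler_wpM2l => //.
  apply: le_trans (cmD _ _) _; rewrite (cmM (la ^+ 2)) !cmX !cmM cm_nat !cm_real.
  have a1 : cm (la * x%:C + ze) <= B * u.
    apply: le_trans (cmD _ _) _; rewrite cmM cm_real /u.
    by have := ler_wpM2r (normr_ge0 x) laB; lra.
  have a2 : cm la * cm (la * x%:C + ze) <= B ^+ 2 * u.
    by rewrite expr2 -mulrA ler_pM ?cm_ge0.
  have a3 : cm la ^+ 2 <= B ^+ 2 by rewrite lerXn2r ?nnegrE ?cm_ge0.
  have a4 : `|h| ^+ 2 <= `|h| by rewrite expr2 ler_piMl.
  have a5 : cm la ^+ 2 * `|h| ^+ 2 <= B ^+ 2 * `|h|.
    by rewrite ler_pM ?exprn_ge0 ?cm_ge0.
  have a6 := ler_wpM2l h0 a2.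
  have a8 : 0 <= B ^+ 2 * `|h| * u by rewrite !mulr_ge0.
  have a7 : B ^+ 2 * `|h| <= B ^+ 2 * `|h| * u by rewrite ler_peMr// mulr_ge0.
  have -> : 2 * `|h| * cm la * cm (la * x%:C + ze) = 2 * (`|h| * (cm la * cm (la * x%:C + ze))) by ring.
  lra.
have eta1 : cm eta <= K1 * u.
  apply: le_trans etaB _; rewrite -mulrA ler_wpM2l//; nra.
have T1 : cm (cexp eta - 1 - eta) <= 12 * K1 ^+ 2 * h ^+ 2 * (u ^+ 2 * expR (K1 * u)).
  apply: le_trans (cexp_taylor _) _.
  have -> : 12 * K1 ^+ 2 * h ^+ 2 * (u ^+ 2 * expR (K1 * u)) =
     12 * (K1 * `|h| * u) ^+ 2 * expR (K1 * u) by rewrite hh; ring.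
  apply: ler_pM; [by rewrite mulr_ge0 ?sqr_ge0|exact: expR_ge0| |by rewrite ler_expR].
  by rewrite ler_wpM2l// lerXn2r ?nnegrE ?cm_ge0 ?mulr_ge0.
have T2 : cm (cexp eta - 1) <= 13 * K1 * `|h| * (u * expR (2 * K1 * u)).
  apply: le_trans (cexp_sub1 _) _.
  have -> : 13 * K1 * `|h| * (u * expR (2 * K1 * u)) = 13 * (K1 * `|h| * u) * expR (2 * K1 * u) by ring.
  apply: ler_pM; [by rewrite mulr_ge0 ?cm_ge0|exact: expR_ge0|by rewrite ler_wpM2l|].
  by rewrite ler_expR -mulrA ler_wpM2l.
have U1 : u * (u ^+ 2 * expR (K1 * u)) <= EU.
  rewrite mulrA -exprS; apply: (@le_trans _ _ (expR u ^+ 3 * expR (K1 * u))).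
    by rewrite ler_wpM2r ?expR_ge0// lerXn2r ?nnegrE ?expR_ge0.
  rewrite -expRM_natl -expRD ler_expR.
  by have := mulr_ge0 K10 u0; lra.
have U2 : u * expR (2 * K1 * u) <= EU.
  apply: (@le_trans _ _ (expR u * expR (2 * K1 * u))); first by rewrite ler_wpM2r ?expR_ge0.
  by rewrite -expRD ler_expR; lra.
suff S : cm ((al + be * x%:C) * (cexp eta - 1 - eta) +
     (al + be * x%:C) * (- (pi%:C * la ^+ 2 * h%:C ^+ 2)) + be * h%:C * (cexp eta - 1)) <= K3 * h ^+ 2 * EU.
  rewrite cmM mulrC; apply: le_trans (ler_wpM2r (cm_ge0 _) S) _.
  have := ler_wpM2l (mulr_ge0 K30 (sqr_ge0 h)) WE.
  have := mulr_ge0 B0 (mulr_ge0 (sqr_ge0 h) (mulr_ge0 M0 ex0)).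
  lra.
have V1 : cm ((al + be * x%:C) * (cexp eta - 1 - eta)) <= 2 * B * (12 * K1 ^+ 2) * h ^+ 2 * EU.
  rewrite cmM; apply: le_trans (ler_pM (cm_ge0 _) (cm_ge0 _) albe T1) _.
  have p1 : 0 <= 2 * B * (12 * K1 ^+ 2) by rewrite !mulr_ge0.
  have := ler_wpM2l (mulr_ge0 p1 (sqr_ge0 h)) U1; lra.
have V2 : cm ((al + be * x%:C) * (- (pi%:C * la ^+ 2 * h%:C ^+ 2))) <= 2 * B * (pi * B ^+ 2) * h ^+ 2 * EU.
  rewrite cmM cmN cmM (cmM pi%:C) !cmX !cm_real (ger0_norm p0) -hh.
  have a3 : cm la ^+ 2 <= B ^+ 2 by rewrite lerXn2r ?nnegrE ?cm_ge0.
  have a4 : pi * cm la ^+ 2 * h ^+ 2 <= pi * B ^+ 2 * h ^+ 2.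
    by rewrite ler_wpM2r ?sqr_ge0// ler_wpM2l.
  apply: le_trans (ler_pM (cm_ge0 _) _ albe a4) _.
    by apply: mulr_ge0; [apply: mulr_ge0; [|exact: sqr_ge0]|exact: sqr_ge0].
  have p1 : 0 <= 2 * B * (pi * B ^+ 2) by rewrite !mulr_ge0.
  have := ler_wpM2l (mulr_ge0 p1 (sqr_ge0 h)) uEU; lra.
have V3 : cm (be * h%:C * (cexp eta - 1)) <= B * (13 * K1) * h ^+ 2 * EU.
  rewrite !cmM cm_real; apply: le_trans (ler_pM _ (cm_ge0 _) (ler_wpM2r h0 beB) T2) _.
    by rewrite mulr_ge0 ?cm_ge0.
  have p1 : 0 <= B * (13 * K1) by rewrite !mulr_ge0.
  have := ler_wpM2l (mulr_ge0 p1 (sqr_ge0 h)) U2; rewrite hh; lra.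
apply: le_trans (cmD _ _) _; apply: le_trans (lerD (cmD _ _) (lexx _)) _.
by rewrite /K3; lra.
Qed.
End GaussianSums.

(** * Riemann sums of Gaussians and shift of the contour *)

Section GaussianRiemann.
Variable R : realType.
Local Notation C := R[i].
Local Notation "x %:C" := (real_complex _ x) : ring_scope.

(** A grid of step 1/N on [-N, N], symmetric about 0, with [nn N] = 2 N^2 + 1 points: step and range
    are refined together. *)
Definition xg (N j : nat) : R := (j%:R - (N * N)%:R) / N%:R.
Definition nn (N : nat) := (2 * (N * N)).+1.

Lemma xgS N j : xg N j.+1 = xg N j + N%:R^-1.
Proof. by rewrite /xg -natr1 -addrA [1 - _]addrC addrA mulrDl mul1r. Qed.

Lemma xg_mid N i : xg N (N * N + i) = i%:R / N%:R.
Proof. by rewrite /xg natrD addrAC subrr add0r. Qed.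

Lemma xg_midN N i : (i <= N * N)%N -> xg N (N * N - i) = - (i%:R / N%:R).
Proof. by move=> iN; rewrite /xg natrB// addrAC subrr sub0r mulNr. Qed.

Lemma exp_sum N : (0 < N)%N -> \sum_(j < nn N) expR (- `|xg N j|) <= 3 * N%:R.
Proof.
move=> N0; have NR : 0 < N%:R :> R by rewrite ltr0n.
rewrite /nn (sum_sym (fun j => expR (- `|xg N j|))).
have -> : xg N (N * N) = 0 by rewrite -[X in xg N X]addn0 xg_mid mul0r.
rewrite normr0 oppr0 expR0.
have -> : \sum_(i < N * N) (expR (- `|xg N (N * N + i.+1)|) + expR (- `|xg N (N * N - i.+1)|)) =
  2 * \sum_(i < N * N) expR (- N%:R^-1) ^+ i.+1.
  rewrite mulr_sumr; apply: eq_bigr => i _.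
  rewrite xg_mid xg_midN// normrN ger0_norm ?divr_ge0//.
  by rewrite -expRM_natl mulrN -[X in _ = 2 * expR X]mulNr; rewrite mulNr; ring.
set r := expR _.
have r0 : 0 <= r by exact: expR_ge0.
have rN : r * (1 + N%:R^-1) <= 1.
  by rewrite -[leRHS](expRxMexpNx_1 N%:R^-1) mulrC -/r ler_wpM2r// expR_ge1Dx.
have -> : \sum_(i < N * N) r ^+ i.+1 = r * \sum_(i < N * N) r ^+ i.
  by rewrite mulr_sumr; apply: eq_bigr => i _; rewrite exprS.
have := subrX1 r (N * N); have := exprn_ge0 (N * N) r0.
set S := \sum_(i < _) _; set q := r ^+ _ => q0 e.
have S0 : 0 <= S by apply: sumr_ge0 => i _; exact: exprn_ge0.
have h : r <= N%:R * (1 - r).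
  have := ler_wpM2l (ltW NR) rN; rewrite mulrCA mulrDr mulr1 divff ?gt_eqF//; lra.
have := ler_wpM2r S0 h.
have e1 : (1 - r) * S <= 1 by lra.
have := ler_wpM2l (ltW NR) e1.
have : 1 <= N%:R :> R by rewrite ler1n.
lra.
Qed.

Lemma expR_natN N : (0 < N)%N -> expR (- N%:R) <= N%:R^-1 :> R.
Proof.
move=> N0; have NR : 0 < N%:R :> R by rewrite ltr0n.
by rewrite expRN lef_pV2 ?posrE ?expR_gt0// expR_ge_id.
Qed.

Lemma invn_le1 N : (0 < N)%N -> `|N%:R^-1| <= 1 :> R.
Proof.
by move=> N0; rewrite ger0_norm ?invr_ge0// invf_le1 ?ltr0n// ler1n.
Qed.

(** The sum of a derivative telescopes: two boundary values of size K/N, plus Taylor errors K/N^2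
    weighted by e^(-|x|), whose sum over the grid is at most 3N. *)
Lemma riemann_telescope (F F' : R -> C) (K : R) N : (0 < N)%N -> 0 <= K ->
  (forall x, cm (F x) <= K * expR (- `|x|)) ->
  (forall x h, `|h| <= 1 -> cm (F (x + h) - F x - h%:C * F' x) <= K * h ^+ 2 * expR (- `|x|)) ->
  cm (N%:R^-1%:C * \sum_(j < nn N) F' (xg N j)) <= 5 * K / N%:R.
Proof.
move=> N0 K0 HF HT; have NR : 0 < N%:R :> R by rewrite ltr0n.
have -> : N%:R^-1%:C * \sum_(j < nn N) F' (xg N j) =
  F (xg N (nn N)) - F (xg N 0) -
  \sum_(j < nn N) (F (xg N j + N%:R^-1) - F (xg N j) - N%:R^-1%:C * F' (xg N j)).
  rewrite sumrB mulr_sumr; have -> : \sum_(j < nn N) (F (xg N j + N%:R^-1) - F (xg N j)) =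
     F (xg N (nn N)) - F (xg N 0).
    elim: (nn N) => [|n IH]; first by rewrite big_ord0 subrr.
    by rewrite big_ord_recr/= IH -xgS addrC addrA subrK.
  by rewrite opprB addrC subrK.
have end_ x : N%:R <= `|x| -> cm (F x) <= K / N%:R.
  move=> h; apply: le_trans (HF _) _; rewrite ler_wpM2l//.
  by apply: le_trans (expR_natN N0); rewrite ler_expR lerN2.
have e1 : cm (F (xg N (nn N))) <= K / N%:R.
  apply: end_; have -> : nn N = (N * N + (N * N).+1)%N by rewrite addnS addnn -mul2n; reflexivity.
  rewrite xg_mid ger0_norm ?divr_ge0// ler_pdivlMr// -natrM ler_nat; lia.
have e2 : cm (F (xg N 0)) <= K / N%:R.
  apply: end_; have -> : 0%N = (N * N - N * N)%N by lia.
  rewrite xg_midN// normrN ger0_norm ?divr_ge0// ler_pdivlMr// -natrM ler_nat; lia.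
have e3 : cm (\sum_(j < nn N) (F (xg N j + N%:R^-1) - F (xg N j) - N%:R^-1%:C * F' (xg N j))) <= 3 * K / N%:R.
  apply: le_trans (cm_sum _ _ _) _.
  apply: (@le_trans _ _ (\sum_(j < nn N) K * N%:R^-1 ^+ 2 * expR (- `|xg N j|))).
    by apply: ler_sum => j _; apply: HT; exact: invn_le1.
  rewrite -mulr_sumr; apply: le_trans (ler_wpM2l _ (exp_sum N0)) _.
    by apply: mulr_ge0 => //; exact: sqr_ge0.
  by rewrite (_ : K * _ * _ = 3 * K / N%:R)//; field; rewrite gt_eqF.
apply: le_trans (cmB _ _) _; apply: le_trans (lerD (cmB _ _) (lexx _)) _; lra.
Qed.

(** Riemann sum of the integral of la e^(- pi (la x + ze)^2), whose value does not depend on la and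
    ze. *)
Definition IN (N : nat) (la ze : C) : C := N%:R^-1%:C * \sum_(j < nn N) (la * gwt la ze (xg N j)).

Lemma CD_affine (a b z : C) : CD (fun t : C => a + t * b) z b.
Proof.
apply: CD_eq (CD_add (CD_cst a z) (CD_scale b (CD_id z))) => [w|].
  by rewrite mulrC.
by rewrite mulr1 add0r.
Qed.

(** Stands in for Cauchy's theorem: the derivative of the integrand in the path parameter t is the
    x-derivative of a decaying function. *)
Lemma CD_path (l ze : C) (x : R) (t : C) :
  CD (fun t => (1 + t * (l - 1)) * gwt (1 + t * (l - 1)) (0 + t * ze) x) t
     (gF' ze (l - 1) (1 + t * (l - 1)) (0 + t * ze) x).
Proof.
have h1 := CD_affine 1 (l - 1) t.
have h2 := CD_add (CD_scale x%:C h1) (CD_affine 0 ze t).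
have h3 := CD_comp (CD_scale (- pi%:C) (CD_exp 1 h2)) (@CD_cexp R _).
apply: CD_eq (CD_mul h1 h3) => [w|].
  rewrite /gwt; congr (_ * cexp _); move: (x%:C) (pi%:C) => y q; ring.
rewrite /gF' /gwt.
have -> : - pi%:C * (x%:C * (1 + t * (l - 1)) + (0 + t * ze)) ^+ 2 =
  - (pi%:C * ((1 + t * (l - 1)) * x%:C + (0 + t * ze)) ^+ 2).
  by move: (x%:C) (pi%:C) => y q; ring.
by move: (x%:C) (pi%:C) (cexp _) => y q w; ring.
Qed.

(** The parameters move along a segment from (1, 0) to (l, ze); by [CD_path] and [riemann_telescope]
    the sum changes at a rate O(1/N). *)
Lemma gaussI (l ze : C) : `|Im l| < Re l -> exists2 K : R, 0 <= K &
  forall N, (0 < N)%N -> cm (IN N l ze - IN N 1 0) <= K / N%:R.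
Proof.
move=> hl; have [hl1 hl2] : 0 < Re l - Im l /\ 0 < Re l + Im l.
  by move: hl; rewrite ltr_norml => /andP[]; lra.
pose m1 := Num.min 1 (Re l - Im l); pose m2 := Num.min 1 (Re l + Im l).
have m10 : 0 < m1 by rewrite lt_min ltr01.
have m20 : 0 < m2 by rewrite lt_min ltr01.
have [K K0 HK] := gauss_taylor (1 + cm (l - 1) + cm ze) (mulr_gt0 m10 m20).
exists (2 * (5 * K)); first by rewrite !mulr_ge0.
move=> N N0; pose G (t : C) := IN N (1 + t * (l - 1)) (0 + t * ze).
have -> : IN N l ze = G 1 by rewrite /G; congr IN; ring.
have -> : IN N 1 0 = G 0 by rewrite /G; congr IN; ring.
pose g t := N%:R^-1%:C * \sum_(j < nn N) gF' ze (l - 1) (1 + t * (l - 1)) (0 + t * ze) (xg N j).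
have dG t : CD G t (g t).
  by apply: CD_scale; apply: CD_sum => j; exact: CD_path.
rewrite -[_ * _ / _]mulrA; apply: (@CD_mvt _ G g) => [t _|t /andP[t0 t1]]; first exact: dG.
rewrite subr0 !mulr1 add0r /g -[5 * _ / _]mulrA mulrA.
have tn : `|t| = t by rewrite ger0_norm.
have b1 : cm (1 + t%:C * (l - 1)) <= 1 + cm (l - 1) + cm ze.
  apply: le_trans (cmD _ _) _; rewrite cm1 cmM cm_real tn.
  have := cm_ge0 (l - 1); have := cm_ge0 ze; nra.
have b2 : cm (0 + t%:C * ze) <= 1 + cm (l - 1) + cm ze.
  rewrite add0r cmM cm_real tn; have := cm_ge0 (l - 1); have := cm_ge0 ze; nra.
have b3 : cm ze <= 1 + cm (l - 1) + cm ze by have := cm_ge0 (l - 1); lra.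
have b4 : cm (l - 1) <= 1 + cm (l - 1) + cm ze by have := cm_ge0 ze; lra.
(* Re (z^2) = (Re z - Im z)(Re z + Im z), and each factor is affine in t, hence at least the minimum
   of its values at the two ends. *)
have b5 : m1 * m2 <= Re ((1 + t%:C * (l - 1)) ^+ 2).
  have -> : Re ((1 + t%:C * (l - 1)) ^+ 2) = (1 + t * (Re l - 1) - t * Im l) * (1 + t * (Re l - 1) + t * Im l).
    rewrite expr2 ReMc !ReD !ImD !Re_realM !Im_realM !ReB !ImB /=; ring.
  have m11 : m1 <= 1 by rewrite ge_min lexx.
  have m21 : m2 <= 1 by rewrite ge_min lexx.
  have m12 : m1 <= Re l - Im l by rewrite ge_min lexx orbT.
  have m22 : m2 <= Re l + Im l by rewrite ge_min lexx orbT.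
  by apply: ler_pM; [exact: ltW|exact: ltW|nra|nra].
have H x := HK _ _ _ _ b3 b4 b1 b2 b5 x.
apply: (@riemann_telescope (gF ze (l - 1) (1 + t%:C * (l - 1)) (0 + t%:C * ze)) _ _ _ N0 K0).
- by move=> x; have [h1 h2] := H x; first [exact: h1|exact: h2].
- by move=> x; have [h1 h2] := H x; first [exact: h1|exact: h2].
Qed.
End GaussianRiemann.

(** * Discrete Poisson summation *)

Section Poisson.
Variable R : realType.
Local Notation C := R[i].
Local Notation "x %:C" := (real_complex _ x) : ring_scope.

Definition ph (y : R) : C := cexp (y%:C * 'i%C).

Lemma phD x y : ph (x + y) = ph x * ph y.
Proof. by rewrite /ph rcD mulrDl cexpD. Qed.

Lemma ph0 : ph 0 = 1. Proof. by rewrite /ph rc0 mul0r cexp0. Qed.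

Lemma phN x : ph (- x) = (ph x)^-1.
Proof. by rewrite /ph rcN mulNr cexpN. Qed.

Lemma phE y : ph y = (cos y +i* sin y)%C.
Proof.
rewrite /ph cexpE; have -> : Re (y%:C * 'i%C) = 0 by rewrite ReMc /=; ring.
have -> : Im (y%:C * 'i%C) = y by rewrite ImMc /=; ring.
by rewrite expR0 rc1 mul1r.
Qed.

Lemma cm_ph y : cm (ph y) = 1.
Proof. by rewrite /ph cm_cexp ReMc /= mulr0 mul0r subr0 expR0. Qed.

Lemma ph_neq0 y : ph y != 0. Proof. exact: cexp_neq0. Qed.

Lemma phMn y n : ph (n%:R * y) = ph y ^+ n.
Proof. by rewrite /ph rcM real_complex_nat -mulrA cexpMn. Qed.

Lemma ph2pi n : ph (n%:R * (2 * pi)) = 1.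
Proof.
rewrite phMn phE mulrC mulr_natr cos2pi sin2pi complexr0 rc1 expr1n//.
Qed.

Lemma ph_neq1 y : 0 < y < 2 * pi -> ph y != 1.
Proof.
move=> hy; apply/eqP; rewrite phE => -[h _].
have : cos y = 1 - (sin (y / 2) ^+ 2) *+ 2.
  have -> : cos y = cos (y / 2) ^+ 2 *+ 2 - 1.
    by rewrite -cos_mulr2n; congr cos; field.
  by rewrite cos2sin2; ring.
rewrite h => e.
have : 0 < sin (y / 2) by apply: sin_gt0_pi; lra.
move=> s0; have := exprn_gt0 2 s0; lra.
Qed.

(* Riemann sum with step 1/N for a Fourier integral of the Gaussian. Its sum over the
   frequencies mod N is a partial theta series: a discrete Poisson formula. *)
Definition AN (N : nat) (l : C) (u : R) : C :=
  N%:R^-1%:C * \sum_(j < nn N) (gwt l 0 (xg R N j) * ph (- (2 * pi * u * xg R N j))).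

(** Completing the square turns the Fourier phase into the imaginary shift ze = u i / l. *)
Lemma AN_gauss N l u : l != 0 ->
  AN N l u = cexp (- (pi * u ^+ 2)%:C / l ^+ 2) * l^-1 * IN N l (u%:C * 'i%C / l).
Proof.
move=> l0; rewrite /AN /IN [RHS]mulrCA; congr (_ * _).
rewrite mulr_sumr; apply: eq_bigr => j _; move: (xg R N j) => x.
rewrite -[RHS]mulrA (mulKf l0) /gwt /ph -!cexpD; congr cexp.
rewrite (rcM pi (u ^+ 2)) rcX rcN !rcM real_complex_nat.
have i2 : ('i%C : C) ^+ 2 = -1 by exact: sqr_i.
move: ('i%C : C) i2 (pi%:C) (x%:C) (u%:C) => i i2 q y v.
have -> : (l * y + v * i / l) ^+ 2 = (l * y) ^+ 2 + 2 * (y * (v * i)) + v ^+ 2 * i ^+ 2 / l ^+ 2 by field.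
by rewrite i2; field.
Qed.

Lemma sum_block (V : zmodType) (g : nat -> V) m n :
  \sum_(j < m * n) g j = \sum_(i < m) \sum_(r < n) g (i * n + r)%N.
Proof.
elim: m => [|m IH]; first by rewrite mul0n !big_ord0.
by rewrite mulSn addnC big_split_ord/= IH big_ord_recr.
Qed.

Lemma gwt_nat (l : C) (m : nat) : gwt l 0 m%:R = cexp (- (pi%:C * l ^+ 2)) ^+ (m * m).
Proof.
rewrite /gwt -cexpMn; congr cexp; rewrite real_complex_nat natrM.
by move: (pi%:C) => q; ring.
Qed.

Lemma gwtN (l : C) x : gwt l 0 (- x) = gwt l 0 x.
Proof. by rewrite /gwt rcN !addr0 mulrN sqrrN. Qed.

(** Orthogonality of the N-th roots of unity: summing over the frequencies keeps only the grid
    points whose index is a multiple of N, that is the integers from -N to N. The grid splits into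
    2N blocks of length N and one last point. *)
Lemma AN_sum N l : (0 < N)%N ->
  \sum_(k < N) AN N l k%:R =
  1 + 2 * \sum_(i < N) cexp (- (pi%:C * l ^+ 2)) ^+ (i.+1 * i.+1).
Proof.
move=> N0; have NR : 0 < N%:R :> R by rewrite ltr0n.
pose w j := ph (- (2 * pi * (j%:R / N%:R))).
have wE (j k : nat) : ph (- (2 * pi * k%:R * xg R N j)) = w j ^+ k.
  rewrite /w -phMn /xg.
  have -> : - (2 * pi * k%:R * ((j%:R - (N * N)%:R) / N%:R)) =
     k%:R * - (2 * pi * (j%:R / N%:R)) + (k * N)%:R * (2 * pi) :> R.
    by rewrite !natrM; field; rewrite gt_eqF.
  by rewrite phD ph2pi mulr1.
have wN j : w j ^+ N = 1.
  rewrite /w -phMn (_ : _ * _ = - (j%:R * (2 * pi))); last by field; rewrite gt_eqF.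
  by rewrite phN ph2pi invr1.
have delta i r : (r < N)%N -> \sum_(k < N) w (i * N + r)%N ^+ k = if r == 0%N then N%:R else 0.
  move=> rN.
  have -> : w (i * N + r)%N = w r.
    rewrite /w (_ : - _ = - (2 * pi * (r%:R / N%:R)) + - (i%:R * (2 * pi))); last first.
      by rewrite natrD natrM; field; rewrite gt_eqF.
    by rewrite phD [ph (- (i%:R * _))]phN ph2pi invr1 mulr1.
  case: eqP => [->|/eqP r0].
    rewrite /w mul0r mulr0 oppr0 ph0; under eq_bigr do rewrite expr1n.
    by rewrite sumr_const card_ord.
  have w1 : w r - 1 != 0.
    rewrite subr_eq0 /w phN -[X in _ != X]invr1 (inj_eq invr_inj).
    apply: ph_neq1.
    have r1 : 0 < r%:R :> R by rewrite ltr0n lt0n.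
    have rr : r%:R / N%:R < 1 :> R by rewrite ltr_pdivrMr// mul1r ltr_nat.
    have p0 := pi_gt0 R; rewrite mulr_gt0 ?divr_gt0 ?mulr_gt0//=.
    by rewrite -[ltRHS]mulr1 ltr_pM2l// mulr_gt0.
  by apply: (mulfI w1); rewrite -subrX1 wN subrr mulr0.
have -> : \sum_(k < N) AN N l k%:R =
   \sum_(j < nn N) gwt l 0 (xg R N j) * (N%:R^-1%:C * \sum_(k < N) w j ^+ k).
  rewrite /AN -mulr_sumr exchange_big/= mulr_sumr; apply: eq_bigr => j _.
  rewrite [RHS]mulrCA; congr (_ * _); rewrite mulr_sumr.
  by apply: eq_bigr => k _; rewrite wE.
have nnE : nn N = (2 * N * N).+1 by rewrite /nn mulnA.
have NC : (N%:R^-1)%:C * N%:R = 1 :> C.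
  by rewrite -real_complex_nat -rcM mulVf ?rc1// gt_eqF.
rewrite nnE big_ord_recr/= (sum_block (fun j => gwt l 0 (xg R N j) * (N%:R^-1%:C * \sum_(k < N) w j ^+ k)))/=.
have blk i : \sum_(r < N) gwt l 0 (xg R N (i * N + r)) * (N%:R^-1%:C * \sum_(k < N) w (i * N + r)%N ^+ k) =
   gwt l 0 (xg R N (i * N)).
  case: N N0 @w {wE wN NR nnE} delta NC => // n _ w delta NC.
  rewrite big_ord_recl/= [X in _ + X]big1 => [|r _]; last first.
    by rewrite (delta i (bump 0 r)) ?ltnS/= ?mulr0 ?mulr0// /bump/= add1n ltn_ord.
  by rewrite delta//= addr0 NC mulr1 addn0.
have -> : w (2 * N * N)%N = w (2 * N * N + 0)%N by rewrite addn0.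
rewrite delta// eqxx NC mulr1.
under eq_bigr do rewrite blk.
rewrite -(big_ord_recr (2 * N) (fun i : 'I__ => gwt l 0 (xg R N (i * N))))/=.
rewrite (sum_sym (fun i => gwt l 0 (xg R N (i * N)))).
have x0 : xg R N (N * N) = 0 by rewrite -[X in xg _ N X]addn0 xg_mid mul0r.
have g0 : gwt l 0 0 = 1 by exact: (gwt_nat l 0).
rewrite x0 g0; congr (_ + _).
rewrite mulr_sumr; apply: eq_bigr => i _.
have -> : xg R N ((N + i.+1) * N) = i.+1%:R.
  by rewrite mulnDl xg_mid natrM mulfK// gt_eqF.
have -> : xg R N ((N - i.+1) * N) = - i.+1%:R.
  rewrite mulnBl xg_midN ?natrM ?mulfK ?gt_eqF//.
  by rewrite leq_mul2r ltn_ord orbT.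
by rewrite gwtN gwt_nat; ring.
Qed.

Lemma AN_refl N l u : (0 < N)%N -> AN N l (N%:R - u) = AN N l u.
Proof.
move=> N0; have NR : 0 < N%:R :> R by rewrite ltr0n.
have -> : AN N l (N%:R - u) =
   N%:R^-1%:C * \sum_(j < nn N) (gwt l 0 (xg R N j) * ph (2 * pi * u * xg R N j)).
  rewrite /AN; congr (_ * _); apply: eq_bigr => j _; congr (_ * _).
  have -> : - (2 * pi * (N%:R - u) * xg R N j) =
     - (j%:R * (2 * pi)) + (N * N)%:R * (2 * pi) + 2 * pi * u * xg R N j.
    by rewrite /xg; field; rewrite gt_eqF.
  by rewrite phD phD phN !ph2pi invr1 !mul1r.
rewrite /AN (reindex_inj rev_ord_inj)/=; congr (_ * _); apply: eq_bigr => j _.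
have -> : xg R N (nn N - j.+1) = - xg R N j.
  rewrite /xg /nn subSS natrB; last by rewrite -ltnS.
  by rewrite natrM; field; rewrite gt_eqF.
by rewrite gwtN mulrN.
Qed.

(** For an odd number N = 2M + 1 of frequencies, [AN_refl] pairs k with N - k and leaves 1 <= k <=
    M, the range covered by [AN_decay]. *)
Lemma AN_fold M l : \sum_(k < M.*2.+1) AN M.*2.+1 l k%:R =
  AN M.*2.+1 l 0 + 2 * \sum_(i < M) AN M.*2.+1 l i.+1%:R.
Proof.
rewrite big_ord_recl/=; congr (_ + _).
under eq_bigr do rewrite /bump/= add1n.
rewrite -addnn big_split_ord/= mulr_natl mulr2n; congr (_ + _).
rewrite (reindex_inj rev_ord_inj)/=; apply: eq_bigr => i _.
rewrite -[RHS]AN_refl//; congr AN; rewrite -natrB; last by have := ltn_ord i; lia.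
by congr (_%:R); have := ltn_ord i; lia.
Qed.

Lemma sin_ge (y : R) : 0 <= y <= pi / 2 -> y / 8 <= sin y.
Proof.
move=> /andP[y0 y1]; have p2 := pihalf_lt2 R; have p1 := pihalf_ge1 R.
have small (z : R) : 0 <= z <= 2^-1 -> z / 2 <= sin z.
  move=> /andP[z0 z1]; have zz : `|z| <= 1 by rewrite ger0_norm; lra.
  have := sin_subid zz; rewrite ler_norml => /andP[h _]; nra.
have [yl|yl] := leP y 2^-1; first by have := small y; lra.
have h := small 2^-1; have {}h : 2^-1 / 2 <= sin (2^-1 : R) by apply: h; lra.
have : sin (2^-1) < sin y.
  by rewrite ltr_sin ?in_itv/=; lra.
lra.
Qed.

Lemma abel2 (F : fieldType) (w : F) (a : nat -> F) n : w != 0 ->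
  (w + w^-1 - 2) * \sum_(j < n) a j.+1 * w ^+ j =
  \sum_(j < n) (a j - 2 * a j.+1 + a j.+2) * w ^+ j +
  (a n * w ^+ n - a 0%N) + (a 1%N * w^-1 - a n.+1 * w ^+ n * w^-1).
Proof.
move=> w0; elim: n => [|n IH]; first by rewrite !big_ord0 expr0; ring.
rewrite !big_ord_recr/= mulrDr IH exprS.
by move: (\sum_(i < n) _) (w ^+ n) (a n) (a n.+1) (a n.+2) (a 0%N) (a 1%N) =>
  S x b c d e f; field.
Qed.

(** The domination needed for Tannery, uniform in [N]. Second differences of the Gaussian and the
    four boundary terms total at most 10 K / N, while |w + 1/w - 2| = 4 sin^2 (pi k / N) >= (k/N)^2
    / 4 as long as 2k <= N. *)
Lemma AN_decay (l : C) : `|Im l| < Re l -> exists2 D : R, 0 <= D &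
  forall N k, (0 < N)%N -> (k.+1 * 2 <= N)%N -> cm (AN N l k.+1%:R) <= D * (k.+1%:R ^+ 2)^-1.
Proof.
move=> hl; have c0 : 0 < Re (l ^+ 2).
  rewrite expr2 ReMc -!expr2 subr_gt0; move: hl; rewrite ltr_norml => /andP[]; nra.
have [K K0 HK] := gauss_taylor (1 + cm l) c0.
have b1 : cm (1 : C) <= 1 + cm l by rewrite cm1 lerDl cm_ge0.
have b2 : cm (0 : C) <= 1 + cm l by rewrite cm0 addr_ge0 ?ler01 ?cm_ge0.
have b3 : cm l <= 1 + cm l by rewrite lerDr ler01.
have H x := HK _ _ _ _ b1 b2 b3 b2 (lexx _) x.
have FE x : gF 1 0 l 0 x = gwt l 0 x by rewrite /gF mul0r addr0 mul1r.
exists (40 * K); first by rewrite mulr_ge0.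
move=> N k N0 kN; have NR : 0 < N%:R :> R by rewrite ltr0n.
set h := N%:R^-1 : R; have h0 : 0 < h by rewrite invr_gt0.
have hN : h * N%:R = 1 by rewrite mulVf// gt_eqF.
have hle : `|h| <= 1 by exact: invn_le1.
have hleN : `|- h| <= 1 by rewrite normrN.
pose w := ph (- (2 * pi * k.+1%:R / N%:R)).
have w0 : w != 0 by exact: ph_neq0.
have cw n : cm (w ^+ n) = 1 by rewrite cmX cm_ph expr1n.
have cw' : cm w^-1 = 1 by rewrite cmV cm_ph invr1.
pose a j := gwt l 0 (xg R N j - h).
have a1 j : a j.+1 = gwt l 0 (xg R N j) by rewrite /a xgS addrK.
have S0 : AN N l k.+1%:R = h%:C * \sum_(j < nn N) a j.+1 * w ^+ j.
  rewrite /AN; congr (_ * _); apply: eq_bigr => j _; rewrite a1; congr (_ * _).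
  rewrite /w -phMn.
  have -> : - (2 * pi * k.+1%:R * xg R N j) =
     j%:R * - (2 * pi * k.+1%:R / N%:R) + (k.+1 * N)%:R * (2 * pi).
    by rewrite /xg !natrM; field; rewrite gt_eqF.
  by rewrite phD ph2pi mulr1.
have e := abel2 a (nn N) w0.
have fb x : N%:R <= `|x| -> cm (gwt l 0 x) <= K * h.
  move=> hx; have [h1 _] := H x; rewrite FE in h1; apply: le_trans h1 _.
  by rewrite ler_wpM2l//; apply: le_trans (expR_natN R N0); rewrite ler_expR lerN2.
have x0 : xg R N 0 = - N%:R by rewrite /xg sub0r natrM mulNr mulfK// gt_eqF.
have xn : xg R N (nn N) = N%:R + h.
  have -> : nn N = (N * N + (N * N).+1)%N by rewrite addnS addnn -mul2n; reflexivity.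
  by rewrite xg_mid -addn1 natrD natrM mulrDl mul1r mulfK// gt_eqF.
have A0 : cm (a 0%N) <= K * h.
  by apply: fb; rewrite x0 -opprD normrN ger0_norm; lra.
have A1 : cm (a 1%N) <= K * h.
  by rewrite a1; apply: fb; rewrite x0 normrN ger0_norm; lra.
have An : cm (a (nn N)) <= K * h.
  by apply: fb; rewrite xn addrK ger0_norm; lra.
have An1 : cm (a (nn N).+1) <= K * h.
  by rewrite a1; apply: fb; rewrite xn ger0_norm; lra.
have B1 : cm (\sum_(j < nn N) (a j - 2 * a j.+1 + a j.+2) * w ^+ j) <= 6 * K * h.
  apply: le_trans (cm_sum _ _ _) _.
  apply: (@le_trans _ _ (\sum_(j < nn N) 2 * K * h ^+ 2 * expR (- `|xg R N j|))).
    apply: ler_sum => j _; rewrite cmM cw mulr1 !a1 xgS -/h /a.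
    have [_ T] := H (xg R N j).
    have T1 := T _ hle; have T2 := T _ hleN; rewrite !FE in T1 T2.
    set D := gF' _ _ _ _ _ in T1 T2; set y := xg R N j in T1 T2 *.
    have -> : gwt l 0 (y - h) - 2 * gwt l 0 y + gwt l 0 (y + h) =
      (gwt l 0 (y - h) - gwt l 0 y - (- h)%:C * D) + (gwt l 0 (y + h) - gwt l 0 y - h%:C * D).
      by rewrite rcN; move: (gwt l 0 (y - h)) (gwt l 0 y) (gwt l 0 (y + h)) (h%:C) => *; ring.
    apply: le_trans (cmD _ _) _; rewrite sqrrN in T2; lra.
  rewrite -mulr_sumr; apply: le_trans (ler_wpM2l _ (exp_sum R N0)) _.
    by apply: mulr_ge0; [exact: mulr_ge0|exact: sqr_ge0].
  have -> : 2 * K * h ^+ 2 * (3 * N%:R) = 6 * K * h * (h * N%:R) by ring.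
  by rewrite hN mulr1.
have TOT : cm ((w + w^-1 - 2) * \sum_(j < nn N) a j.+1 * w ^+ j) <= 10 * K * h.
  rewrite e; apply: le_trans (cmD _ _) _; apply: le_trans (lerD (cmD _ _) (cmB _ _)) _.
  apply: le_trans (lerD (lerD (lexx _) (cmB _ _)) (lexx _)) _.
  clear -A0 A1 An An1 B1 cw cw'; clearbody a; rewrite !cmM !cw cw' !mulr1; lra.
pose y : R := pi * k.+1%:R / N%:R.
have kR : 0 < k.+1%:R :> R by rewrite ltr0n.
have p2 := pi_ge2 R.
have y0 : 0 <= y <= pi / 2.
  rewrite divr_ge0 ?mulr_ge0 ?pi_ge0//= ler_pdivrMr// -!mulrA ler_pM2l ?pi_gt0//.
  by rewrite mulrC ler_pdivlMr// -natrM ler_nat.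
have wE : w + w^-1 - 2 = (- (4 * sin y ^+ 2))%:C.
  rewrite /w -phN !phE opprK cosN sinN.
  have -> : cos (2 * pi * k.+1%:R / N%:R) = 1 - 2 * sin y ^+ 2.
    have -> : 2 * pi * k.+1%:R / N%:R = y *+ 2 by rewrite /y; ring.
    by rewrite cos_mulr2n cos2sin2; ring.
  move: (sin y) (sin _) => s u; apply: complex_ext.
    by rewrite !ReD ReN Re_nat /=; ring.
  by rewrite !ImD ImN Im_nat /=; ring.
have wge : (k.+1%:R * h) ^+ 2 / 4 <= cm (w + w^-1 - 2).
  rewrite wE cm_real normrN ger0_norm; last by apply: mulr_ge0 => //; exact: sqr_ge0.
  have s1 := sin_ge y0.
  have y1 : k.+1%:R * h * 2 <= y by rewrite mulrC /y -mulrA -/h; apply: ler_wpM2r => //; rewrite mulr_ge0// ltW.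
  have : 0 <= k.+1%:R * h by rewrite mulr_ge0// ltW.
  by move: (k.+1%:R * h) y1 s1 => u ? ? ?; nra.
rewrite S0 cmM cm_real (ger0_norm (ltW h0)).
move: TOT; rewrite cmM; set X := cm (\sum_(j < _) _) => TOT.
have X0 : 0 <= X by exact: cm_ge0.
have := ler_wpM2r X0 wge => /le_trans/(_ TOT) F.
rewrite ler_pdivlMr ?exprn_gt0//.
have : h * (k.+1%:R ^+ 2 * (h * X) - 40 * K) <= 0.
  rewrite exprMn in F; nra.
by rewrite pmulr_rle0// subr_le0 mulrC.
Qed.
End Poisson.

(** * Inversion formulas for the theta constants and for Delta *)

Section Inversion.
Variable R : realType.
Local Notation C := R[i].
Local Notation "x %:C" := (real_complex _ x) : ring_scope.

Definition nome (s : C) : C := cexp (- (pi%:C * s)).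

Lemma cm_nome (s : C) : 0 < Re s -> cm (nome s) < 1.
Proof.
move=> s0; rewrite /nome cm_cexp ReN Re_realM -[ltRHS](@expR0 R) ltr_expR oppr_lt0.
by rewrite mulr_gt0 ?pi_gt0.
Qed.

Lemma nome_neq0 s : nome s != 0. Proof. exact: cexp_neq0. Qed.

Lemma ccvg0_bounded (b u : nat -> C) (B : R) : (forall n, cm (b n) <= B) ->
  ccvg u 0 -> ccvg (fun n => b n * u n) 0.
Proof.
move=> bB hu; have B0 : 0 <= B by apply: le_trans (bB 0%N); exact: cm_ge0.
apply: (ccvg_squeeze (N0 := 0%N) _ (tends0Z hu B0)) => n _.
by rewrite !subr0 cmM ler_wpM2r ?cm_ge0.
Qed.

Lemma IN1_bounded : exists B : R, forall N, (0 < N)%N -> cm (IN N (1 : C) 0) <= B.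
Proof.
have [K K0 HK] := gauss_taylor (1 : R) (ltr01 : 0 < (1 : R)).
have b1 : cm (1 : C) <= 1 by rewrite cm1.
have b0 : cm (0 : C) <= 1 by rewrite cm0 ler01.
have b2 : 1 <= Re ((1 : C) ^+ 2) by rewrite expr1n.
exists (3 * K) => N N0; have NR : 0 < N%:R :> R by rewrite ltr0n.
rewrite /IN cmM cm_real ger0_norm ?invr_ge0// mulrC ler_pdivrMr//.
apply: le_trans (cm_sum _ _ _) _.
apply: (@le_trans _ _ (\sum_(j < nn N) K * expR (- `|xg R N j|))).
  apply: ler_sum => j _; have [h _] := HK 1 0 1 0 b1 b0 b1 b0 b2 (xg R N j).
  by move: h; rewrite /gF mul0r addr0 !mul1r.
rewrite -mulr_sumr mulrAC; apply: le_trans (ler_wpM2l K0 (exp_sum R N0)) _.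
by rewrite mulrC.
Qed.

Lemma Re_invsqr (l : C) : l != 0 -> 0 < Re (l ^+ 2) -> 0 < Re (l ^- 2).
Proof.
move=> l0; have l20 : l ^+ 2 != 0 by rewrite expf_neq0.
move: (l ^+ 2) l20 => s s0 hs.
have -> : Re s^-1 = Re s / cm s ^+ 2.
  by rewrite cm_sqr; case: (s).
by rewrite divr_gt0// exprn_gt0// cm_gt0.
Qed.

Lemma sector_sqr (l : C) : `|Im l| < Re l -> l != 0 /\ 0 < Re (l ^+ 2).
Proof.
move=> hl; split.
  apply: contraTneq hl => ->; rewrite -leNgt; exact: normr_ge0.
rewrite expr2 ReMc -!expr2 subr_gt0; move: hl; rewrite ltr_norml => /andP[]; nra.
Qed.

(** The sum over frequencies is a partial theta series at l^2 by [AN_sum]; by [AN_gauss] and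
    [gaussI] its terms approach those of the series at l^(-2), times a Riemann sum of the real
    Gaussian that is kept as it is. *)
Lemma theta_asymp (l : C) : `|Im l| < Re l ->
  ccvg (fun M => l^-1 * IN M.*2.+1 1 0 * th3 (nome (l ^- 2))) (th3 (nome (l ^+ 2))).
Proof.
move=> hl; have [l0 hl2] := sector_sqr hl; have hli := Re_invsqr l0 hl2.
have p1 := cm_nome hl2; have q1 := cm_nome hli.
set p := nome (l ^+ 2) in p1 *; set q := nome (l ^- 2) in q1 *.
have [B HB] := IN1_bounded; have [D D0 HD] := AN_decay hl.
have B0 : 0 <= B by apply: le_trans (HB 1%N isT); exact: cm_ge0.
have ANq N (k : nat) : AN N l k%:R = q ^+ (k * k) * l^-1 * IN N l (k%:R%:C * 'i%C / l).
  rewrite AN_gauss// /q /nome -cexpMn; congr (cexp _ * _ * _).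
  by rewrite rcM rcX real_complex_nat natrM; move: (pi%:C) => P; field.
have diff0 (k : nat) : ccvg (fun M => AN M.*2.+1 l k%:R - q ^+ (k * k) * l^-1 * IN M.*2.+1 1 0) 0.
  have [K K0 HK] := gaussI (k%:R%:C * 'i%C / l) hl.
  have t := tends0Z (tends0_inv K) (cm_ge0 (q ^+ (k * k) * l^-1)).
  have t2 : tends0 (fun M => cm (q ^+ (k * k) * l^-1) * (K / M.*2.+1%:R)).
    by apply: (tends0_comp t (f := double)) => n; rewrite -addnn leq_addr.
  apply: (ccvg_squeeze (N0 := 0%N) _ t2) => n _.
  rewrite subr0 ANq -mulrBr [leLHS]cmM; apply: ler_wpM2l; first exact: cm_ge0.
  exact: HK.
have sm : summ (fun i => D * (i.+1%:R ^+ 2)^-1 + cm l^-1 * B * cm q ^+ (i * i)).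
  apply: summD; first by apply: summZ => //; exact: summ_inv2.
  by apply: summZ; [rewrite mulr_ge0 ?cm_ge0|exact: square_summ].
have dom M i : (i < M)%N -> cm (AN M.*2.+1 l i.+1%:R - q ^+ (i.+1 * i.+1) * l^-1 * IN M.*2.+1 1 0) <=
   D * (i.+1%:R ^+ 2)^-1 + cm l^-1 * B * cm q ^+ (i * i).
  move=> iM; apply: le_trans (cmB _ _) _; apply: lerD; first by apply: HD; lia.
  have c1 : cm q ^+ (i.+1 * i.+1) <= cm q ^+ (i * i).
    by apply: ler_wiXn2l; [exact: cm_ge0|exact: ltW|lia].
  have -> : cm l^-1 * B * cm q ^+ (i * i) = cm q ^+ (i * i) * cm l^-1 * B by ring.
  rewrite [leLHS]cmM (cmM (q ^+ _)) cmX; apply: ler_pM => //.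
  - by rewrite mulr_ge0 ?cm_ge0// exprn_ge0// cm_ge0.
  - exact: cm_ge0.
  - by apply: ler_wpM2r => //; exact: cm_ge0.
  - exact: HB.
have z0 : csumto (fun _ => 0 : C) 0.
  by apply: ccvg_eq (ccvg_cst 0) => n; rewrite big1.
have T := tannery_fin (K := id) sm dom (fun n => leqnn n) (fun k => diff0 k.+1) z0.
pose SM M := 1 + 2 * \sum_(i < M) p ^+ (i.+1 * i.+1).
pose TM M := 1 + 2 * \sum_(i < M) q ^+ (i.+1 * i.+1).
have SMc : ccvg (fun M => SM M.*2.+1) (th3 p).
  rewrite th3_def; apply: ccvgD; first exact: ccvg_cst.
  apply: ccvgZ; apply: (ccvg_comp (th3_csum p1) (f := fun M => M.*2.+1)) => n; lia.
have TMc : ccvg TM (th3 q).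
  by rewrite th3_def; apply: ccvgD; [exact: ccvg_cst|apply: ccvgZ; exact: th3_csum].
have main := ccvgD (diff0 0%N) (ccvgZ 2 T).
have e M : AN M.*2.+1 l 0%:R - q ^+ (0 * 0) * l^-1 * IN M.*2.+1 1 0 +
    2 * \sum_(i < M) (AN M.*2.+1 l i.+1%:R - q ^+ (i.+1 * i.+1) * l^-1 * IN M.*2.+1 1 0) =
    SM M.*2.+1 - l^-1 * IN M.*2.+1 1 0 * TM M.
  rewrite /SM -/(nome _) -AN_sum// AN_fold sumrB /TM mul0n expr0.
  have -> : \sum_(i < M) q ^+ (i.+1 * i.+1) * l^-1 * IN M.*2.+1 1 0 =
    (\sum_(i < M) q ^+ (i.+1 * i.+1)) * (l^-1 * IN M.*2.+1 1 0).
    by rewrite mulr_suml; apply: eq_bigr => i _; rewrite [RHS]mulrA.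
  move: (\sum_(i < M) AN _ _ _) (\sum_(i < M) q ^+ _) (AN _ _ _) (IN _ _ _) => a b c d.
  ring.
have u_bd M : cm (l^-1 * IN M.*2.+1 1 0) <= cm l^-1 * B.
  by rewrite cmM ler_wpM2l ?cm_ge0// HB.
have h0 : ccvg (fun M => TM M - th3 q) 0 by rewrite -[0](subrr (th3 q)); apply: ccvgB => //; exact: ccvg_cst.
have h1 := ccvg0_bounded u_bd h0.
have h2 := ccvgB SMc (ccvgD main h1).
rewrite mulr0 !addr0 subr0 in h2.
apply: ccvg_eq h2 => M; rewrite e.
by move: (SM _) (TM _) (l^-1 * _) (th3 q) => a b c d; ring.
Qed.

(** The case l = 1 of [theta_asymp] compares th3 (e^(-pi)), which is nonzero, with itself, and so
    forces the Riemann sums of the Gaussian to tend to 1. *)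
Lemma theta_inversion (l : C) : `|Im l| < Re l ->
  th3 (nome (l ^+ 2)) = l^-1 * th3 (nome (l ^- 2)).
Proof.
have h1 : `|Im (1 : C)| < Re (1 : C) by rewrite /= normr0 ltr01.
have := theta_asymp h1; rewrite !expr1n invr1.
have -> : nome 1 = (expR (- pi))%:C by rewrite /nome mulr1 -rcN cexp_real.
set q := th3 _; have q0 : q != 0.
  have hq : 0 <= (expR (- pi) : R) < 1.
    apply/andP; split; first exact: expR_ge0.
    by rewrite -[ltRHS](@expR0 R) ltr_expR oppr_lt0 pi_gt0.
  have := th3_ge1 hq; rewrite -/q => q1; apply: contraTneq q1 => ->.
  by rewrite -ltNge ltr01.
move=> h; have {}h : ccvg (fun M => IN M.*2.+1 (1 : C) 0) 1.
  have := ccvgZ q^-1 h; rewrite mulVf//; apply: ccvg_eq => M.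
  by rewrite mul1r mulrCA mulVf// mulr1.
move=> hl; apply: ccvg_uniq (theta_asymp hl) _.
have := ccvgZ (l^-1 * th3 (nome (l ^- 2))) h; rewrite mulr1; apply: ccvg_eq => M.
by rewrite mulrAC.
Qed.

Lemma nomeMn (s : C) n : nome (n%:R * s) = nome s ^+ n.
Proof. by rewrite /nome mulrCA -mulrN cexpMn. Qed.

Lemma sector_half (l : C) : `|Im l| < Re l -> `|Im (2^-1%:C * l)| < Re (2^-1%:C * l).
Proof.
by move=> hl; rewrite Re_realM Im_realM normrM ger0_norm ?invr_ge0// ltr_pM2l// invr_gt0.
Qed.

Lemma sector_inv (l : C) : `|Im l| < Re l -> `|Im l^-1| < Re l^-1.
Proof.
move=> hl; have [l0 _] := sector_sqr hl; have c0 : 0 < (cm l ^+ 2)^-1.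
  by rewrite invr_gt0 exprn_gt0// cm_gt0.
have -> : Re l^-1 = Re l * (cm l ^+ 2)^-1 by rewrite cm_sqr; case: (l).
have -> : Im l^-1 = - Im l * (cm l ^+ 2)^-1 by rewrite cm_sqr; case: (l) => a b /=; rewrite mulNr.
by rewrite normrM normrN (gtr0_norm c0) ltr_pM2r.
Qed.

(* 2 P ps(p) with P^4 = p is the classical theta_2, which the inversion exchanges
   with theta_4. *)
Lemma theta2_inversion (l : C) : `|Im l| < Re l ->
  2 * (nome (l ^+ 2 / 4) * ps (nome (l ^+ 2))) = l^-1 * th3 (- nome (l ^- 2)).
Proof.
move=> hl; have [l0 hl2] := sector_sqr hl; have hli := Re_invsqr l0 hl2.
have s4 : 0 < Re (l ^+ 2 / 4).
  have -> : l ^+ 2 / 4 = 4^-1%:C * l ^+ 2 by rewrite rcV real_complex_nat mulrC.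
  by rewrite Re_realM mulr_gt0// invr_gt0.
have e4 : nome (l ^+ 2 / 4) ^+ 4 = nome (l ^+ 2) by rewrite -nomeMn; congr nome; field.
have := th3_split (cm_nome s4); rewrite e4.
have -> : nome (l ^+ 2 / 4) = nome ((2^-1%:C * l) ^+ 2).
  by congr nome; rewrite exprMn rcV real_complex_nat; field.
rewrite (theta_inversion (sector_half hl)) (theta_inversion hl).
have -> : nome ((2^-1%:C * l) ^- 2) = nome (l ^- 2) ^+ 4.
  by rewrite -nomeMn; congr nome; rewrite rcV real_complex_nat; field.
have q1 := cm_nome hli; have qN1 : cm (- nome (l ^- 2)) < 1 by rewrite cmN.
have := th3_split q1; have := th3_split qN1.
have -> : (- nome (l ^- 2)) ^+ 4 = nome (l ^- 2) ^+ 4 by rewrite exprNn -signr_odd expr0 mul1r.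
have -> : (2^-1%:C * l)^-1 = 2 * l^-1 by rewrite rcV real_complex_nat invfM invrK.
move: (nome (l ^- 2)) (nome ((2^-1%:C * l) ^+ 2)) (ps (nome (l ^+ 2))) => q P y.
move: (ps (q ^+ 4)) => x.
move: (th3 q) (th3 (- q)) (th3 (q ^+ 4)) => a b c eb ea h.
have -> : 2 * (P * y) = 2 * l^-1 * c - l^-1 * a by rewrite h addrC addKr.
by rewrite ea eb; ring.
Qed.

Lemma eta_inversion_algebra (F : fieldType) (l P Q x y a b c d E1 E2 : F) :
  l != 0 -> (2 : F) != 0 -> 2 * (P * x) = l^-1 * d -> 2 * (Q * y) = l * b -> a = l^-1 * c ->
  x * a * b = E1 -> y * c * d = E2 -> P * E1 = l ^- 3 * (Q * E2).
Proof.
move=> l0 F2 h1 h2 -> <- <-.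
have -> : P * (x * (l^-1 * c) * b) = (2 * (P * x)) * (l^-1 * c * b) / 2 by field; rewrite l0 F2.
have -> : Q * (y * c * d) = (2 * (Q * y)) * (c * d) / 2 by field.
by rewrite h1 h2; field; rewrite l0 F2.
Qed.

(** The product of the three theta inversions, in which theta_2 and theta_4 are exchanged; by
    [theta_mul] it is the law for eta^3. *)
Lemma eta_inversion (l : C) : `|Im l| < Re l ->
  nome (l ^+ 2 / 4) * Eul (nome (l ^+ 2) ^+ 2) ^+ 3 =
  l ^- 3 * (nome (l ^- 2 / 4) * Eul (nome (l ^- 2) ^+ 2) ^+ 3).
Proof.
move=> hl; have [l0 hl2] := sector_sqr hl; have hli := Re_invsqr l0 hl2.
have a2 := theta2_inversion (sector_inv hl).
rewrite exprVn invrK invrK in a2.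
apply: (eta_inversion_algebra l0 _ (theta2_inversion hl) a2 (theta_inversion hl)
  (theta_mul (nome_neq0 _) (cm_nome hl2)) (theta_mul (nome_neq0 _) (cm_nome hli))).
by rewrite pnatr_eq0.
Qed.

Definition eD (z : C) : C := cexp (2 * pi%:C * 'i%C * z).
(* The discriminant Delta on the upper half-plane. *)
Definition Dl (z : C) : C := eD z * Eul (eD z) ^+ 24.

Lemma cm_eD z : cm (eD z) = expR (- (2 * pi) * Im z).
Proof.
rewrite /eD cm_cexp; congr expR; rewrite -[2]real_complex_nat -rcM -mulrA Re_realM.
by rewrite ReMc /=; ring.
Qed.

Lemma cm_eD_lt1 z : 0 < Im z -> cm (eD z) < 1.
Proof.
move=> z0; rewrite cm_eD -[ltRHS](@expR0 R) ltr_expR mulNr oppr_lt0.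
by rewrite !mulr_gt0 ?pi_gt0.
Qed.

Lemma eD_nome (z : C) : eD z = nome (- 'i%C * z) ^+ 2.
Proof.
rewrite /eD -nomeMn /nome; congr cexp; move: (pi%:C) ('i%C : C) => p i; ring.
Qed.

(** Of the two square roots, the one with positive real part lies in the sector, because Re (l^2) >
    0 means |Im l| < |Re l|. *)
Lemma sector_sqrt (s : C) : 0 < Re s -> exists2 l : C, `|Im l| < Re l & l ^+ 2 = s.
Proof.
move=> s0; have e := sqr_sqrtc s; set r := sqrtc s in e.
have h : 0 < Re (r ^+ 2) by rewrite e.
rewrite expr2 ReMc -!expr2 subr_gt0 in h.
have h2 : `|Im r| < `|Re r| by rewrite -(ltr_pXn2r (n := 2)) ?nnegrE// !real_normK ?num_real.
have [r0|r0] := leP 0 (Re r); first by exists r => //; rewrite -[ltRHS]ger0_norm.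
exists (- r); last by rewrite sqrrN.
by rewrite ReN ImN normrN -[ltRHS]ltr0_norm.
Qed.

Lemma Im_invN (z : C) : 0 < Im z -> 0 < Im (- z^-1).
Proof.
move=> z0; have h : z != 0 by apply: contraTneq z0 => ->; rewrite ltxx.
have -> : Im (- z^-1) = Im z / cm z ^+ 2.
  by rewrite cm_sqr; case: (z) => a b /=; rewrite opprK.
by rewrite divr_gt0// exprn_gt0// cm_gt0.
Qed.

Lemma eighth_power (F : comNzRingType) (A Q L E1 E2 : F) :
  A * E1 ^+ 3 = L * (Q * E2 ^+ 3) -> A ^+ 8 * E1 ^+ 24 = L ^+ 8 * (Q ^+ 8 * E2 ^+ 24).
Proof.
move=> h; transitivity ((A * E1 ^+ 3) ^+ 8); first by rewrite exprMn -exprM.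
by rewrite h [LHS]exprMn [(Q * _) ^+ 8]exprMn -exprM.
Qed.

(** The eighth power of the law for eta^3 at l^2 = - i z: the factor l^(-24) is (- i z)^(-12) =
    z^(-12), so the choice of the root disappears. *)
Lemma Delta_inversion (z : C) : 0 < Im z -> Dl (- z^-1) = z ^+ 12 * Dl z.
Proof.
move=> z0; have zn : z != 0 by apply: contraTneq z0 => ->; rewrite ltxx.
have i2 : ('i%C : C) ^+ 2 = -1 by exact: sqr_i.
have s0 : 0 < Re (- 'i%C * z) by rewrite ReMc /=; lra.
have [l hl e] := sector_sqrt s0; have [l0 _] := sector_sqr hl.
have eta := eta_inversion hl.
have eX : nome (l ^+ 2) ^+ 2 = eD z by rewrite eD_nome e.
have eY : nome (l ^- 2) ^+ 2 = eD (- z^-1).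
  rewrite eD_nome; congr (nome _ ^+ 2); rewrite e.
  move: ('i%C : C) i2 => i i2; have i0 : i != 0.
    by rewrite -sqrf_eq0 i2 oppr_eq0 oner_eq0.
  have -> : (- i * z)^-1 = i / (- i ^+ 2 * z) by field; rewrite zn i0.
  by rewrite i2 opprK mul1r mulrNN.
have n4 (s : C) : nome (s / 4) ^+ 8 = nome s ^+ 2.
  by rewrite -!nomeMn; congr nome; field.
have eL : (l ^- 3) ^+ 8 = (z ^+ 12)^-1.
  have -> : (l ^- 3) ^+ 8 = ((l ^+ 2) ^+ 12)^-1 by rewrite exprVn -!exprM.
  rewrite e exprMn; have -> : (- 'i%C : C) ^+ 12 = 1; last by rewrite mul1r.
  by rewrite (exprM _ 2 6) sqrrN i2 (exprM _ 2 3) sqrrN expr1n expr1n.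
have nX := n4 (l ^+ 2); have nY := n4 (l ^- 2); rewrite eX in nX; rewrite eY in nY.
move: eta eX eY nX nY eL; move: (l ^- 3) (l ^- 2) (l ^+ 2) => L m s eta eX eY nX nY eL.
have := eighth_power eta; rewrite nX nY eX eY eL /Dl => ->.
by rewrite mulVKf// expf_neq0.
Qed.
End Inversion.

(** * q-expansions, decay at i oo and primitives *)

Section QSeries.
Variable R : realType.
Local Notation C := R[i].
Local Notation "x %:C" := (real_complex _ x) : ring_scope.

(** Radius of convergence at least 1. This follows directly from the product, needs no growth
    estimate for tau, and is stable under multiplication and division by n + 1. *)
Definition subexp (a : nat -> C) :=
  forall r : R, 0 < r < 1 -> exists2 B : R, 0 <= B & forall n, cm (a n) * r ^+ n <= B.

Definition majo (p : {poly C}) (P : {poly R}) := forall i, cm p`_i <= P`_i.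

Lemma majo_mul p P q Q : majo p P -> majo q Q -> majo (p * q) (P * Q).
Proof.
move=> hp hq i; rewrite !coefM; apply: le_trans (cm_sum _ _ _) _.
by apply: ler_sum => k _; rewrite cmM ler_pM ?cm_ge0.
Qed.

Lemma majo1 : majo 1 1.
Proof. by move=> i; rewrite !coef1; case: (i == 0%N); rewrite ?cm1 ?cm0. Qed.

Lemma majo_exp p P n : majo p P -> majo (p ^+ n) (P ^+ n).
Proof.
move=> h; elim: n => [|n IH]; first by rewrite !expr0; exact: majo1.
by rewrite !exprS; exact: majo_mul.
Qed.

Definition PN N : {poly C} := (\prod_(k < N) (1 - 'X^(k.+1))) ^+ 24.
(** A majorant of [PN] with nonnegative coefficients: each coefficient times r^i is at most the
    value at r, which is bounded uniformly in [N]. *)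
Definition MN N : {poly R} := (\prod_(k < N) (1 + 'X^(k.+1))) ^+ 24.

Lemma majo_PN N : majo (PN N) (MN N).
Proof.
apply: majo_exp; elim: N => [|N IH]; first by rewrite !big_ord0; exact: majo1.
rewrite !big_ord_recr/=; apply: majo_mul => // i.
rewrite coefB coefD !coef1 !coefXn; apply: le_trans (cmB _ _) _.
by apply: lerD; [case: (i == 0%N)|case: (i == N.+1)]; rewrite ?cm1 ?cm0.
Qed.

Lemma MN_ge0 N i : 0 <= (MN N)`_i.
Proof. by apply: le_trans (majo_PN N i); exact: cm_ge0. Qed.

Lemma MN_horner N (r : R) : 0 <= r < 1 -> (MN N).[r] <= expR (1 - r)^-1 ^+ 24.
Proof.
move=> /andP[r0 r1]; rewrite /MN horner_exp horner_prod lerXn2r ?nnegrE ?expR_ge0//.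
  by apply: prodr_ge0 => k _; rewrite !hornerE addr_ge0// exprn_ge0.
have : \prod_(k < N) (1 + 'X^(k.+1)).[r] <= expR (\sum_(k < N) r ^+ k).
  elim: N => [|N IH]; first by rewrite !big_ord0 expR0.
  rewrite !big_ord_recr/= expRD ler_pM//.
  - by apply: prodr_ge0 => k _; rewrite !hornerE addr_ge0// exprn_ge0.
  - by rewrite !hornerE addr_ge0// exprn_ge0.
  - rewrite !hornerE; apply: le_trans (expR_ge1Dx _).
    by rewrite lerD2l exprS ler_piMl ?exprn_ge0// ltW.
move/le_trans; apply; rewrite ler_expR.
rewrite -[leRHS]mul1r ler_pdivlMr ?subr_gt0//.
by have := subrX1 r N; have := exprn_ge0 N r0; lra.
Qed.

Lemma PN_bound (r : R) : 0 < r < 1 -> exists2 B : R, 0 <= B &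
  forall N i, cm (PN N)`_i * r ^+ i <= B.
Proof.
move=> /andP[r0 r1]; exists (expR (1 - r)^-1 ^+ 24); first by rewrite exprn_ge0// expR_ge0.
move=> N i; have r01 : 0 <= r < 1 by rewrite ltW.
apply: le_trans (MN_horner N r01).
apply: (@le_trans _ _ ((MN N)`_i * r ^+ i)).
  by rewrite ler_wpM2r ?exprn_ge0 ?(ltW r0)//; exact: majo_PN.
rewrite horner_coef; have [iN|Ni] := ltnP i (size (MN N)).
  rewrite (bigD1 (Ordinal iN))//= lerDl; apply: sumr_ge0 => k _.
  by rewrite mulr_ge0 ?MN_ge0// exprn_ge0// ltW.
rewrite nth_default// mul0r; apply: sumr_ge0 => k _.
by rewrite mulr_ge0 ?MN_ge0// exprn_ge0// ltW.
Qed.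

Lemma PN_stable N i : (i <= N)%N -> (PN N.+1)`_i = (PN N)`_i.
Proof.
move=> iN; have [q e] : exists q : {poly C}, PN N.+1 = PN N + q * 'X^(N.+1).
  rewrite /PN big_ord_recr/= exprMn; move: (_ ^+ 24) => A.
  have [q ->] : exists q : {poly C}, (1 - 'X^(N.+1)) ^+ 24 = 1 + q * 'X^(N.+1).
    elim: 24%N => [|n [q e]]; first by exists 0; rewrite expr0 mul0r addr0.
    exists (q - 1 - q * 'X^(N.+1)); rewrite exprS e; ring.
  by exists (A * q); rewrite mulrDr mulr1 mulrA.
by rewrite e coefD coefMXn ltnS iN addr0.
Qed.

(** This is tau(n + 1): the leading q is split off, and later factors no longer change the n-th
    coefficient. *)
Definition dcoef (n : nat) : C := (PN n)`_n.

Lemma PN_dcoef N i : (i <= N)%N -> (PN N)`_i = dcoef i.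
Proof.
elim: N => [|N IH]; first by rewrite leqn0 => /eqP ->.
rewrite leq_eqVlt => /orP[/eqP -> //|]; rewrite ltnS => iN.
by rewrite PN_stable// IH.
Qed.

Lemma subexp_dcoef : subexp dcoef.
Proof. by move=> r /PN_bound[B B0 H]; exists B => // n; exact: H. Qed.

Lemma subexp_dom (a : nat -> C) (x : R) : subexp a -> 0 <= x < 1 ->
  exists2 b, summ b & forall n, cm (a n) * x ^+ n <= b n.
Proof.
move=> sa /andP[x0 x1]; pose r := (1 + x) / 2.
have r01 : 0 < r < 1 by rewrite /r; lra.
have xr : x < r by rewrite /r; lra.
clearbody r; have r0 : 0 < r by lra.
have [B B0 HB] := sa _ r01; exists (fun n => B * (x / r) ^+ n).
  apply: summZ => //; apply: summ_geom.
  by rewrite divr_ge0 ?(ltW r0)//= ltr_pdivrMr// mul1r.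
move=> n; have -> : cm (a n) * x ^+ n = (cm (a n) * r ^+ n) * (x / r) ^+ n.
  by rewrite -mulrA -exprMn [r * _]mulrC divfK// gt_eqF.
by rewrite ler_wpM2r// exprn_ge0// divr_ge0// ltW.
Qed.

Lemma subexpMn (a : nat -> C) : subexp a -> subexp (fun n => a n * n.+1%:R).
Proof.
move=> sa r r01; pose s := (1 + r) / 2.
have s01 : 0 < s < 1 by rewrite /s; lra.
have rs : r < s by rewrite /s; lra.
clearbody s; have [B B0 HB] := sa _ s01; have s0 : 0 < s by lra.
have t01 : 0 <= r / s < 1.
  apply/andP; split; first by apply: divr_ge0; lra.
  by rewrite ltr_pdivrMr// mul1r.
have t1 : 0 < 1 - r / s by lra.
exists (B * (1 - r / s)^-1); first by rewrite mulr_ge0// invr_ge0 ltW.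
move=> n; rewrite cmM cm_nat.
have -> : cm (a n) * n.+1%:R * r ^+ n = (cm (a n) * s ^+ n) * (n.+1%:R * (r / s) ^+ n).
  have sn : s ^+ n != 0 by rewrite expf_neq0// gt_eqF.
  by rewrite expr_div_n; field.
apply: ler_pM => //; first by rewrite mulr_ge0 ?cm_ge0// exprn_ge0// ltW.
  by rewrite mulr_ge0// exprn_ge0//; lra.
by rewrite -[leRHS]mul1r ler_pdivlMr//; exact: geom_le_inv.
Qed.

Lemma subexpZ (a : nat -> C) (c : C) : subexp a -> subexp (fun n => c * a n).
Proof.
move=> sa r /sa[B B0 HB]; exists (cm c * B); first by rewrite mulr_ge0 ?cm_ge0.
by move=> n; rewrite cmM -mulrA ler_wpM2l ?cm_ge0.
Qed.

Lemma subexpVn (a : nat -> C) : subexp a -> subexp (fun n => a n / n.+1%:R).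
Proof.
move=> sa r r01; have [B B0 HB] := sa r r01; exists B => // n.
apply: le_trans (HB n); rewrite cmM cmV cm_nat ler_wpM2r//.
  by rewrite exprn_ge0//; lra.
by rewrite ler_piMr ?cm_ge0// invf_le1 ?ltr0n// ler1n.
Qed.

Definition qsf (a : nat -> C) (z : C) : C := csum (fun n => a n * eD z ^+ n.+1).

Lemma qsf_csum a z : subexp a -> 0 < Im z -> csumto (fun n => a n * eD z ^+ n.+1) (qsf a z).
Proof.
move=> sa z0; have q1 := cm_eD_lt1 z0; have q01 : 0 <= cm (eD z) < 1 by rewrite cm_ge0.
have [b sb hb] := subexp_dom sa q01.
have [|l hl] := summ_csumto (a := fun n => a n * eD z ^+ n.+1) sb; last exact: csumP hl.
move=> n; apply: le_trans (hb n); rewrite cmM cmX ler_wpM2l ?cm_ge0//.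
by rewrite exprS ler_piMl ?exprn_ge0 ?cm_ge0// ltW.
Qed.

(** Tannery for the truncated products: their coefficients are eventually constant and dominated
    through [PN_bound]. *)
Lemma qsf_Dl z : 0 < Im z -> qsf dcoef z = Dl z.
Proof.
move=> z0; have q1 := cm_eD_lt1 z0; have q01 : 0 <= cm (eD z) < 1 by rewrite cm_ge0.
have h := qsf_csum subexp_dcoef z0; rewrite /Dl; move: (qsf _ z) h => S h.
move: (eD z) q1 q01 h => q q1 q01 h.
pose r := (1 + cm q) / 2; have r01 : 0 < r < 1 by rewrite /r; lra.
have qr : cm q < r by rewrite /r; lra.
clearbody r; have r0 : 0 < r by lra.
have [B B0 HB] := PN_bound r01.
have sm : summ (fun i => B * (cm q / r) ^+ i).
  apply: summZ => //; apply: summ_geom.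
  by rewrite divr_ge0 ?cm_ge0 ?(ltW r0)//= ltr_pdivrMr// mul1r.
have dom N i : cm ((PN N)`_i * q ^+ i) <= B * (cm q / r) ^+ i.
  have -> : cm ((PN N)`_i * q ^+ i) = (cm (PN N)`_i * r ^+ i) * (cm q / r) ^+ i.
    by rewrite cmM cmX -mulrA -exprMn [r * _]mulrC divfK// gt_eqF.
  by rewrite ler_wpM2r// exprn_ge0// divr_ge0 ?cm_ge0// ltW.
have lim i : ccvg (fun N => (PN N)`_i * q ^+ i) (dcoef i * q ^+ i).
  by apply: (ccvg_ext (N0 := i)) (ccvg_cst _) => N iN; rewrite PN_dcoef.
have fin N : csumto (fun i => (PN N)`_i * q ^+ i) (PN N).[q].
  by rewrite horner_coef; apply: csumto_fin => k kN; rewrite nth_default ?mul0r.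
have [l hl] : exists l, csumto (fun i => dcoef i * q ^+ i) l.
  by apply: (summ_csumto sm) => k; rewrite -(PN_dcoef (leqnn k)); exact: dom.
have c1 := tannery sm dom lim hl fin.
have c2 : ccvg (fun N => (PN N).[q]) (Eul q ^+ 24).
  apply: ccvg_eq (ccvgX 24 (Eu_cvg q1)) => N; rewrite /PN horner_exp horner_prod /Eu.
  by congr (_ ^+ _); apply: eq_bigr => k _; rewrite !hornerE.
rewrite -(ccvg_uniq c1 c2); refine (ccvg_uniq h _).
change (csumto (fun n => dcoef n * q ^+ n.+1) (q * l)).
apply: csumto_eq (csumtoZ q hl) => k.
by rewrite exprS mulrCA.
Qed.

Definition qc (n : nat) : C := 2 * pi%:C * 'i%C * n.+1%:R.

Lemma qc_neq0 n : qc n != 0.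
Proof.
rewrite /qc !mulf_neq0 ?pnatr_eq0// -cm_gt0 ?cm_i ?cm_real ?ltr01// normr_gt0.
by rewrite gt_eqF// pi_gt0.
Qed.

Lemma subexp_qc a : subexp a -> subexp (fun n => a n * qc n).
Proof.
move=> /subexpMn/(subexpZ (2 * pi%:C * 'i%C)) h r /h [B B0 HB]; exists B => // n.
have -> : a n * qc n = 2 * pi%:C * 'i%C * (a n * n.+1%:R); last exact: HB.
by rewrite /qc mulrCA.
Qed.

Lemma subexp_qcV a : subexp a -> subexp (fun n => a n / qc n).
Proof.
move=> /subexpVn/(subexpZ (2 * pi%:C * 'i%C)^-1) h r /h [B B0 HB]; exists B => // n.
have -> : a n / qc n = (2 * pi%:C * 'i%C)^-1 * (a n / n.+1%:R); last exact: HB.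
by rewrite /qc [in LHS]invfM mulrCA.
Qed.

Lemma eD_add (z h : C) : eD (z + h) = eD z * eD h.
Proof. by rewrite /eD mulrDr cexpD. Qed.

Lemma eDX (z : C) n : eD z ^+ n.+1 = cexp (qc n * z).
Proof. by rewrite /eD -cexpMn; congr cexp; rewrite /qc; move: (_ * 'i%C) => c; ring. Qed.

(** Termwise Taylor expansion. For |h| <= Im z / 2 the factor e^(2 pi (n+1) |h|) of the remainder is
    absorbed by descending to height Im z / 2; the remaining (n + 1)^2 explains the double use of
    [subexpMn]. *)
Lemma CD_qsf a z : subexp a -> 0 < Im z -> CD (qsf a) z (qsf (fun n => a n * qc n) z).
Proof.
move=> sa z0; have p0 := pi_gt0 R; have p2 := pi_ge2 R.
set y := Im z in z0 *; pose d := y / 2.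
have d0 : 0 < d by rewrite /d; lra.
pose x := expR (- (2 * pi) * (y - d)).
have x01 : 0 <= x < 1.
  rewrite expR_ge0/= -[ltRHS](@expR0 R) ltr_expR mulNr oppr_lt0 mulr_gt0 ?mulr_gt0//.
  by rewrite /d; lra.
have [b [b0 [S HS]] hb] := subexp_dom (subexpMn (subexpMn sa)) x01.
exists (S * (12 * (2 * pi) ^+ 2)), d; split => //.
  apply: mulr_ge0; last by apply: mulr_ge0 => //; exact: sqr_ge0.
  by have := HS 0%N; rewrite big_ord0.
move=> h hd.
have zh : 0 < Im (z + h).
  rewrite ImD; have := cm_Im h; rewrite ler_norml => /andP[h1 _].
  by move: h1 hd; rewrite -/y /d; lra.
have c1 := qsf_csum sa zh; have c2 := qsf_csum sa z0.
have c3 := csumtoZ h (qsf_csum (subexp_qc sa) z0).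
have cc := ccvgB (ccvgB c1 c2) c3.
rewrite [qsf _ z * h]mulrC.
apply: (@csumto_cm _ (fun n => a n * eD (z + h) ^+ n.+1 - a n * eD z ^+ n.+1 -
   h * (a n * qc n * eD z ^+ n.+1)) (fun n => b n * (12 * (2 * pi) ^+ 2 * cm h ^+ 2))).
- move=> n; set w := qc n * h.
  have -> : a n * eD (z + h) ^+ n.+1 - a n * eD z ^+ n.+1 - h * (a n * qc n * eD z ^+ n.+1) =
     a n * (eD z ^+ n.+1 * (cexp w - 1 - w)).
    by rewrite eD_add exprMn (eDX h) /w; move: (eD z ^+ n.+1) (a n) (qc n) (cexp _) => ? ? ? ?; ring.
  have wE : cm w = 2 * pi * n.+1%:R * cm h.
    by rewrite /w /qc !cmM !cm_nat cm_i cm_real (gtr0_norm p0) mulr1.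
  rewrite !cmM cmX.
  have t := cexp_taylor w; rewrite wE in t.
  have ex : cm (eD z) ^+ n.+1 * expR (2 * pi * n.+1%:R * cm h) <= x ^+ n.
    apply: (@le_trans _ _ (x ^+ n.+1)); last first.
      by rewrite exprS ler_piMl ?exprn_ge0 ?expR_ge0//; lra.
    rewrite cm_eD -!expRM_natl -expRD ler_expR -/y.
    have -> : n.+1%:R * (- (2 * pi) * y) + 2 * pi * n.+1%:R * cm h = n.+1%:R * (2 * pi * (cm h - y)) by ring.
    rewrite ler_pM2l ?ltr0n//.
    have : 2 * pi * cm h <= 2 * pi * d by rewrite ler_pM2l// mulr_gt0.
    lra.
  have hbn := hb n; rewrite !cmM !cm_nat in hbn.
  have e0 : 0 <= 12 * (2 * pi) ^+ 2 * cm h ^+ 2.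
    by apply: mulr_ge0; [apply: mulr_ge0 => //; exact: sqr_ge0|exact: sqr_ge0].
  apply: le_trans (ler_wpM2r e0 hbn).
  apply: (@le_trans _ _ (cm (a n) * (cm (eD z) ^+ n.+1 *
     (12 * (2 * pi * n.+1%:R * cm h) ^+ 2 * expR (2 * pi * n.+1%:R * cm h))))).
    by rewrite !ler_wpM2l ?exprn_ge0 ?cm_ge0.
  have -> : cm (a n) * (cm (eD z) ^+ n.+1 * (12 * (2 * pi * n.+1%:R * cm h) ^+ 2 *
      expR (2 * pi * n.+1%:R * cm h))) =
      (cm (a n) * n.+1%:R * n.+1%:R * (12 * (2 * pi) ^+ 2 * cm h ^+ 2)) *
      (cm (eD z) ^+ n.+1 * expR (2 * pi * n.+1%:R * cm h)).
    by move: (n.+1%:R) (expR _) (cm (eD z) ^+ _) => u v w'; ring.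
  rewrite [leRHS]mulrAC; apply: ler_wpM2l => //.
  by apply: mulr_ge0 => //; rewrite !mulr_ge0 ?cm_ge0.
- move=> n; rewrite -mulr_suml.
  have -> : S * (12 * (2 * pi) ^+ 2) * cm h ^+ 2 = S * (12 * (2 * pi) ^+ 2 * cm h ^+ 2) by ring.
  apply: ler_wpM2r => //.
  by apply: mulr_ge0; [apply: mulr_ge0 => //; exact: sqr_ge0|exact: sqr_ge0].
- by apply: ccvg_eq cc => n; rewrite !sumrB.
Qed.

Lemma qsf_decay a : subexp a -> exists2 K : R, 0 <= K &
  forall z, 1 <= Im z -> cm (qsf a z) <= K * expR (- 2 * Im z).
Proof.
move=> sa; have p0 := pi_gt0 R; have p2 := pi_ge2 R.
pose x : R := expR (- (2 * pi)).
have x01 : 0 <= x < 1.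
  by rewrite expR_ge0/= -[ltRHS](@expR0 R) ltr_expR oppr_lt0 mulr_gt0.
have [b [b0 [S HS]] hb] := subexp_dom sa x01.
exists S; first by have := HS 0%N; rewrite big_ord0.
move=> z z1; have z0 : 0 < Im z by lra.
apply: (@csumto_cm _ _ (fun n => b n * expR (- 2 * Im z))) (qsf_csum sa z0) => [n|n]; last first.
  by rewrite -mulr_suml ler_wpM2r ?expR_ge0.
apply: le_trans (ler_wpM2r (expR_ge0 _) (hb n)).
rewrite cmM cmX -mulrA ler_wpM2l ?cm_ge0// cm_eD -!expRM_natl -expRD ler_expR.
rewrite -natr1; have : 0 <= n%:R :> R by [].
move: (n%:R) => u u0.
have : 0 <= u * (2 * pi) * (Im z - 1) by rewrite !mulr_ge0//; lra.
have : 0 <= (2 * pi - 2) * Im z by rewrite mulr_ge0//; lra.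
lra.
Qed.

(** The rate e^(- Im z), weaker than the true one, leaves room for factors z^j; uniformity on
    vertical strips makes the notion stable under translation. *)
Definition dec (G : C -> C) := forall c : R, exists K : R, forall z,
  `|Re z| <= c -> 1 <= Im z -> cm (G z) <= K * expR (- Im z).

Lemma dec_add F G : dec F -> dec G -> dec (fun z => F z + G z).
Proof.
move=> hF hG c; have [K HK] := hF c; have [L HL] := hG c; exists (K + L) => z h1 h2.
by apply: le_trans (cmD _ _) _; rewrite mulrDl lerD ?HK ?HL.
Qed.

Lemma dec_scale (c : C) F : dec F -> dec (fun z => c * F z).
Proof.
move=> hF x; have [K HK] := hF x; exists (cm c * K) => z h1 h2.
by rewrite cmM -mulrA ler_wpM2l ?cm_ge0 ?HK.
Qed.

Lemma dec_sum (I : Type) (r : seq I) (F : I -> C -> C) :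
  (forall i, dec (F i)) -> dec (fun z => \sum_(i <- r) F i z).
Proof.
move=> H; elim: r => [|i r IH].
  by move=> c; exists 0 => z _ _; rewrite big_nil cm0 mul0r.
move=> c; have [K HK] := dec_add (H i) IH c; exists K => z h1 h2.
by rewrite big_cons; exact: HK.
Qed.

Lemma dec_translate (k : R) F : dec F -> dec (fun z => F (z + k%:C)).
Proof.
move=> hF c; have [K HK] := hF (c + `|k|); exists K => z h1 h2.
have -> : Im z = Im (z + k%:C) by rewrite ImD /= addr0.
apply: HK; last by rewrite ImD /= addr0.
by rewrite ReD /=; apply: le_trans (ler_normD _ _) _; rewrite lerD2r.
Qed.

Lemma dec_pow_qsf j a : subexp a -> dec (fun z => z ^+ j * qsf a z).
Proof.
move=> sa c; have [K K0 HK] := qsf_decay sa.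
exists (K * (expR (c + 1) * (j.+1%:R ^+ j))) => z h1 h2.
have zb : cm z <= c + Im z.
  apply: le_trans (cm_ReIm _) _; apply: lerD => //.
  by rewrite ger0_norm//; lra.
have cz0 := cm_ge0 z.
have e1 : cm z ^+ j <= j.+1%:R ^+ j * expR (c + 1 + Im z).
  have -> : c + 1 + Im z = j.+1%:R * ((c + 1 + Im z) / j.+1%:R).
    by rewrite mulrCA divff ?mulr1// pnatr_eq0.
  set u := _ / _.
  have u0 : 0 <= u by rewrite divr_ge0//; lra.
  have cu : cm z <= j.+1%:R * u.
    by rewrite /u mulrCA divff ?mulr1 ?pnatr_eq0//; lra.
  have ju0 : 0 <= j.+1%:R * u by exact: le_trans cu.
  apply: (@le_trans _ _ ((j.+1%:R * u) ^+ j)); first by apply: lerXn2r; rewrite ?nnegrE.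
  rewrite exprMn ler_wpM2l ?exprn_ge0// expRM_natl.
  apply: (@le_trans _ _ (expR u ^+ j)); first by rewrite lerXn2r ?nnegrE ?expR_ge0 ?expR_ge_id.
  by rewrite exprS ler_peMl ?exprn_ge0 ?expR_ge0// expR_ge_1.
rewrite cmM cmX; apply: le_trans (ler_pM _ (cm_ge0 _) e1 (HK z h2)) _.
  by rewrite exprn_ge0.
have -> : expR (c + 1 + Im z) = expR (c + 1) * expR (Im z) by rewrite expRD.
have -> : expR (- 2 * Im z) = expR (- Im z) * expR (- Im z) by rewrite -expRD; congr expR; ring.
have e : expR (Im z) * expR (- Im z) = 1 by exact: expRxMexpNx_1.
have -> : j.+1%:R ^+ j * (expR (c + 1) * expR (Im z)) * (K * (expR (- Im z) * expR (- Im z))) =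
  K * (expR (c + 1) * j.+1%:R ^+ j) * expR (- Im z) * (expR (Im z) * expR (- Im z)) by ring.
by rewrite e mulr1.
Qed.

Lemma dec_cvg0 F x : dec F -> forall e : R, 0 < e -> exists2 T : R, 1 <= T &
  forall t, T <= t -> cm (F (x +i* t)%C) < e.
Proof.
move=> hF e e0; have [K HK] := hF `|x|.
exists (1 + `|K| / e); first by rewrite lerDl divr_ge0// ltW.
move=> t ht; have Ke : 0 <= `|K| / e by rewrite divr_ge0// ltW.
have t1 : 1 <= t by lra.
have h : cm (F (x +i* t)%C) <= K * expR (- t) by exact: HK.
apply: le_lt_trans h _; apply: le_lt_trans (ler_norm _) _.
rewrite normrM [`|expR _|]ger0_norm ?expR_ge0// expRN ltr_pdivrMr ?expR_gt0//.
rewrite mulrC -ltr_pdivrMr//; apply: lt_le_trans (_ : t <= _); last exact: expR_ge_id.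
by lra.
Qed.

Lemma H_const F (z w : C) : (forall z, 0 < Im z -> CD F z 0) -> 0 < Im z -> 0 < Im w -> F z = F w.
Proof.
move=> H z0 w0; apply: CD_zero_const => t /andP[t0 t1]; apply: H.
rewrite ImD Im_realM ImB.
have -> : Im w + t * (Im z - Im w) = (1 - t) * Im w + t * Im z by ring.
by have [->|t2] := eqVneq t 0; [rewrite subr0 mul1r mul0r addr0|rewrite ltr_wpDl ?mulr_ge0 ?mulr_gt0 ?(ltW w0) ?subr_ge0// lt_def t2].
Qed.

(** The principle by which Eichler integrals are identified: equal derivatives and decay at i oo
    leave no constant. *)
Lemma H_zero F (z : C) : (forall z, 0 < Im z -> CD F z 0) -> dec F -> 0 < Im z -> F z = 0.
Proof.
move=> H hF z0; apply/eqP; rewrite -cm_eq0 eq_le cm_ge0 andbT leNgt; apply/negP => e0.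
have [T T1 HT] := dec_cvg0 0 hF e0.
have := HT T (lexx _); rewrite -(H_const H z0) ?ltxx//=.
by apply: lt_le_trans T1.
Qed.

Lemma CD_pow j (z : C) : CD (fun z => z ^+ j) z (j%:R * z ^+ j.-1).
Proof.
case: j => [|j]; first by apply: CD_eq (CD_cst 1 z) => [w|]; rewrite ?expr0 ?mul0r.
by apply: CD_eq (CD_exp j (CD_id z)) => //=; rewrite mulr1.
Qed.

(** Integration by parts lowers the power of z; decay selects the primitive that represents the
    integral from i oo. *)
Lemma primitive j a : subexp a -> exists2 G, dec G &
  forall z, 0 < Im z -> CD G z (z ^+ j * qsf a z).
Proof.
elim: j a => [|j IH] a sa; have sF := subexp_qcV sa.
  exists (fun z => z ^+ 0 * qsf (fun n => a n / qc n) z); first exact: dec_pow_qsf.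
  move=> z z0; apply: CD_eq (CD_qsf sF z0) => [w|]; rewrite expr0 mul1r//.
  by congr qsf; apply/funext => n; rewrite divfK// qc_neq0.
have [G dG hG] := IH _ sF.
exists (fun z => z ^+ j.+1 * qsf (fun n => a n / qc n) z + (- j.+1%:R) * G z).
  by apply: dec_add; [exact: dec_pow_qsf|exact: dec_scale].
move=> z z0; apply: CD_eq (CD_add (CD_mul (CD_pow j.+1 z) (CD_qsf sF z0)) (CD_scale (- j.+1%:R) (hG z z0))) => //.
have -> : (fun n => a n / qc n * qc n) = a by apply/funext => n; rewrite divfK// qc_neq0.
by rewrite /=; ring.
Qed.
End QSeries.

(** * Eichler integrals and the period polynomial *)

Section Periods.
Variable R : realType.
Local Notation C := R[i].
Local Notation "x %:C" := (real_complex _ x) : ring_scope.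

Definition tpi : C := - (2 * pi%:C * 'i%C).

(* Phi j z is 2 pi i times the integral of w^j Delta(w) dw from z to i oo. *)
Definition Phi (j : nat) : C -> C :=
  fun z => tpi * s2val (cid2 (primitive j (@subexp_dcoef R))) z.

Lemma dec_Phi j : dec (Phi j).
Proof. apply: dec_scale; exact: s2valP (cid2 _). Qed.

Lemma CD_Phi j z : 0 < Im z -> CD (Phi j) z (tpi * (z ^+ j * Dl z)).
Proof.
move=> z0; apply: CD_scale; rewrite -qsf_Dl//.
exact: (s2valP' (cid2 (primitive j (@subexp_dcoef R)))).
Qed.

Lemma eD_int (k : int) (z : C) : eD (z + k%:~R) = eD z.
Proof.
rewrite eD_add; suff -> : eD (k%:~R : C) = 1 by rewrite mulr1.
have nat_case (n : nat) : eD (n%:R : C) = 1.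
  rewrite /eD; have -> : 2 * pi%:C * 'i%C * n%:R = (n%:R * (2 * pi))%:C * 'i%C :> C.
    by rewrite !rcM !real_complex_nat; move: (pi%:C) => p; ring.
  exact: ph2pi.
case: k => n; first exact: nat_case.
have -> : (Negz n)%:~R = - n.+1%:R :> C by rewrite NegzE mulrNz.
by rewrite /eD mulrN cexpN -/(eD _) nat_case invr1.
Qed.

Lemma Dl_int (k : int) (z : C) : Dl (z + k%:~R) = Dl z.
Proof. by rewrite /Dl eD_int. Qed.

Lemma int_real (k : int) : (k%:~R : C) = (k%:~R : R)%:C.
Proof. by rewrite rmorph_int. Qed.

Lemma Im_int (k : int) (z : C) : Im (z + k%:~R) = Im z.
Proof. by rewrite int_real ImD /= addr0. Qed.

Lemma CD_shift (k : C) (z : C) : CD (fun w => w + k) z 1.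
Proof. by apply: CD_eq (CD_add (CD_id z) (CD_cst k z)) => //; rewrite addr0. Qed.

Lemma CD_ninv (z : C) : z != 0 -> CD (fun w => - w^-1) z (z ^- 2).
Proof. by move=> z0; apply: CD_eq (CD_opp (CD_inv z0)) => //; rewrite opprK. Qed.

Lemma H_neq0 (z : C) : 0 < Im z -> z != 0.
Proof. by move=> z0; apply: contraTneq z0 => ->; rewrite ltxx. Qed.

(** Both sides decay at i oo, and their derivatives agree by the binomial expansion of (w + k)^j and
    the periodicity of Delta. *)
Lemma Phi_T j (k : int) z : 0 < Im z ->
  Phi j (z + k%:~R) = \sum_(i < j.+1) ('C(j, i)%:R * k%:~R ^+ (j - i)) * Phi i z.
Proof.
move=> z0; apply/eqP; rewrite -subr_eq0; apply/eqP.
set F := fun z => Phi j (z + k%:~R) - \sum_(i < j.+1) ('C(j, i)%:R * k%:~R ^+ (j - i)) * Phi i z.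
suff [h1 h2] : (forall w, 0 < Im w -> CD F w 0) /\ dec F by exact: (H_zero h1 h2 z0).
split.
  move=> w w0; have wk : 0 < Im (w + k%:~R) by rewrite Im_int.
  have h1 := CD_comp (CD_shift k%:~R w) (CD_Phi j wk).
  have h2 : CD (fun z => \sum_(i < j.+1) ('C(j, i)%:R * k%:~R ^+ (j - i)) * Phi i z) w
     (\sum_(i < j.+1) ('C(j, i)%:R * k%:~R ^+ (j - i)) * (tpi * (w ^+ i * Dl w))).
    by apply: CD_sum => i; apply: CD_scale; exact: CD_Phi.
  apply: CD_eq (CD_sub h1 h2) => //.
  rewrite mulr1 Dl_int [w + _]addrC exprDn mulr_suml mulr_sumr -sumrB big1// => i _.
  by rewrite -mulr_natl; move: (_ ^+ (j - i)) (_ ^+ i) => u v; ring.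
apply: dec_add.
  by have := dec_translate k%:~R (dec_Phi j); rewrite -int_real.
have hd : dec (fun z => (-1) * \sum_(i < j.+1) ('C(j, i)%:R * k%:~R ^+ (j - i)) * Phi i z).
  by apply: dec_scale; apply: dec_sum => i; apply: dec_scale; exact: dec_Phi.
move=> c; have [K HK] := hd c; exists K => w h1 h2; rewrite -mulN1r; exact: HK.
Qed.

(** The weight 12 law and dw / w^2 leave w^10, which exchanges j and 10 - j. No decay is available,
    so the constant is read at the fixed point i. *)
Lemma Phi_S j z : (j <= 10)%N -> 0 < Im z ->
  Phi j (- z^-1) = (-1) ^+ j * Phi (10 - j) z + (Phi j 'i%C - (-1) ^+ j * Phi (10 - j) 'i%C).
Proof.
move=> j10 z0.
pose F z := Phi j (- z^-1) - (-1) ^+ j * Phi (10 - j) z.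
have i0 : 0 < Im ('i%C : C) by rewrite /= ltr01.
have ii : - ('i%C : C)^-1 = 'i%C.
  have i2 : ('i%C : C) ^+ 2 = -1 by exact: sqr_i.
  have := H_neq0 i0; move: ('i%C : C) i2 => i i2 hi.
  by apply: (mulfI hi); rewrite mulrN divff// -expr2 i2.
suff e : F z = F 'i%C.
  by rewrite /F ii in e; rewrite -e addrC subrK.
suff h w : 0 < Im w -> CD F w 0 by exact: (H_const h z0 i0).
move=> w0; have w1 := H_neq0 w0; have w2 := Im_invN w0.
have h1 := CD_comp (CD_ninv w1) (CD_Phi j w2).
have h2 := CD_scale ((-1) ^+ j) (CD_Phi (10 - j) w0).
apply: CD_eq (CD_sub h1 h2) => //.
rewrite Delta_inversion//; have -> : (- w^-1) ^+ j = (-1) ^+ j * w ^- j by rewrite [LHS]exprNn exprVn.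
have -> : w ^+ 12 = w ^+ j * w ^+ (10 - j) * w ^+ 2 by rewrite -!exprD; congr (_ ^+ _); lia.
have := expf_neq0 j w1; have := expf_neq0 2 w1.
move: (w ^+ j) (w ^+ 2) (w ^+ (10 - j)) ((-1) ^+ j) (Dl w) tpi => a b d s D t b0 a0.
by field; rewrite a0 b0.
Qed.

Definition phi (j : nat) (z : C) : R := 'C(10, j)%:R * Re (Phi j z).
(** The constant of z -> -1/z, computed at the fixed point i. Letting z tend to i oo in [phi_S]
    shows that it is the coefficient of x^j y^(10-j) in R; thus [per 0] is A and [per 2] is - B. *)
Definition per (j : nat) : R := phi j 'i%C - (-1) ^+ j * phi (10 - j) 'i%C.

Lemma phi_S j z : (j <= 10)%N -> 0 < Im z ->
  phi j (- z^-1) = (-1) ^+ j * phi (10 - j) z + per j.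
Proof.
move=> j10 z0; rewrite /per /phi bin_sub// Phi_S// ReD ReB.
have e w : Re ((-1) ^+ j * w) = (-1) ^+ j * Re w :> R.
  by rewrite -[in LHS]signr_odd -[in RHS]signr_odd; case: (odd j); rewrite ?expr0 ?expr1 ?mul1r ?mulN1r ?ReN.
by rewrite !e; ring.
Qed.

(** With the factor C(10, j) included in [phi], translation has integer coefficients, by C(10,j)
    C(j,i) = C(10,i) C(10-i,j-i). The integrality of all values of the symbol rests on this. *)
Lemma phi_T j (k : int) z : (j <= 10)%N -> 0 < Im z ->
  phi j (z + k%:~R) = \sum_(i < 11) (('C(10 - i, j - i) * (i <= j))%:R * k%:~R ^+ (j - i)) * phi i z.
Proof.
move=> j10 z0; rewrite /phi Phi_T// Re_sum mulr_sumr.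
rewrite (big_ord_widen 11 (fun i => 'C(10, j)%:R * Re ('C(j, i)%:R * k%:~R ^+ (j - i) * Phi i z))); last by [].
rewrite big_mkcond/=; apply: eq_bigr => i _; rewrite ltnS.
case: leqP => ij; last by rewrite muln0 !mul0r.
rewrite int_real -real_complex_nat -rcX -rcM Re_realM muln1.
have e : ('C(10, j) * 'C(j, i) = 'C(10, i) * 'C(10 - i, j - i))%N.
  have /allP h : all (fun j => all (fun i => (i <= j)%N ==>
     ('C(10, j) * 'C(j, i) == 'C(10, i) * 'C(10 - i, j - i))%N) (iota 0 11)) (iota 0 11) by vm_compute.
  have jm : j \in iota 0 11 by rewrite mem_iota.
  have im : (i : nat) \in iota 0 11 by rewrite mem_iota ltn_ord.
  have /allP h2 := h j jm; have := h2 i im.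
  by rewrite ij => /eqP.
rewrite !mulrA -!natrM e; ring.
Qed.

(* The plus part of 2 pi i int_z^{i oo} Delta(w)(wx+y)^10 dw. *)
Definition eichler (z : C) (x y : R) : R := \sum_(j < 11) x ^+ j * y ^+ (10 - j) * phi j z.
Definition perpol (x y : R) : R := \sum_(j < 11) x ^+ j * y ^+ (10 - j) * per j.

Lemma eichler_Re z (x y : R) :
  eichler z x y = Re (\sum_(j < 11) ('C(10, j)%:R * (x ^+ j * y ^+ (10 - j)))%:C * Phi j z).
Proof.
by rewrite Re_sum; apply: eq_bigr => j _; rewrite Re_realM /phi; ring.
Qed.

Lemma eichler_T (k : int) z (x y : R) : 0 < Im z -> eichler (z + k%:~R) x y = eichler z x (y + k%:~R * x).
Proof.
move=> z0; rewrite !eichler_Re; congr Re; apply/eqP; rewrite -subr_eq0; apply/eqP.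
pose G (y : R) z := \sum_(j < 11) ('C(10, j)%:R * (x ^+ j * y ^+ (10 - j)))%:C * Phi j z.
have dG y' w : 0 < Im w -> CD (G y') w (tpi * ((w * x%:C + y'%:C) ^+ 10 * Dl w)).
  move=> w0; have h : CD (G y') w (\sum_(j < 11) ('C(10, j)%:R * (x ^+ j * y' ^+ (10 - j)))%:C * (tpi * (w ^+ j * Dl w))).
    by apply: CD_sum => i; apply: CD_scale; exact: CD_Phi.
  apply: CD_eq h => //; rewrite addrC exprDn mulr_suml mulr_sumr; apply: eq_bigr => i _.
  rewrite !rcM !rcX real_complex_nat exprMn -mulr_natl.
  by move: (_ ^+ (10 - i)) (x%:C ^+ i) (w ^+ i) => a b d; ring.
have decG y' : dec (G y') by apply: dec_sum => i; apply: dec_scale; exact: dec_Phi.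
set F := fun z => G y (z + k%:~R) - G (y + k%:~R * x) z.
suff [h1 h2] : (forall w, 0 < Im w -> CD F w 0) /\ dec F by exact: (H_zero h1 h2 z0).
split.
  move=> w w0; have wk : 0 < Im (w + k%:~R) by rewrite Im_int.
  apply: CD_eq (CD_sub (CD_comp (CD_shift k%:~R w) (dG y _ wk)) (dG (y + k%:~R * x) w w0)) => //.
  rewrite Dl_int rcD rcM -int_real; move: (x%:C) (y%:C) => X Y.
  have -> : (w + k%:~R) * X + Y = w * X + (Y + k%:~R * X) by ring.
  by rewrite mulr1 subrr.
apply: dec_add; first by have := dec_translate k%:~R (decG y); rewrite -int_real.
move=> c; have [K HK] := dec_scale (-1) (decG (y + k%:~R * x)) c.
by exists K => w h1 h2; rewrite -mulN1r; exact: HK.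
Qed.

Lemma eichler_S z (x y : R) : 0 < Im z -> eichler (- z^-1) x y = eichler z y (- x) + perpol x y.
Proof.
move=> z0; rewrite /eichler /perpol (eq_bigr (fun j : 'I_11 => x ^+ j * y ^+ (10 - j) * ((-1) ^+ j * phi (10 - j) z)
   + x ^+ j * y ^+ (10 - j) * per j)).
  rewrite big_split/=; congr (_ + _); rewrite (reindex_inj rev_ord_inj)/=.
  apply: eq_bigr => i _; have i10 : (i <= 10)%N by rewrite -ltnS.
  rewrite subSS subKn// [(- x) ^+ _]exprNn.
  have -> : (-1) ^+ (10 - i) = (-1) ^+ i :> R.
    by rewrite -signr_odd oddB// signr_odd.
  by ring.
by move=> j _; rewrite phi_S// ?mulrDr// -ltnS.
Qed.

Lemma eichler_even z (x y : R) : eichler z (- x) (- y) = eichler z x y.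
Proof.
apply: eq_bigr => j _; rewrite [(- x) ^+ _]exprNn [(- y) ^+ _]exprNn.
have j10 : (j <= 10)%N by rewrite -ltnS.
have : (-1) ^+ j * (-1) ^+ (10 - j) = 1 :> R.
  by rewrite -exprD subnKC// -signr_odd.
by move=> e; rewrite [X in X * phi _ _]mulrACA e mul1r.
Qed.

Lemma Eul_real (q : C) : cm q < 1 -> Im q = 0 -> Im (Eul q) = 0.
Proof.
move=> q1 iq; apply: ccvg_Im0 (Eu_cvg q1) => n.
have -> : q = (Re q)%:C by apply: complex_ext.
by rewrite /Eu; under eq_bigr do rewrite -rcX -rc1 -rcB; rewrite -rmorph_prod.
Qed.

Lemma eD_it (t : R) : eD (t%:C * 'i%C) = (expR (- (2 * pi * t)))%:C.
Proof.
rewrite /eD -cexp_real; congr cexp; rewrite rcN !rcM real_complex_nat.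
have i2 : ('i%C : C) ^+ 2 = -1 by exact: sqr_i.
move: ('i%C : C) i2 (pi%:C) (t%:C) => i i2 p u.
have -> : 2 * p * i * (u * i) = 2 * p * u * i ^+ 2 by ring.
by rewrite i2 mulrN1.
Qed.

Lemma Im_it (t : R) : Im (t%:C * 'i%C) = t.
Proof. by rewrite ImMc /= mulr1 mul0r addr0. Qed.

Lemma Dl_it_real (t : R) : 0 < t -> Dl (t%:C * 'i%C) = (Re (Dl (t%:C * 'i%C)))%:C.
Proof.
move=> t0; apply: complex_ext => //=; rewrite /Dl.
have q1 : cm (eD (t%:C * 'i%C)) < 1 by apply: cm_eD_lt1; rewrite Im_it.
have h : Im (eD (t%:C * 'i%C)) = 0 by rewrite eD_it.
have hE := Eul_real q1 h.
have -> : Eul (eD (t%:C * 'i%C)) = (Re (Eul (eD (t%:C * 'i%C))))%:C by exact: complex_ext.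
by rewrite eD_it -rcX -rcM.
Qed.

Lemma vertical_zero (h : R -> R) : (forall t : R, 0 < t -> is_derive t 1 h 0) ->
  (forall e : R, 0 < e -> exists T : R, forall t, T <= t -> `|h t| < e) ->
  forall t : R, 0 < t -> h t = 0.
Proof.
move=> dh lim t t0; apply/eqP; rewrite -normr_eq0 eq_le normr_ge0 andbT leNgt; apply/negP => e0.
have [T HT] := lim _ e0; set u := Num.max t T.
have tu : t <= u by rewrite le_max lexx.
have := @mvt_bound _ h (fun=> 0) t u 0 tu.
have dd : forall x, t <= x <= u -> is_derive x 1 h 0.
  by move=> x /andP[h1 _]; apply: dh; exact: lt_le_trans h1.
move=> /(_ dd); rewrite mul0r => H.
have {}H : `|h u - h t| <= 0 by apply: H => x _; rewrite normr0.
have := HT u; rewrite le_max lexx orbT => /(_ isT).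
move: H; rewrite normr_le0 subr_eq0 => /eqP ->; by rewrite ltxx.
Qed.

(** Delta is real on the imaginary axis, and there 2 pi i w^j dw = 2 pi i^(j+2) t^j dt is purely
    imaginary for odd j. So the real part is constant, and it vanishes at infinity. *)
Lemma phi_odd (j : nat) (t : R) : odd j -> 0 < t -> phi j (t%:C * 'i%C) = 0.
Proof.
move=> oj; rewrite /phi => t0.
suff -> : Re (Phi j (t%:C * 'i%C)) = 0 by rewrite mulr0.
apply: (vertical_zero (h := fun t => Re (Phi j (t%:C * 'i%C)))) => // [u u0|e e0].
  have u0' : 0 < Im (0 + u%:C * 'i%C : C) by rewrite add0r Im_it.
  have := CD_Re_derive (CD_Phi j u0').
  have -> : (fun t : R => Re (Phi j (0 + t%:C * 'i%C))) = (fun t : R => Re (Phi j (t%:C * 'i%C))).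
    by apply/funext => x; rewrite add0r.
  rewrite add0r (Dl_it_real u0); set D := Re (Dl _).
  suff -> : tpi * ((u%:C * 'i%C) ^+ j * D%:C) * 'i%C = (2 * pi * u ^+ j * D)%:C * 'i%C ^+ j.
    have -> : Re ((2 * pi * u ^+ j * D)%:C * 'i%C ^+ j) = 0; last by [].
    have -> : 'i%C ^+ j = ((-1) ^+ j./2)%:C * 'i%C :> C.
      rewrite -[in LHS](odd_double_half j) oj add1n exprS -mul2n exprM mulrC.
      by rewrite (sqr_i R) rcX rcN rc1.
    by rewrite Re_realM Re_realM /= !mulr0.
  have i2 : ('i%C : C) ^+ 2 = -1 by exact: sqr_i.
  rewrite /tpi !rcM rcX real_complex_nat exprMn.
  move: ('i%C : C) i2 (pi%:C) (u%:C ^+ j) (D%:C) => i i2 p v d.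
  have -> : - (2 * p * i) * (v * i ^+ j * d) * i = - (2 * p * v * d * i ^+ j) * i ^+ 2 by ring.
  by rewrite i2; ring.
have [T T1 HT] := dec_cvg0 0 (dec_Phi j) e0; exists T => u uT.
apply: le_lt_trans (cm_Re _) _.
have -> : u%:C * 'i%C = (0 +i* u)%C :> C by apply: complex_ext; rewrite ?ReMc ?ImMc /=; ring.
exact: HT.
Qed.

Lemma i_1i : ('i%C : C) = 1%:C * 'i%C. Proof. by rewrite rc1 mul1r. Qed.

Lemma per_odd j : odd j -> (j <= 10)%N -> per j = 0.
Proof.
move=> oj j10; rewrite /per i_1i phi_odd// phi_odd ?mulr0 ?subr0//.
by rewrite oddB// oj.
Qed.

Lemma per_sym j : ~~ odd j -> (j <= 10)%N -> per (10 - j) = - per j.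
Proof.
move=> oj j10; rewrite /per subKn// -[(-1) ^+ j]signr_odd -[(-1) ^+ (10 - j)]signr_odd oddB//.
by rewrite (negbTE oj)/= expr0 !mul1r opprB.
Qed.

Lemma perpol_short x y : perpol x y = per 0 * (y ^+ 10 - x ^+ 10) +
  per 2 * (x ^+ 2 * y ^+ 8 - x ^+ 8 * y ^+ 2) + per 4 * (x ^+ 4 * y ^+ 6 - x ^+ 6 * y ^+ 4).
Proof.
have e10 : per 10 = - per 0 by rewrite -(per_sym (j := 0)).
have e8 : per 8 = - per 2 by rewrite -(per_sym (j := 2)).
have e6 : per 6 = - per 4 by rewrite -(per_sym (j := 4)).
rewrite /perpol !big_ord_recr big_ord0/= e10 e8 e6.
rewrite (per_odd (j := 1))// (per_odd (j := 3))// (per_odd (j := 5))// (per_odd (j := 7))// (per_odd (j := 9))//.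
by rewrite !subn0 !subSS; ring.
Qed.

Lemma per42 : per 4 = - 3 * per 2.
Proof.
have s0 : 0 <= (3 : R) by [].
(* The fixed point of z |-> 1 - 1/z, where the relation below is the three-term relation. *)
pose rho : C := (2^-1 +i* (Num.sqrt 3 / 2))%C.
have r0 : 0 < Im rho by rewrite /= divr_gt0// sqrtr_gt0.
have rr : - rho^-1 = rho + (-1)%:~R.
  have h := H_neq0 r0; apply: (mulfI h); rewrite mulrN divff//.
  have s2 : Num.sqrt 3 ^+ 2 = 3 :> R by rewrite sqr_sqrtr.
  rewrite int_real rmorphN rmorph1 /rho; move: (Num.sqrt 3) s2 => s s2.
  apply: complex_ext; rewrite ?ReMc ?ImMc ?ReD ?ImD ?ReN ?ImN /=; first by nra.
  by field.
have rel x y : perpol x y = eichler rho x (y - x) - eichler rho y (- x).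
  have := eichler_T (-1) x y r0; rewrite -rr eichler_S// rmorphN rmorph1 mulN1r => <-.
  by rewrite addrC addKr.
(* Three successive points under (x, y) -> (y, y - x): the values of [eichler rho] telescope, and
   the terms y^10 - x^10 cancel as well. *)
have e1 := rel 1 3; have e2 := rel 3 2; have e3 := rel 2 (-1).
have three : perpol 1 3 + perpol 3 2 + perpol 2 (-1) = 0.
  rewrite e1 e2 e3.
  have -> : (3 : R) - 1 = 2 by ring.
  have -> : (2 : R) - 3 = -1 by ring.
  have -> : (-1 : R) - 2 = -3 by ring.
  have -> : eichler rho (-1) (-2) = eichler rho 1 2 by exact: eichler_even.
  ring.
by move: three; rewrite !perpol_short; lra.
Qed.
End Periods.

(** * The Hecke operator T_2 and the relation between the two periods *)

Section Hecke.
Variable R : realType.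
Local Notation C := R[i].
Local Notation "x %:C" := (real_complex _ x) : ring_scope.

Definition vanish (f : R -> R) :=
  forall e : R, 0 < e -> exists T : R, forall t, T <= t -> `|f t| < e.

Lemma vanish_add f g : vanish f -> vanish g -> vanish (fun t => f t + g t).
Proof.
move=> hf hg e e0; have e2 : 0 < e / 2 by rewrite divr_gt0.
have [T HT] := hf _ e2; have [U HU] := hg _ e2; exists (Num.max T U) => t.
rewrite ge_max => /andP[/HT h1 /HU h2]; have := ler_normD (f t) (g t); lra.
Qed.

Lemma vanish_scale (c : R) f : vanish f -> vanish (fun t => c * f t).
Proof.
move=> hf e e0; have c0 : 0 < `|c| + 1 by rewrite ltr_wpDl.
have [T HT] := hf _ (divr_gt0 e0 c0); exists T => t /HT.
rewrite ltr_pdivlMr// normrM; have := normr_ge0 (f t); have := normr_ge0 c; nra.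
Qed.

Lemma vanish_dilate (c : R) f : 0 < c -> vanish f -> vanish (fun t => f (c * t)).
Proof.
move=> c0 hf e e0; have [T HT] := hf e e0; exists (T / c) => t; rewrite ler_pdivrMr// mulrC.
exact: HT.
Qed.

Lemma vanish_cst (c : R) : vanish (fun=> c) -> c = 0.
Proof.
move=> h; apply/eqP; rewrite -normr_eq0 eq_le normr_ge0 andbT leNgt; apply/negP => e0.
by have [T /(_ T (lexx _))] := h _ e0; rewrite ltxx.
Qed.

Lemma vanish_dec (F : C -> C) (x : R) : dec F -> vanish (fun t => Re (F (x +i* t)%C)).
Proof.
move=> hF e e0; have [T _ HT] := dec_cvg0 x hF e0; exists T => t /HT.
by apply: le_lt_trans; exact: cm_Re.
Qed.

Lemma vanish_phi j (x : R) : vanish (fun t => phi j (x +i* t)%C).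
Proof. by apply: vanish_scale; apply: vanish_dec; exact: dec_Phi. Qed.

Lemma vanish_eichler (a b x : R) : vanish (fun t => eichler (x +i* t)%C a b).
Proof.
have h : dec (fun z : C => \sum_(j < 11) ('C(10, j)%:R * (a ^+ j * b ^+ (10 - j)))%:C * Phi j z).
  by apply: dec_sum => j; apply: dec_scale; exact: dec_Phi.
move=> e e0; have [T HT] := vanish_dec x h e0; exists T => t /HT.
by rewrite eichler_Re.
Qed.

Lemma phi0_derive (t x c : R) : 0 < c -> 0 < t ->
  is_derive t 1 (fun t => phi 0 (x +i* (c * t))%C) (2 * pi * c * Re (Dl (x +i* (c * t))%C)).
Proof.
move=> c0 t0.
have e (u : R) : (x +i* (c * u))%C = x%:C + u%:C * (c%:C * 'i%C) :> C.
  by apply: complex_ext; rewrite ?ReD ?ImD ?ReMc ?ImMc /=; ring.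
have z0 : 0 < Im (x%:C + t%:C * (c%:C * 'i%C)) by rewrite -e /= mulr_gt0.
have := CD_Re_derive (CD_Phi 0 z0); rewrite expr0 mul1r.
have -> : (fun t : R => Re (Phi 0 (x%:C + t%:C * (c%:C * 'i%C)))) = (fun t : R => phi 0 (x +i* (c * t))%C).
  by apply/funext => u; rewrite /phi bin0 mul1r e.
have -> : tpi R * Dl (x%:C + t%:C * (c%:C * 'i%C)) * (c%:C * 'i%C) =
   (2 * pi * c)%:C * Dl (x%:C + t%:C * (c%:C * 'i%C)).
  rewrite /tpi !rcM real_complex_nat; move: (Dl _) => D.
  have i2 : ('i%C : C) ^+ 2 = -1 by exact: sqr_i.
  move: ('i%C : C) i2 (pi%:C) (c%:C) => i i2 p v.
  have -> : - (2 * p * i) * D * (v * i) = - (2 * p * v * D) * i ^+ 2 by ring.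
  by rewrite i2; ring.
by rewrite Re_realM -e.
Qed.

Lemma eD_axis (t : R) : eD (0 +i* t)%C = (expR (- (2 * pi * t)))%:C.
Proof.
by rewrite -eD_it; congr eD; apply: complex_ext; rewrite ?ReMc ?ImMc /=; ring.
Qed.

Lemma eD_half (t : R) : eD (2^-1 +i* t)%C = - (expR (- (2 * pi * t)))%:C.
Proof.
have -> : (2^-1 +i* t)%C = (2^-1)%:C + (0 +i* t)%C :> C by apply: complex_ext; rewrite /= ?addr0 ?add0r.
rewrite eD_add eD_axis; suff -> : eD ((2^-1)%:C : C) = -1 by rewrite mulN1r.
rewrite /eD.
have -> : 2 * pi%:C * 'i%C * (2^-1)%:C = (0 +i* pi)%C :> C.
  rewrite -real_complex_nat; apply: complex_ext; rewrite !(ReMc, ImMc)/=; first by ring.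
  by field.
by rewrite cexpE /= expR0 cospi sinpi rc1 mul1r; apply: complex_ext; rewrite /= ?oppr0.
Qed.

Lemma re_lin (a b c d : C) : 2048 * a + 2^-1 * (b - c) = - 24 * d ->
  2048 * Re a + 2^-1 * (Re b - Re c) = - 24 * Re d.
Proof.
move=> /(congr1 (fun z : C => Re z)).
have -> : (2048 : C) = 2048%:C by rewrite real_complex_nat.
have -> : (2^-1 : C) = (2^-1)%:C by rewrite rcV real_complex_nat.
have -> : (-24 : C) = (-24)%:C by rewrite rcN real_complex_nat.
by rewrite ReD !Re_realM ReB.
Qed.

(** Dilation by c multiplies derivatives by c, which turns the weights 2^11, 1/2, 1/2 of T_2 into
    1024, 1, 1. The combination is constant by [hecke2_nome] and vanishes at infinity. *)
Lemma hecke2_phi (t : R) : 0 < t ->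
  1024 * phi 0 (0 +i* (2 * t))%C + phi 0 (0 +i* (2^-1 * t))%C +
  phi 0 (2^-1 +i* (2^-1 * t))%C + 24 * phi 0 (0 +i* (1 * t))%C = 0.
Proof.
apply: (vertical_zero (h := fun t => 1024 * phi 0 (0 +i* (2 * t))%C + phi 0 (0 +i* (2^-1 * t))%C +
  phi 0 (2^-1 +i* (2^-1 * t))%C + 24 * phi 0 (0 +i* (1 * t))%C)) => [{t}t t0|].
  have h2 : 0 < (2 : R) by []. have hh : 0 < (2^-1 : R) by rewrite invr_gt0.
  have h1 : 0 < (1 : R) by [].
  have d1 := phi0_derive 0 h2 t0. have d2 := phi0_derive 0 hh t0.
  have d3 := phi0_derive 2^-1 hh t0. have d4 := phi0_derive 0 h1 t0.
  set p := expR (- (pi * t)).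
  have p01 : 0 < p < 1.
    by rewrite expR_gt0 /= -expR0 ltr_expR oppr_lt0 mulr_gt0// pi_gt0.
  have e4 : expR (- (2 * pi * (2 * t))) = p ^+ 4 by rewrite -expRM_natl; congr expR; ring.
  have e1 : expR (- (2 * pi * (2^-1 * t))) = p by congr expR; field.
  have e2 : expR (- (2 * pi * (1 * t))) = p ^+ 2 by rewrite -expRM_natl; congr expR; ring.
  have h5 a4 a1 a3 a2 : a4 = p%:C ^+ 4 * Eul (p%:C ^+ 4) ^+ 24 -> a1 = p%:C * Eul p%:C ^+ 24 ->
      a3 = p%:C * Eul (- p%:C) ^+ 24 -> a2 = p%:C ^+ 2 * Eul (p%:C ^+ 2) ^+ 24 ->
      2048 * a4 + 2^-1 * (a1 - a3) = - 24 * a2.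
    by move=> -> -> -> ->; exact: hecke2_nome.
  clearbody p.
  have [[f4 f1] [f3 f2]] :
     (Dl (0 +i* (2 * t))%C = p%:C ^+ 4 * Eul (p%:C ^+ 4) ^+ 24 /\
      Dl (0 +i* (2^-1 * t))%C = p%:C * Eul p%:C ^+ 24) /\
     (- Dl (2^-1 +i* (2^-1 * t))%C = p%:C * Eul (- p%:C) ^+ 24 /\
      Dl (0 +i* (1 * t))%C = p%:C ^+ 2 * Eul (p%:C ^+ 2) ^+ 24).
    clear h5; split; split; rewrite /Dl ?eD_half ?eD_axis ?e4 ?e2 ?e1 ?rcX ?mulNr ?opprK; reflexivity.
  have := h5 _ _ _ _ f4 f1 f3 f2 => {f1 f2 f3 f4 h5}.
  move: d1 d2 d3 d4; move: (Dl _) (Dl _) (Dl _) (Dl _) => a b d e d1 d2 d3 d4 /re_lin r.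
  apply: is_derive_eq.
  move: r; rewrite ReN; move: (Re a) (Re b) (Re d) (Re e) => A B D E r.
  have {}r : 2048 * E + 2^-1 * (D + B) + 24 * A = 0 by lra.
  have h0 := congr1 (fun x => 2 * pi * x) r; rewrite mulr0 in h0; rewrite -[RHS]h0 /GRing.scale/=.
  by field.
apply: vanish_add; first (apply: vanish_add; first apply: vanish_add).
- by apply: vanish_scale; apply: (vanish_dilate (f := fun t => phi 0 (0 +i* t)%C)) => //; exact: vanish_phi.
- by apply: (vanish_dilate (f := fun t => phi 0 (0 +i* t)%C)); rewrite ?invr_gt0//; exact: vanish_phi.
- by apply: (vanish_dilate (f := fun t => phi 0 (2^-1 +i* t)%C)); rewrite ?invr_gt0//; exact: vanish_phi.
- by apply: vanish_scale; apply: (vanish_dilate (f := fun t => phi 0 (0 +i* t)%C)) => //; exact: vanish_phi.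
Qed.

Lemma phi0_eichler (z : C) : phi 0 z = eichler z 0 1.
Proof.
rewrite /eichler big_ord_recl expr0 expr1n !mul1r big1 ?addr0// => i _.
by rewrite /= /bump/= expr0n/= !mul0r.
Qed.

Lemma invN_axis (u : R) : 0 < u -> - (0 +i* u)%C^-1 = (0 +i* u^-1)%C :> C.
Proof.
move=> u0; have h : (0 +i* u)%C != 0 :> C by apply: H_neq0.
apply: (mulfI h); rewrite mulrN divff//; apply: complex_ext; rewrite !(ReMc, ImMc, ReN, ImN)/=.
  by rewrite mulfV ?gt_eqF//; ring.
by ring.
Qed.

Lemma phi0_axis (u : R) : 0 < u -> phi 0 (0 +i* u^-1)%C = phi 10 (0 +i* u)%C + per R 0.
Proof. by move=> u0; rewrite -invN_axis// phi_S// expr0 mul1r. Qed.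

(** The point over the cusp 1/2 is w / (2 w + 1) with w = (- 1 + i u) / 2, reached by inversion,
    translation by - 2 and inversion; w goes to i oo with u. *)
Lemma phi0_half (u : R) : 0 < u -> phi 0 (2^-1 +i* (2^-1 * u^-1))%C =
  eichler ((- 2^-1) +i* (2^-1 * u))%C (-2) (-1) + perpol 1 (-2) + perpol (0:R) 1.
Proof.
move=> u0; set w : C := ((- 2^-1) +i* (2^-1 * u))%C.
have w0 : 0 < Im w by rewrite /= mulr_gt0// invr_gt0.
have w1 := Im_invN w0; have wn := H_neq0 w0; have w1n := H_neq0 w1.
have w2 : 0 < Im (- w^-1 + (-2)%:~R) by rewrite Im_int.
have w2n := H_neq0 w2.
have -> : (2^-1 +i* (2^-1 * u^-1))%C = - (- w^-1 + (-2)%:~R)^-1 :> C.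
  have e : - w^-1 + (-2)%:~R = - (1 + 2 * w) / w.
    by rewrite rmorphN/=; field.
  rewrite e in w2n *; have e3 : 1 + 2 * w = (0 +i* u)%C.
    rewrite -real_complex_nat; apply: complex_ext; rewrite ?ReD ?ImD ?Re_realM ?Im_realM /=; by field.
  have u1 : (0 +i* u)%C != 0 :> C by apply: H_neq0.
  rewrite e3; apply: (mulfI u1); rewrite mulNr invrN opprK invf_div mulrCA divff// mulr1.
  have u0n : u != 0 by rewrite gt_eqF.
  by apply: complex_ext; rewrite ?(ReMc, ImMc, ReN, ImN) /=; field.
rewrite phi0_eichler eichler_S// eichler_T// eichler_S//; congr (eichler w _ _ + _ + _).
  by rewrite oppr0 rmorphN/=; ring.
by rewrite oppr0 rmorphN/=; congr (perpol _ _); ring.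
Qed.

(** With t = 1/u and u going to infinity, the points of [hecke2_phi] tend to the cusps 0, 0, 1/2, 0,
    and only period constants survive. The coefficient 1049 is 1024 + 1 + 24. *)
Lemma period_relation : 691 * per R 0 + 36 * per R 2 = 0.
Proof.
have key (u : R) : 0 < u -> 1024 * phi 10 (0 +i* (2^-1 * u))%C + phi 10 (0 +i* (2 * u))%C +
   eichler ((- 2^-1) +i* (2^-1 * u))%C (-2) (-1) + 24 * phi 10 (0 +i* (1 * u))%C =
   - (1049 * per R 0 + perpol 1 (-2) + perpol (0:R) 1).
  move=> u0; have v0 : 0 < u^-1 by rewrite invr_gt0.
  have := hecke2_phi v0; rewrite phi0_half//.
  have e1 : 2 * u^-1 = (2^-1 * u)^-1 by rewrite invfM invrK.
  have e2 : 2^-1 * u^-1 = (2 * u)^-1 by rewrite invfM.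
  have e3 : 1 * u^-1 = (1 * u)^-1 by rewrite !mul1r.
  rewrite e1 e3 e2 !phi0_axis ?mulr_gt0 ?invr_gt0//; lra.
have : - (1049 * per R 0 + perpol 1 (-2) + perpol (0:R) 1) = 0.
  apply: vanish_cst => e e0.
  have h2 : 0 < (2 : R) by []. have hh : 0 < (2^-1 : R) by rewrite invr_gt0.
  have h1 : 0 < (1 : R) by [].
  have v1 := vanish_scale 1024 (vanish_dilate hh (vanish_phi 10 0)).
  have v2 := vanish_dilate h2 (vanish_phi 10 0).
  have v3 := vanish_dilate hh (vanish_eichler (-2) (-1) (- 2^-1)).
  have v4 := vanish_scale 24 (vanish_dilate h1 (vanish_phi 10 0)).
  have [T HT] := vanish_add (vanish_add (vanish_add v1 v2) v3) v4 e0.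
  exists (Num.max T 1) => t; rewrite ge_max => /andP[tT t1].
  rewrite -(key t); last by lra.
  exact: HT.
(* The left side is 2073 [per 0] + 108 [per 2] up to sign, three times the claim. *)
rewrite !perpol_short per42; lra.
Qed.

Lemma perpol_H (x y : R) : perpol x y = per R 0 * (y ^+ 10 - x ^+ 10)
  + - per R 2 * (x ^+ 2 * y ^+ 2 * (x ^+ 2 - y ^+ 2) ^+ 3).
Proof. rewrite perpol_short per42; ring. Qed.
End Hecke.

(** * The cocycle of B modulo 81 *)

Section Cocycle.
Local Open Scope int_scope.

(* Modulo 81, the coefficient of [- per 2] in the value at the cusp a/c of the symbol
   evaluated at (0,1), for a matrix of SL_2(Z) with bottom row (c, d). *)
Definition ecoc (c d : int) : int :=
  if ~~ (3 %| c)%Z then 9 - 9 * c ^+ 2 else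
  if ~~ (9 %| c)%Z then c ^+ 2 else - (9 * (d ^+ 2 - 1)).

Lemma sqr_mod3 (c : int) : ~~ (3 %| c)%Z -> exists u : int, c ^+ 2 = 1 + 3 * u.
Proof.
move=> h; have e := divz_eq c 3; set k := (c %/ 3)%Z in e.
have : (c %% 3)%Z = 1 \/ (c %% 3)%Z = 2.
  have := modz_ge0 c (isT : (3 : int) != 0); have := ltz_mod c (isT : (3 : int) != 0).
  have : (c %% 3)%Z != 0 by apply: contra h => /eqP h; apply/dvdz_mod0P.
  lia.
case=> h1; rewrite {}h1 in e.
  by exists (3 * k ^+ 2 + 2 * k); rewrite e; ring.
by exists (3 * k ^+ 2 + 4 * k + 1); rewrite e; ring.
Qed.

Lemma cube_mod3 (x : int) : exists w : int, x ^+ 3 = x + 3 * w.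
Proof.
have [/dvdzP[k ->]|/sqr_mod3[u h]] := boolP (3 %| x)%Z.
  by exists (9 * k ^+ 3 - k); ring.
by exists (x * u); rewrite exprSr h; ring.
Qed.

Lemma ecoc_N c d : ecoc (- c) (- d) = ecoc c d.
Proof. by rewrite /ecoc !dvdzE abszN !sqrrN. Qed.

Lemma ecoc_T c d (k : int) : exists w : int, ecoc c (d + k * c) = ecoc c d + 81 * w.
Proof.
rewrite /ecoc; case: ifP => _; first by exists 0; rewrite mulr0 addr0.
case: ifP => [_|/negbT]; first by exists 0; rewrite mulr0 addr0.
rewrite negbK => /dvdzP[t ->]; exists (- (2 * d * k * t + 9 * k ^+ 2 * t ^+ 2)); ring.
Qed.

(** If 9 divides c or d, the added term vanishes modulo 81. If 3 divides c exactly it is - c^2 d^8,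
    and symmetrically for d. If both are prime to 3, with c^2 = 1 + 3u and d^2 = 1 + 3v, it is 27 (u
    - v)^3, congruent to 27 (u - v). *)
Lemma ecoc_S c d : ~~ ((3 %| c)%Z && (3 %| d)%Z) ->
  exists w : int, ecoc d (- c) = ecoc c d + c ^+ 2 * d ^+ 2 * (c ^+ 2 - d ^+ 2) ^+ 3 + 81 * w.
Proof.
have d9 x : (9 %| x)%Z -> (3 %| x)%Z by apply: dvdz_trans.
rewrite negb_and /ecoc; have [c3|/sqr_mod3[u hu]] := boolP (3 %| c)%Z;
  have [d3|/sqr_mod3[v hv]] := boolP (3 %| d)%Z => //= _.
- have [/dvdzP[t ->]|c9] := boolP (9 %| c)%Z => /=.
    exists (- (t ^+ 2 * d ^+ 2 * ((t * 9) ^+ 2 - d ^+ 2) ^+ 3)); ring.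
  have /dvdzP[s es] := c3.
  have /sqr_mod3[r hr] : ~~ (3 %| s)%Z.
    by apply: contra c9 => /dvdzP[q eq]; apply/dvdzP; exists q; rewrite es eq; ring.
  exists (v * r + s ^+ 2 * (d ^+ 2 * v * (1 + 3 * v + 3 * v ^+ 2)
    - 3 * d ^+ 2 * (27 * s ^+ 6 - 9 * s ^+ 4 * d ^+ 2 + s ^+ 2 * d ^+ 4))).
  have -> : s ^+ 6 = (1 + 3 * r) ^+ 3 by rewrite -hr; ring.
  have -> : s ^+ 4 = (1 + 3 * r) ^+ 2 by rewrite -hr; ring.
  have -> : d ^+ 4 = (1 + 3 * v) ^+ 2 by rewrite -hv; ring.
  rewrite es exprMn hr hv; ring.
- have [/dvdzP[t ->]|d9n] := boolP (9 %| d)%Z => /=.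
    exists (- (t ^+ 2 * c ^+ 2 * (c ^+ 2 - (t * 9) ^+ 2) ^+ 3)); ring.
  have /dvdzP[s es] := d3.
  have /sqr_mod3[r hr] : ~~ (3 %| s)%Z.
    by apply: contra d9n => /dvdzP[q eq]; apply/dvdzP; exists q; rewrite es eq; ring.
  exists (- (r * u) + s ^+ 2 * (3 * c ^+ 2 * (27 * s ^+ 6 - 9 * s ^+ 4 * c ^+ 2 + s ^+ 2 * c ^+ 4)
    - c ^+ 2 * u * (1 + 3 * u + 3 * u ^+ 2))).
  have -> : s ^+ 6 = (1 + 3 * r) ^+ 3 by rewrite -hr; ring.
  have -> : s ^+ 4 = (1 + 3 * r) ^+ 2 by rewrite -hr; ring.
  have -> : c ^+ 4 = (1 + 3 * u) ^+ 2 by rewrite -hu; ring.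
  rewrite es exprMn hr hu; ring.
- have [y hy] := cube_mod3 (u - v).
  exists (- y - (u + v + 3 * u * v) * (u - v + 3 * y)); rewrite hu hv.
  have -> : 1 + 3 * u - (1 + 3 * v) = 3 * (u - v) by ring.
  rewrite exprMn hy; ring.
Qed.
End Cocycle.

(** * Transformation of Eichler integrals under SL_2(Z) *)

Section Modular.
Variable R : realType.
Local Notation C := R[i].
Local Notation "x %:C" := (real_complex _ x) : ring_scope.

Definition mob (a b c d : int) (z : C) : C := (a%:~R * z + b%:~R) / (c%:~R * z + d%:~R).

(** The Z-span of the functions [phi i] and of the constants [per 0], [per 2]. At a cusp the
    functions tend to 0 in the right coordinate and only the constants remain. *)
Definition lattice (f : C -> R) := exists (n : 'I_11 -> int) (u v : int), forall z, 0 < Im z ->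
  f z = \sum_i (n i)%:~R * phi i z + (u%:~R * per R 0 - v%:~R * per R 2).

Lemma lattice_eq f g : (forall z, 0 < Im z -> f z = g z) -> lattice f -> lattice g.
Proof. by move=> e [n [u [v h]]]; exists n, u, v => z z0; rewrite -e// h. Qed.

Lemma lattice_phi (j : 'I_11) : lattice (phi j).
Proof.
exists (fun i => (i == j)%:Z), 0, 0 => z z0; rewrite !mul0r subr0 addr0 (bigD1 j)//= eqxx mul1r big1 ?addr0//.
by move=> i /negbTE ->; rewrite mul0r.
Qed.

Lemma lattice_cst (u v : int) : lattice (fun=> u%:~R * per R 0 - v%:~R * per R 2).
Proof. by exists (fun=> 0), u, v => z z0; rewrite big1 ?add0r// => i _; rewrite mul0r. Qed.

Lemma lattice_add f g : lattice f -> lattice g -> lattice (fun z => f z + g z).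
Proof.
move=> [n [u [v h]]] [n' [u' [v' h']]]; exists (fun i => n i + n' i), (u + u'), (v + v') => z z0.
rewrite h// h'// !rmorphD/=; under [in RHS]eq_bigr do rewrite rmorphD mulrDl.
by rewrite big_split/=; ring.
Qed.

Lemma lattice_scale (k : int) f : lattice f -> lattice (fun z => k%:~R * f z).
Proof.
move=> [n [u [v h]]]; exists (fun i => k * n i), (k * u), (k * v) => z z0.
rewrite h// !rmorphM/=; under [in RHS]eq_bigr do rewrite rmorphM -mulrA.
by rewrite -mulr_sumr; ring.
Qed.

Lemma lattice_sum (F : 'I_11 -> C -> R) : (forall i, lattice (F i)) -> lattice (fun z => \sum_i F i z).
Proof.
move=> h; suff H r : lattice (fun z => \sum_(i <- r) F i z) by exact: H.
elim: r => [|i r IH].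
  by apply: lattice_eq (lattice_cst 0 0) => z z0; rewrite big_nil /= ?mulr0z !mul0r subr0.
by apply: lattice_eq (lattice_add (h i) IH) => z z0; rewrite big_cons.
Qed.

Lemma lattice_subst (F : 'I_11 -> C -> R) (n : 'I_11 -> int) (u v : int) :
  (forall i, lattice (F i)) ->
  lattice (fun z => \sum_i (n i)%:~R * F i z + (u%:~R * per R 0 - v%:~R * per R 2)).
Proof.
move=> h; apply: lattice_add (lattice_cst _ _); apply: lattice_sum => i.
exact: lattice_scale.
Qed.

Lemma lattice_phi_T (k : int) (j : 'I_11) : lattice (fun z => phi j (z + k%:~R)).
Proof.
have h : lattice (fun z => \sum_(i < 11) (('C(10 - i, j - i) * (i <= j))%:Z * k ^+ (j - i))%:~R * phi i z).
  by apply: lattice_sum => i; apply: lattice_scale; exact: lattice_phi.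
apply: lattice_eq h => z z0; rewrite phi_T//; last by rewrite -ltnS.
by apply: eq_bigr => i _; rewrite rmorphM rmorphXn.
Qed.

(** Parity, antisymmetry and [per42] reduce the eleven periods to two, with integer coefficients. *)
Lemma lattice_per (j : nat) : (j <= 10)%N -> lattice (fun=> per R j).
Proof.
move=> j10.
have [oj|ej] := boolP (odd j).
  by apply: lattice_eq (lattice_cst 0 0) => z z0; rewrite (per_odd R oj j10) mulr0z !mul0r subr0.
have e10 : per R 10 = - per R 0 by rewrite -(@per_sym R 0).
have e8 : per R 8 = - per R 2 by rewrite -(@per_sym R 2).
have e6 : per R 6 = - per R 4 by rewrite -(@per_sym R 4).
have e4 := per42 R.
have [u [v e]] : exists u v : int, per R j = u%:~R * per R 0 - v%:~R * per R 2.
  move: j j10 ej; do 11?[case => //] => _ _;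
    [exists 1, 0|exists 0, (-1)|exists 0, 3|exists 0, (-3)|exists 0, 1|exists (-1), 0];
    rewrite ?e10 ?e8 ?e6 ?e4; lra.
by apply: lattice_eq (lattice_cst u v) => z z0; rewrite e.
Qed.

Lemma lattice_phi_S (j : 'I_11) : lattice (fun z => phi j (- z^-1)).
Proof.
have j10 : (j <= 10)%N by rewrite -ltnS.
have h := lattice_add (lattice_scale ((-1) ^+ j) (lattice_phi (rev_ord j))) (lattice_per j10).
by apply: lattice_eq h => z z0; rewrite phi_S// rmorphXn/= subSS.
Qed.

(** What is carried along the Euclidean algorithm: the weight 12 law, for bounds near the cusps; the
    value of [phi 0], exact in [per 0] and modulo 81 in [per 2]; and integrality for all j, for the
    normalization of the period. *)
Definition SL2_transform (a b c d : int) := [/\ a * d - b * c = 1,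
  forall z, 0 < Im z -> c%:~R * z + d%:~R != 0 /\
    (0 < Im (mob a b c d z) /\ Dl (mob a b c d z) = (c%:~R * z + d%:~R) ^+ 12 * Dl z),
  exists w : int, forall z, 0 < Im z -> phi 0 (mob a b c d z) = eichler z c%:~R d%:~R
    + (c%:~R ^+ 10 * per R 0 - (ecoc c d + 81 * w)%:~R * per R 2) &
  forall j : 'I_11, lattice (fun z => phi j (mob a b c d z))].

Lemma lattice_comp (f : C -> R) (g : C -> C) : (forall z, 0 < Im z -> 0 < Im (g z)) ->
  (forall j : 'I_11, lattice (fun z => phi j (g z))) -> lattice f -> lattice (fun z => f (g z)).
Proof.
move=> hg H [n [u [v h]]]; apply: lattice_eq (lattice_subst n u v H) => z z0.
by rewrite -h// hg.
Qed.

Lemma SL2_transform1 : SL2_transform 1 0 0 1.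
Proof.
have e z : mob 1 0 0 1 z = z by rewrite /mob !rmorph1 !rmorph0 mul1r mul0r add0r addr0 divr1.
split => //.
- move=> z z0; rewrite e rmorph0 mul0r add0r rmorph1 expr1n mul1r oner_eq0//.
- exists 0 => z z0; rewrite e /= !rmorph0 rmorph1 phi0_eichler expr0n/= mul0r.
  by rewrite /ecoc /= mul0r subr0 addr0.
- by move=> j; apply: lattice_eq (lattice_phi j) => z z0; rewrite e.
Qed.

Lemma SL2_transform_N a b c d : SL2_transform a b c d -> SL2_transform (- a) (- b) (- c) (- d).
Proof.
have e z : mob (- a) (- b) (- c) (- d) z = mob a b c d z.
  by rewrite /mob !rmorphN !mulNr -!opprD invrN mulrNN.
have e2 (z : C) : (- c)%:~R * z + (- d)%:~R = - (c%:~R * z + d%:~R) by rewrite !rmorphN mulNr -opprD.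
move=> [h1 h2 [w h3] h4]; split => //.
- by rewrite !mulrNN.
- by move=> z z0; rewrite e e2 oppr_eq0 [(- _) ^+ 12]exprNn -signr_odd expr0 mul1r; exact: h2.
- exists w => z z0; rewrite e h3// ecoc_N !rmorphN eichler_even; congr (_ + (_ * _ - _)).
  by rewrite exprNn -signr_odd expr0 mul1r.
- by move=> j; apply: lattice_eq (h4 j) => z z0; rewrite e.
Qed.

Lemma SL2_transform_T (k : int) a b c d : SL2_transform a b c d -> SL2_transform a (b + k * a) c (d + k * c).
Proof.
have e z : mob a (b + k * a) c (d + k * c) z = mob a b c d (z + k%:~R).
  by rewrite /mob !rmorphD !rmorphM/=; congr (_ / _); ring.
have e2 (z : C) : c%:~R * z + (d + k * c)%:~R = c%:~R * (z + k%:~R) + d%:~R.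
  by rewrite !rmorphD !rmorphM/=; ring.
move=> [h1 h2 [w h3] h4]; split => //.
- by rewrite -h1; ring.
- move=> z z0; rewrite e e2 -[Dl z](Dl_int k); apply: h2; by rewrite Im_int.
- have [w' hw'] := ecoc_T c d k; exists (w - w') => z z0.
  have zk : 0 < Im (z + k%:~R) by rewrite Im_int.
  rewrite e h3// eichler_T// hw' [in RHS]rmorphD rmorphM/=; congr (_ + (_ - _%:~R * _)); ring.
- move=> j; have hk z : 0 < Im z -> 0 < Im (z + k%:~R : C) by rewrite Im_int.
  by apply: lattice_eq (lattice_comp hk (lattice_phi_T k) (h4 j)) => z z0; rewrite e.
Qed.

Lemma SL2_transform_S a b c d : SL2_transform a b c d -> SL2_transform b (- a) d (- c).
Proof.
move=> [h1 h2 [w h3] h4].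
have e z : 0 < Im z -> mob b (- a) d (- c) z = mob a b c d (- z^-1) /\
   c%:~R * (- z^-1) + d%:~R = (d%:~R * z + (- c)%:~R) / z.
  move=> z0; have zn := H_neq0 z0; have [n1 _] := h2 _ (Im_invN z0).
  have e2 : c%:~R * (- z^-1) + d%:~R = (d%:~R * z + (- c)%:~R) / z by rewrite rmorphN; field.
  split => //; rewrite /mob e2; move: n1; rewrite e2 mulf_eq0 negb_or => /andP[n1 _].
  move: n1; rewrite !mulrNz; move: (c%:~R) (d%:~R) (a%:~R) (b%:~R) => c' d' a' b' n1; field.
  by rewrite n1 zn.
split.
- by rewrite -h1; ring.
- move=> z z0; have [e1 e2] := e z z0; have zn := H_neq0 z0.
  have [n1 [n2 n3]] := h2 _ (Im_invN z0); rewrite e1; split; [|split].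
  + by move: n1; rewrite e2 mulf_eq0 negb_or => /andP[].
  + exact: n2.
  rewrite n3 e2 (Delta_inversion z0); have := expf_neq0 12 zn.
  move: (d%:~R * z + _) (Dl z) => u D h; rewrite expr_div_n; move: h.
  by move: (z ^+ 12) (u ^+ 12) => x y x0; field.
- have [|w' hw'] := @ecoc_S c d.
    apply/negP => /andP[/dvdzP[s es] /dvdzP[t et]].
    move: h1; rewrite es et => h1; have : (3 %| a * (t * 3) - b * (s * 3))%Z by apply/dvdzP; exists (a * t - b * s); ring.
    by rewrite h1.
  exists (w - w') => z z0; have [e1 _] := e z z0; rewrite e1 h3 ?Im_invN// eichler_S// perpol_H hw'.
  rewrite !(rmorphN, rmorphD, rmorphM, rmorphB, rmorphXn)/=; move: (eichler _ _ _) => f; ring.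
- move=> j; have hk (z : C) : 0 < Im z -> 0 < Im (- z^-1) by exact: Im_invN.
  by apply: lattice_eq (lattice_comp hk lattice_phi_S (h4 j)) => z z0; have [->] := e z z0.
Qed.

(** Induction on |c|: with d = k c + d', the matrix comes by inversion, sign change and translation
    from one whose lower left entry is d' < |c|. *)
Lemma SL2_transformP a b c d : a * d - b * c = 1 -> SL2_transform a b c d.
Proof.
have [n] := ubnP `|c|%N; elim: n => // n IH in a b c d *; rewrite ltnS => cn h.
have [c0|c0] := eqVneq c 0.
  rewrite c0 mulr0 subr0 in h *.
  have : a = 1 /\ d = 1 \/ a = -1 /\ d = -1.
    have /eqP := congr1 absz h; rewrite abszM muln_eq1 => /andP[/eqP ha /eqP hd].
    have [a1|a1] : a = 1 \/ a = -1 by lia.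
      by left; move: h; rewrite a1; lia.
    by right; move: h; rewrite a1; lia.
  case=> -[-> ->].
    by have := SL2_transform_T b SL2_transform1; rewrite mulr1 mulr0 add0r addr0.
  by have := SL2_transform_N (SL2_transform_T (- b) SL2_transform1); rewrite mulr1 mulr0 add0r addr0 opprK oppr0.
pose k := (d %/ c)%Z; pose d' := (d %% c)%Z.
have ed : d = k * c + d' by exact: divz_eq.
have dp : 0 <= d' by exact: modz_ge0.
have dl : d' < `|c| by exact: ltz_mod.
have h' : (b - k * a) * (- c) - (- a) * d' = 1 by rewrite -h ed; ring.
have := IH (b - k * a) (- a) d' (- c).
rewrite (leq_trans _ cn) => [/(_ isT h')|]; last by lia.
move=> /SL2_transform_S/SL2_transform_N/(SL2_transform_T k); rewrite !opprK.
by have -> : b - k * a + k * a = b by [rewrite subrK]; have -> : d' + k * c = d by rewrite ed addrC.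
Qed.
End Modular.

(** * Behaviour along vertical lines ending at a cusp *)

Section Cusps.
Variable R : realType.
Local Notation C := R[i].
Local Notation "x %:C" := (real_complex _ x) : ring_scope.

Lemma qsf_bounded a (y : R) : subexp a -> 0 < y ->
  exists2 K : R, 0 <= K & forall z : C, y <= Im z -> cm (qsf a z) <= K.
Proof.
move=> sa y0; have p0 := pi_gt0 R.
pose x : R := expR (- (2 * pi) * y).
have x01 : 0 <= x < 1.
  by rewrite expR_ge0/= -[ltRHS](@expR0 R) ltr_expR mulNr oppr_lt0 !mulr_gt0.
have [b [b0 [S HS]] hb] := subexp_dom sa x01.
exists S; first by have := HS 0%N; rewrite big_ord0.
move=> z z1; have z0 : 0 < Im z by lra.
have q1 : cm (eD z) <= x by rewrite cm_eD ler_expR !mulNr lerN2 ler_pM2l ?mulr_gt0.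
apply: (@csumto_cm _ _ b) (qsf_csum sa z0) => [n|n]; last exact: HS.
apply: le_trans (hb n); rewrite cmM cmX ler_wpM2l ?cm_ge0//.
have [x0 x1] := andP x01; apply: (@le_trans _ _ (x ^+ n.+1)).
  by rewrite lerXn2r ?nnegrE ?cm_ge0.
by rewrite exprS ler_piMl ?exprn_ge0// ltW.
Qed.

Lemma vanish_sum (I : Type) (r : seq I) (F : I -> R -> R) :
  (forall i, vanish (F i)) -> vanish (fun t => \sum_(i <- r) F i t).
Proof.
move=> h; elim: r => [|i r IH] e e0; first by exists 0 => t _; rewrite big_nil normr0.
by have [T HT] := vanish_add (h i) IH e0; exists T => t /HT; rewrite big_cons.
Qed.

(** The matrix maps the vertical line over - d/m to the one over a/m, reversing its direction: t
    near 0 corresponds to [w] near i oo. *)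
Lemma mob_cusp (a b m d : int) (t : R) : 0 < m -> a * d - b * m = 1 -> 0 < t ->
  let w : C := ((- d%:~R / m%:~R) +i* (m%:~R ^+ 2 * t)^-1)%C in
  mob a b m d w = ((a%:~R / m%:~R) +i* t)%C /\ m%:~R * w + d%:~R = (0 +i* (m%:~R * t)^-1)%C.
Proof.
move=> m0 h t0 w; have mr : 0 < m%:~R :> R by rewrite ltr0z.
have mn : m%:~R != 0 :> R by rewrite gt_eqF. have tn : t != 0 by rewrite gt_eqF.
have e : m%:~R * w + d%:~R = (0 +i* (m%:~R * t)^-1)%C.
  rewrite !int_real /w; apply: complex_ext; rewrite !(ReD, ImD, ReMc, ImMc)/=; by field; rewrite ?mn ?tn.
split => //; rewrite /mob e.
have n0 : (0 +i* (m%:~R * t)^-1)%C != 0 :> C by apply: H_neq0; rewrite /= invr_gt0 mulr_gt0.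
apply: (mulIf n0); rewrite divfK//.
have hr : a%:~R * d%:~R - b%:~R * m%:~R = 1 :> R by rewrite -!rmorphM -rmorphB h.
rewrite !int_real /w; apply: complex_ext; rewrite !(ReD, ImD, ReMc, ImMc)/=.
  have -> : b%:~R = (a%:~R * d%:~R - 1) / m%:~R :> R by apply: (mulIf mn); rewrite divfK//; lra.
  by field; rewrite ?mn ?tn.
by field; rewrite ?mn ?tn.
Qed.

(** The integrable majorant on the whole path, from three ranges of heights: decay for t >= 1,
    modularity near the cusp, and boundedness of the q-series in between. *)
Lemma Dl_powM_bound j (s : R) (a b m d : int) : 0 < m -> a * d - b * m = 1 -> s = a%:~R / m%:~R ->
  exists K : R, forall t, 0 < t -> cm ((s +i* t)%C ^+ j * Dl (s +i* t)%C) <= K * expR (- t).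
Proof.
move=> m0 h es; have mr : 1 <= m%:~R :> R by rewrite ler1z; lia.
have mr0 : 0 < m%:~R :> R by lra.
pose M : R := m%:~R; rewrite -/M in mr mr0.
have decD k : dec (fun z : C => z ^+ k * Dl z).
  move=> c; have [K HK] := dec_pow_qsf k (@subexp_dcoef R) c.
  by exists K => z h1 h2; rewrite -qsf_Dl; [exact: HK|lra].
have [K1 H1] := decD j `|s|.
have [K2 H2] := decD 12 `|- d%:~R / M|.
have M2 : 0 < M ^- 2 by rewrite invr_gt0 exprn_gt0.
have [K3 K30 H3] := qsf_bounded (@subexp_dcoef R) M2.
pose L := `|K1| + M ^+ 12 * `|K2| * (`|s| + 1) ^+ j * expR 1 + K3 * (`|s| + 1) ^+ j * expR 1.
have s0 := normr_ge0 s.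
have p0 : 0 <= (`|s| + 1) ^+ j by rewrite exprn_ge0//; lra.
have l1 : `|K1| <= L.
  by rewrite /L -addrA lerDl addr_ge0// !mulr_ge0// ?exprn_ge0 ?expR_ge0//; lra.
exists L => t t0; have et := expR_ge0 (- t).
have [t1|t1] := leP 1 t.
  have := H1 (s +i* t)%C (lexx _) t1; rewrite [Im _]/= => h1; apply: le_trans h1 _; rewrite ler_wpM2r//.
  by apply: le_trans l1; exact: ler_norm.
have e1 : 1 <= expR 1 * expR (- t) by rewrite -expRD expR_ge_1//; lra.
have s1 : 0 <= `|s| + 1 by lra.
have b1 : cm ((s +i* t)%C ^+ j : C) <= (`|s| + 1) ^+ j.
  rewrite cmX lerXn2r ?nnegrE ?cm_ge0 ?s1//.
  by apply: le_trans (cm_ReIm _) _; rewrite /= lerD2l ger0_norm; lra.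
rewrite cmM; set D := cm (Dl _).
suff : D <= M ^+ 12 * `|K2| \/ D <= K3.
  have D0 : 0 <= D by exact: cm_ge0.
  have k2 := normr_ge0 K2; have k1 := normr_ge0 K1.
  have M0 : 0 <= M ^+ 12 * `|K2| by rewrite mulr_ge0// exprn_ge0//; lra.
  move=> hD; have {hD} hD : D <= M ^+ 12 * `|K2| + K3 by case: hD; lra.
  apply: le_trans (ler_pM (cm_ge0 _) D0 b1 hD) _.
  rewrite /L; move: M0 hD et e1 p0 b1 k1; move: (M ^+ 12 * `|K2|) (expR 1) (expR (- t)) ((`|s| + 1) ^+ j) (`|K1|) => A e f p k A0 _ f0 ef p0 _ k0.
  have h1 : p * (A + K3) <= p * (A + K3) * (e * f) by rewrite ler_peMr// mulr_ge0//; lra.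
  have h2 : 0 <= k * f by rewrite mulr_ge0.
  have -> : (k + A * p * e + K3 * p * e) * f = k * f + p * (A + K3) * (e * f) by ring.
  lra.
(* This quantity is Im w for the point [w] of [mob_cusp]; when it is below 1, the height t is at
   least m^(-2). *)
have [tm|tm] := leP 1 (M ^+ 2 * t)^-1; [left|right].
  have [e2 e3] := mob_cusp m0 h t0; rewrite -/M in e2 e3; set w : C := (_ +i* _)%C in e2 e3.
  have w1 : 1 <= Im w by []. have w0 : 0 < Im w by lra.
  have [_ g2 _ _] := SL2_transformP R h; have [_ [_ g3]] := g2 w w0.
  rewrite /D es -/M -e2 g3 e3 cmM cmX.
  have -> : cm (0 +i* (M * t)^-1)%C = M * Im w.
    have -> : (0 +i* (M * t)^-1)%C = 'i%C * ((M * t)^-1)%:C :> C.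
      by apply: complex_ext; rewrite !(ReMc, ImMc)/=; ring.
    rewrite cmM cm_i mul1r cm_real ger0_norm ?invr_ge0 ?mulr_ge0//; try lra.
    by rewrite /=; field; rewrite !gt_eqF.
  rewrite exprMn -mulrA ler_wpM2l ?exprn_ge0//; first lra.
  apply: (@le_trans _ _ (cm (w ^+ 12 * Dl w))).
    rewrite cmM cmX ler_wpM2r ?cm_ge0// lerXn2r ?nnegrE ?cm_ge0//; first lra.
    by apply: le_trans (cm_Im _); exact: ler_norm.
  apply: le_trans (H2 w (lexx _) w1) _.
  have e : expR (- Im w) <= 1 by rewrite expR_le1; lra.
  have := ler_norm K2; have := normr_ge0 K2; have := expR_ge0 (- Im w); nra.
have tM : M ^- 2 <= t.
  move: tm; rewrite invf_lt1; last by rewrite mulr_gt0// exprn_gt0.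
  by move=> tm; rewrite -[_ ^- 2]mul1r ler_pdivrMr ?exprn_gt0// mulrC ltW.
by rewrite /D -qsf_Dl//; exact: H3.
Qed.

(** With t = 1/T, the height of [w] is T / m^2, so the [phi i] in [lattice] tend to 0. *)
Lemma cusp_limit (a b m d : int) (j : 'I_11) : 0 < m -> a * d - b * m = 1 ->
  exists u v : int, vanish (fun T : R => phi j ((a%:~R / m%:~R) +i* T^-1)%C -
    (u%:~R * per R 0 - v%:~R * per R 2)).
Proof.
move=> m0 h; have mr : 0 < m%:~R :> R by rewrite ltr0z.
have [_ _ _ /(_ j)[n [u [v g]]]] := SL2_transformP R h; exists u, v.
pose x : R := - d%:~R / m%:~R.
have : vanish (fun T : R => \sum_(i < 11) (n i)%:~R * phi i (x +i* (m%:~R ^- 2 * T))%C).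
  apply: vanish_sum => i; apply: vanish_scale.
  apply: (vanish_dilate (f := fun T => phi i (x +i* T)%C)); last exact: vanish_phi.
  by rewrite invr_gt0 exprn_gt0.
move=> H e /H[T HT]; exists (Num.max T 1) => t; rewrite ge_max => /andP[/HT t1 t2].
have t0 : 0 < t^-1 by rewrite invr_gt0; lra.
have [<- _] := mob_cusp m0 h t0; rewrite g/= ?invr_gt0 ?mulr_gt0 ?exprn_gt0//.
by rewrite invfM invrK addrK.
Qed.

Lemma cusp_limit0 (a b m d : int) : 0 < m -> a * d - b * m = 1 ->
  exists w : int, vanish (fun T : R => phi 0 ((a%:~R / m%:~R) +i* T^-1)%C -
    (m%:~R ^+ 10 * per R 0 - (ecoc m d + 81 * w)%:~R * per R 2)).
Proof.
move=> m0 h; have mr : 0 < m%:~R :> R by rewrite ltr0z.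
have [_ _ [w g] _] := SL2_transformP R h; exists w.
have m2 : 0 < m%:~R ^- 2 :> R by rewrite invr_gt0 exprn_gt0.
have H := vanish_dilate m2 (vanish_eichler m%:~R d%:~R (- d%:~R / m%:~R : R)).
move=> e /H[T HT]; exists (Num.max T 1) => t; rewrite ge_max => /andP[/HT t1 t2].
have t0 : 0 < t^-1 by rewrite invr_gt0; lra.
have [<- _] := mob_cusp m0 h t0; rewrite g/= ?invr_gt0 ?mulr_gt0 ?exprn_gt0//.
by rewrite invfM invrK addrK.
Qed.
End Cusps.

(** * Improper integrals over the positive half-line *)

Section ImproperIntegral.
Variable R : realType.
Local Notation mu := (@lebesgue_measure R).

Lemma integrable_expRN (K : R) :
  mu.-integrable `]0, +oo[%classic (fun x => (K * expR (- x))%:E).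
Proof.
have c1 : continuous (fun x : R => expR (- x)).
  by move=> x; apply: continuous_comp; [exact: opp_continuous|exact: continuous_expR].
have d1 (x : R) : is_derive x 1 (fun x => - expR (- x)) (expR (- x)).
  by apply: is_derive_eq; rewrite /GRing.scale/= mulrN1 opprK.
have h : (\int[mu]_(x in `[0%R, +oo[) (expR (- x))%:E = 0%:E - (- expR (- 0))%:E)%E.
  apply: (@ge0_continuous_FTC2y R (fun x => expR (- x)) (fun x => - expR (- x)) 0 0).
  - by move=> x _; exact: expR_ge0.
  - exact: continuous_subspaceT.
  - by rewrite -[0]oppr0; apply: cvgN; exact: cvgr_expR.
  - by move=> x _; exact: ex_derive.
  - by apply: cvg_at_right_filter; apply: cvgN; exact: c1.
  - by move=> x _; rewrite derive1E; exact: derive_val.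
have ic : mu.-integrable `[0, +oo[%classic (fun x => (expR (- x))%:E).
  apply/integrableP; split.
    by apply/measurable_EFinP; apply: measurable_funTS; exact: continuous_measurable_fun.
  under eq_integral do rewrite gee0_abs ?lee_fin ?expR_ge0//.
  by rewrite h ltry.
have io : mu.-integrable `]0, +oo[%classic (fun x => (expR (- x))%:E).
  apply: integrableS ic => //. by move=> x /=; rewrite !in_itv/= !andbT; exact: ltW.
have mD : measurable (`]0, +oo[%classic : set R) by exact: measurable_itv.
exact: (@integrableZl _ _ _ mu _ mD K _ io).
Qed.

(** The fundamental theorem on [1/(n+2), n+2], then dominated convergence with majorant K e^(-t).
    The shift by 2 makes these intervals nondegenerate. *)
Lemma improper_FTC (f F : R -> R) (K l : R) :
  (forall t : R, 0 < t -> is_derive t 1 F (f t)) ->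
  (forall t : R, 0 < t -> {for t, continuous f}) ->
  (forall t : R, 0 < t -> `|f t| <= K * expR (- t)) ->
  vanish F -> vanish (fun T => F T^-1 - l) ->
  (\int[mu]_(t in `]0%R, +oo[) f t = - l)%R.
Proof.
move=> dF cf bf vF vl; set D : set R := `]0%R, +oo[%classic.
have D0 x : D x -> 0 < x by rewrite /D/= in_itv/= andbT.
have mD : measurable D by exact: measurable_itv.
have mf : measurable_fun D f.
  apply: open_continuous_measurable_fun => [|x]; first exact: interval_open.
  by rewrite inE => /D0; exact: cf.
pose I n : set R := `[n.+2%:R^-1, n.+2%:R]%classic.
have ID n : I n `<=` D.
  move=> x; rewrite /I /D /= !in_itv/= => /andP[h _]; rewrite andbT.
  by apply: lt_le_trans h; rewrite invr_gt0.
have In n : (\int[mu]_(x in D) ((f \_ (I n)) x)%:E = (F n.+2%:R)%:E - (F n.+2%:R^-1)%:E)%E.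
  have n2 : n.+2%:R^-1 < n.+2%:R :> R by rewrite (@lt_trans _ _ 1)// ?invf_lt1 ?ltr1n.
  have pos t : n.+2%:R^-1 <= t -> (0 : R) < t by apply: lt_le_trans; rewrite invr_gt0.
  have cF t : 0 < t -> {for t, continuous F}.
    by move=> t0; exact/differentiable_continuous/derivable1_diffP/(@ex_derive _ _ _ _ _ _ _ (dF t t0)).
  have : (\int[mu]_(x in I n) (f x)%:E = (F n.+2%:R)%:E - (F n.+2%:R^-1)%:E)%E.
    apply: (@continuous_FTC2 R f F) => //.
    - apply: continuous_in_subspaceT => x; rewrite inE/= in_itv/= => /andP[/pos x0 _]; exact: cf.
    - split.
      + by move=> x; rewrite in_itv/= => /andP[/ltW/pos x0 _]; exact: (@ex_derive _ _ _ _ _ _ _ (dF x x0)).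
      + by apply: cvg_at_right_filter; apply: cF; rewrite invr_gt0.
      + by apply: cvg_at_left_filter; apply: cF.
    - move=> x; rewrite in_itv/= => /andP[/ltW/pos x0 _]; rewrite derive1E.
      exact: (@derive_val _ _ _ _ _ _ _ (dF x x0)).
  move=> <-; rewrite -{2}(setIidr (ID n)) integral_mkcondr.
  by apply: eq_integral => x _; rewrite !patchE; case: ifP.
have mI n : measurable (I n) by exact: measurable_itv.
have [|||||_ _ h] := @dominated_convergence _ _ _ mu D mD (fun n x => ((f \_ (I n)) x)%:E) (fun x => (f x)%:E) (fun x => (K * expR (- x))%:E).
- move=> n; apply/measurable_EFinP; apply/measurable_restrict; [exact: mI|exact: mD|].
  by apply: (measurable_funS mD _ mf) => x [].
- by apply/measurable_EFinP.
- apply/aeW => x /D0 x0.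
  apply: cvg_EFin; first exact: nearW.
  apply: cvg_near_cst; near=> n; rewrite /= patchE ifT// inE /I/= in_itv/=; apply/andP; split.
    rewrite -[leRHS]invrK lef_pV2 ?posrE ?invr_gt0//.
    apply: (@le_trans _ _ n%:R); last by rewrite ler_nat leqW.
    by near: n; exact: nbhs_infty_ger.
  apply: (@le_trans _ _ n%:R); last by rewrite ler_nat leqW.
  by near: n; exact: nbhs_infty_ger.
- exact: integrable_expRN.
- apply/aeW => x n /D0 x0; rewrite patchE; case: ifP => _.
    by rewrite lee_fin; exact: bf.
  by rewrite abse0 lee_fin (le_trans _ (bf x x0)).
move: h; rewrite (_ : (fun n => _) = (fun n => (F n.+2%:R - F n.+2%:R^-1)%:E)); last first.
  by apply/funext => n /=; rewrite In EFinB.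
move=> h; have h2 : (fun n => (F n.+2%:R - F n.+2%:R^-1)%:E) @ \oo --> (- l)%:E.
  apply: cvg_EFin; first exact: nearW.
  apply/cvgrPdist_lt => e e0; have e2 : 0 < e / 2 by rewrite divr_gt0.
  have [T HT] := vF _ e2; have [U HU] := vl _ e2; near=> n.
  have h1 : `|F n.+2%:R| < e / 2.
    apply: HT; apply: (@le_trans _ _ n%:R); last by rewrite ler_nat leqW.
    by near: n; exact: nbhs_infty_ger.
  have h3 : `|F n.+2%:R^-1 - l| < e / 2.
    apply: HU; apply: (@le_trans _ _ n%:R); last by rewrite ler_nat leqW.
    by near: n; exact: nbhs_infty_ger.
  rewrite /=; have -> : - l - (F n.+2%:R - F n.+2%:R^-1) = (F n.+2%:R^-1 - l) - F n.+2%:R by ring.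
  by have := ler_normB (F n.+2%:R^-1 - l) (F n.+2%:R); lra.
by rewrite /Rintegral (cvg_unique _ h h2).
Unshelve. all: by end_near. Qed.
End ImproperIntegral.

(* The modular symbol of the definitions and its period *)
Opaque per.
Lemma vanish_opp (T : realType) (f : T -> T) : vanish f -> vanish (fun t => - f t).
Proof. by move=> h e /h[U HU]; exists U => t /HU; rewrite normrN. Qed.

Lemma ccvg_limn (T : realType) (u : nat -> T[i]) l : ccvg u l ->
  (limn (fun n => Re (u n)) +i* limn (fun n => Im (u n)))%C = l.
Proof.
move=> h; apply: complex_ext => /=; apply: cvg_lim; try exact: Rhausdorff; apply/cvgrPdist_lt => e e0;
  have [N HN] := h _ e0; near=> n; (apply: le_lt_trans (HN n _); last by near: n; exact: nbhs_infty_ge).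
- by rewrite -ReB -normrN -ReN opprB; exact: cm_Re.
- by rewrite -ImB -normrN -ImN opprB; exact: cm_Im.
Unshelve. all: by end_near. Qed.

Local Notation "x %:C" := (real_complex _ x) : ring_scope.

Lemma qexpE (z : R[i]) : qexp z = eD z.
Proof.
rewrite /qexp /eD cexpE /ReC /ImC.
have -> : Re (2 * pi%:C * 'i%C * z) = - (2 * pi) * Im z.
  by rewrite -real_complex_nat; move: z => [a b]; rewrite !(ReMc, ImMc)/=; ring.
have -> : Im (2 * pi%:C * 'i%C * z) = 2 * pi * Re z.
  by rewrite -real_complex_nat; move: z => [a b]; rewrite !(ReMc, ImMc)/=; ring.
by [].
Qed.

Lemma DeltaE (z : R[i]) : 0 < Im z -> Delta z = Dl z.
Proof.
move=> z0; rewrite /Delta /ReC /ImC; apply: (@ccvg_limn _ (fun N => Delta_partial N z)).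
have h := ccvgZ (eD z) (ccvgX 24 (Eu_cvg (cm_eD_lt1 z0))).
apply: ccvg_eq h => n; rewrite /Delta_partial qexpE /Eu -prodrXl.
by rewrite big_add1 /= big_mkord.
Qed.

(** Links the Lebesgue integrals of the definition with limits of [phi]: [improper_FTC] with
    primitive - Re Phi, which vanishes at infinity. *)
Lemma PjE (s : rat) (j : nat) (l : R) : (j <= 10)%N ->
  vanish (fun T => phi j (ratr s +i* T^-1)%C - l) -> 'C(10, j)%:R * Pj j (Some s) = l.
Proof.
move=> j10 vl; pose x : R := ratr s; pose a : int := numq s; pose m : int := denq s.
have c0 : 'C(10, j)%:R != 0 :> R by rewrite pnatr_eq0 -lt0n bin_gt0.
have zE t : (x +i* t)%C = x%:C + t%:C * 'i%C :> R[i].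
  by apply: complex_ext; rewrite ?ReD ?ImD ?ReMc ?ImMc /=; ring.
(* Written with the q-series, whose differentiability ([CD_qsf]) provides the continuity of the
   integrand. *)
pose G (z : R[i]) := tpi R * (z ^+ j * qsf (@dcoef R) z).
pose f (t : R) := - Re (G (x +i* t)%C * 'i%C).
have GE t : 0 < t -> G (x +i* t)%C = tpi R * ((x +i* t)%C ^+ j * Dl (x +i* t)%C).
  by move=> t0; rewrite /G qsf_Dl.
have fE : {in `]0, +oo[%classic, forall t : R,
   ReC ((2 * pi)%:C * 'i%C * Delta (x +i* t)%C * (x +i* t)%C ^+ j * 'i%C) = f t}.
  move=> t; rewrite inE/= in_itv/= andbT => t0; rewrite DeltaE// /f GE// /ReC /tpi -ReN.
  rewrite rcM real_complex_nat; congr Re; move: (Dl _) (_ ^+ j) (pi%:C) ('i%C : R[i]) => D w p i.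
  by ring.
have -> : Pj j (Some s) = \int[@lebesgue_measure R]_(t in `]0%R, +oo[) f t.
  by apply: eq_Rintegral => t tD; exact: fE.
have [b [d hbd]] : exists b d : int, a * d - b * m = 1.
  have : coprimez a m by rewrite /coprimez; exact: coprime_num_den.
  case/coprimezP => [[u v] /= e]; exists (- v), u; rewrite -e; ring.
have m0 : 0 < m by exact: denq_gt0.
have xE : x = a%:~R / m%:~R by rewrite /x /ratr.
have [K HK] := Dl_powM_bound j m0 hbd xE.
have p0 := pi_gt0 R.
suff -> : \int[@lebesgue_measure R]_(t in `]0%R, +oo[) f t = - - (l / 'C(10, j)%:R).
  by rewrite opprK mulrCA divff ?mulr1.
apply: (@improper_FTC _ f (fun t => - Re (Phi j (x +i* t)%C)) (2 * pi * K)).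
- move=> t t0.
  have z0 : 0 < Im (x%:C + t%:C * 'i%C : R[i]) by rewrite -zE.
  have h := CD_Re_derive (CD_Phi j z0).
  have := is_deriveN h; rewrite -!zE -GE// -/(f t).
  have -> : - (fun t : R => Re (Phi j (x%:C + t%:C * 'i%C))) = (fun t : R => - Re (Phi j (x +i* t)%C)).
    by apply/funext => u; rewrite zE.
  by [].
- move=> t t0; have z0 : 0 < Im (x%:C + t%:C * 'i%C : R[i]) by rewrite -zE.
  have hG := CD_scale (tpi R) (CD_mul (CD_pow j (x%:C + t%:C * 'i%C)) (CD_qsf (@subexp_dcoef R) z0)).
  have := is_derive_continuous (is_deriveN (CD_Re_derive (CD_scale 'i%C hG))).
  have -> : - (fun t : R => Re ('i%C * (G (x%:C + t%:C * 'i%C)))) = f.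
    by apply/funext => u; rewrite /f zE mulrC.
  by [].
- move=> t t0; rewrite /f normrN; apply: le_trans (cm_Re _) _; rewrite GE//.
  have hk := HK t t0; move: (_ * Dl _) hk => D hk; rewrite cmM cm_i mulr1 cmM.
  have -> : cm (tpi R) = 2 * pi by rewrite /tpi cmN !cmM cm_nat cm_real cm_i mulr1 gtr0_norm.
  by rewrite -mulrA ler_pM2l// mulr_gt0.
- by apply: vanish_opp; apply: vanish_dec; exact: dec_Phi.
- have := vanish_scale (- 'C(10, j)%:R^-1) vl => h e /h[T HT]; exists T => t /HT.
  rewrite /phi; congr (`|_| < e); rewrite mulrBr mulrA mulNr mulVf// mulN1r mulNr opprK mulrC.
  by rewrite opprK.
Qed.

Lemma rat_bezout (s : rat) : exists b d : int, numq s * d - b * denq s = 1.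
Proof.
have : coprimez (numq s) (denq s) by rewrite /coprimez; exact: coprime_num_den.
case/coprimezP => [[u v] /= e]; exists (- v), u; rewrite -e; ring.
Qed.

Lemma Pj_lattice (s : option rat) (j : nat) : (j <= 10)%N ->
  exists u v : int, 'C(10, j)%:R * Pj j s = u%:~R * per R 0 - v%:~R * per R 2.
Proof.
case: s => [s|] j10; last by exists 0, 0; rewrite /= mulr0 !mul0r subr0.
have [b [d hbd]] := rat_bezout s.
have [u [v h]] := @cusp_limit R _ _ _ _ (Ordinal (j10 : (j < 11)%N)) (denq_gt0 s) hbd.
by exists u, v; apply: PjE.
Qed.

Lemma Pj0_fraction (a b m d : int) : 0 < m -> a * d - b * m = 1 ->
  exists w : int, Pj 0 (Some (a%:Q / m%:Q)) =
    m%:~R ^+ 10 * per R 0 - (ecoc m d + 81 * w)%:~R * per R 2.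
Proof.
move=> m0 h; have [w hw] := @cusp_limit0 R _ _ _ _ m0 h; exists w.
rewrite -[LHS]mul1r; apply: (@PjE _ 0) => //.
have -> : ratr (a%:Q / m%:Q) = a%:~R / m%:~R :> R by rewrite rmorphM fmorphV /= !ratr_int.
exact: hw.
Qed.

(** So [per 2] is itself a coefficient of a value of the symbol, and integrality of the normalized
    symbol applies to it. *)
Lemma Pj2_zero : 'C(10, 2)%:R * Pj 2 (Some 0) = per R 2.
Proof.
apply: PjE => // e e0; have [T HT] := @vanish_phi R 8 0 e e0; exists (Num.max T 1) => t.
rewrite ge_max => /andP[/HT h t1]; have t0 : 0 < t by lra.
rewrite rmorph0 -invN_axis// phi_S//= addrK expr2 mulrNN mulr1 mul1r.
exact: h.
Qed.

Lemma per0E (T : realType) : per T 0 = - (36 / 691) * per T 2.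
Proof. have := period_relation T; lra. Qed.

(** Every value becomes a multiple of [per 2 / O] with denominator 691, which is prime to 3. *)
Lemma lattice_quotient (T : realType) (O : T) (u v x y : int) : y != 0 ->
  per T 2 / O = x%:~R / y%:~R ->
  (u%:~R * per T 0 - v%:~R * per T 2) / O =
  (- (36 * u + 691 * v) * x)%:~R / (691 * y)%:~R.
Proof.
move=> y0 e; have yn : y%:~R != 0 :> T by rewrite intr_eq0.
have H q : q = x%:~R / y%:~R -> (- (36 / 691) * u%:~R - v%:~R) * q =
    (- (36 * u + 691 * v) * x)%:~R / (691 * y)%:~R :> T.
  by move=> ->; field.
by apply: (etrans _ (H _ e)); rewrite per0E; ring.
Qed.

(** If 3 divided [x], every coefficient of every value would lie in 3 Z_(3), against primitivity. *)
Lemma period_unit (Omega : R) : cohomological_period Omega ->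
  exists x y : int, [/\ ~~ (3 %| x)%Z, ~~ (3 %| y)%Z & per R 2 / Omega = x%:~R / y%:~R].
Proof.
move=> [O0 [integral [r [s [j [j10 prim]]]]]].
have [x [y [y3 e2]]] : in_Z3loc (per R 2 / Omega).
  have := integral None (Some 0) 2%N isT.
  by rewrite /phiplus_coef [Pj 2 None]/= subr0 Pj2_zero.
exists x, y; split => //.
apply/negP => /dvdzP[t xt]; apply: prim; rewrite /phiplus_coef mulrBr.
have [u [v ->]] := Pj_lattice s j10; have [u' [v' ->]] := Pj_lattice r j10.
exists (- (36 * (u - u') + 691 * (v - v')) * t), (691 * y); split.
  by rewrite Gauss_dvdzr.
have y0 : y != 0 by apply: contraNneq y3 => ->.
rewrite mulrBl !(lattice_quotient _ _ y0 e2) xt -mulrBl -rmorphB/=.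
have -> : - (36 * u + 691 * v) * (t * 3) - - (36 * u' + 691 * v') * (t * 3) =
  3 * (- (36 * (u - u') + 691 * (v - v')) * t) by ring.
by rewrite rmorphM.
Qed.

Lemma MT_values (Omega : R) (n : nat) (c : nat -> rat) : cohomological_period Omega -> (1 <= n)%N ->
  (forall a : nat, (a < 3 ^ n.+1)%N -> coprime a 3 ->
     ratr (c a) = phiplus_coef None (Some ((a%:Q) / ((3 ^ n.+1)%N)%:Q)) 0 / Omega) ->
  exists x y : int, [/\ ~~ (3 %| x)%Z, ~~ (3 %| y)%Z &
    forall a : nat, (a < 3 ^ n.+1)%N -> coprime a 3 -> exists b d w : int,
      a%:Z * d - b * (3 ^ n.+1)%N = 1 /\
      c a = (x * (9 * 691 * (d ^+ 2 - 1) + 81 * w))%:~R / (691 * y)%:~R].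
Proof.
move=> hO n1 hc; have [x [y [x3 y3 e2]]] := period_unit hO.
exists x, y; split => // a am a3; set m : int := (3 ^ n.+1)%N.
have m0 : 0 < m by rewrite /m ltz_nat expn_gt0.
have [b [d hbd]] : exists b d : int, a%:Z * d - b * m = 1.
  have : coprimez a m by rewrite coprimezE !absz_nat coprimeXr.
  case/coprimezP => [[u v] /= e]; exists (- v), u; rewrite -e; ring.
have [w hw] := Pj0_fraction m0 hbd.
have [t mt] : exists t : int, m = 9 * t.
  by exists (3 ^ n.-1)%N; rewrite /m -[in LHS](prednK n1) !expnS mulnA PoszM.
(* With m = 9 t, the [per 0] term gives - 36 m^10 = - 81 * 36 * 9^8 t^10; the rest is the
   indeterminacy 81 w of [ecoc]. *)
exists b, d, (- 36 * (9 ^+ 8 * t ^+ 10) - 691 * w); split => //.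
have y0 : y != 0 by apply: contraNneq y3 => ->.
apply: (fmorph_inj (ratr : rat -> R)); rewrite rmorphM fmorphV /= !ratr_int; apply: (etrans (hc a am a3)).
rewrite /phiplus_coef bin0 mul1r subr0 hw -rmorphXn/= (lattice_quotient _ _ y0 e2).
have m9 : (9 %| m)%Z by apply/dvdzP; exists t; rewrite mt mulrC.
have -> : ecoc m d = - (9 * (d ^+ 2 - 1)) by rewrite /ecoc m9 (dvdz_trans _ m9).
by congr (_%:~R / _); rewrite mt; ring.
Qed.

(** * Binomial sums modulo 3 and the lambda-invariant *)

Lemma sum_mulbin (N i : nat) :
  (\sum_(k < N) k * 'C(k, i) = i.+1 * 'C(N, i.+2) + i * 'C(N, i.+1))%N.
Proof.
elim: N => [|N IH]; first by rewrite big_ord0 !bin0n !muln0.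
rewrite big_ord_recr/= IH !binS.
have [iN|Ni] := leqP i N; last first.
  by rewrite !(bin_small Ni) !(bin_small (leqW Ni)) !(bin_small (leqW (leqW Ni))) !muln0.
(* Hence N C(N,i) = (i + 1) C(N,i+1) + i C(N,i), which is the increment of the right side by
   Pascal's rule. *)
have e : (i.+1 * 'C(N, i.+1) = (N - i) * 'C(N, i))%N by rewrite mul_bin_left.
have : (N * 'C(N, i) = (N - i) * 'C(N, i) + i * 'C(N, i))%N by rewrite -mulnDl subnK.
lia.
Qed.

(** From j C(p^n, j) = p^n C(p^n - 1, j - 1): were p prime to the coefficient, p^n would divide
    j. *)
Lemma prime_dvd_bin_pow (p n j : nat) : prime p -> (0 < j < p ^ n)%N -> (p %| 'C(p ^ n, j))%N.
Proof.
move=> pp /andP[j0 jn]; apply: contraLR jn => pC; rewrite -leqNgt.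
have : (p ^ n %| j * 'C(p ^ n, j))%N.
  case: j j0 pC => // j _ _; rewrite -mul_bin_diag; exact: dvdn_mulr.
rewrite Gauss_dvdl; first exact: dvdn_leq.
by rewrite coprimeXl// prime_coprime.
Qed.

Lemma sum_mulbin_dvd (n i : nat) : (i.+2 < 3 ^ n)%N -> (3 %| \sum_(k < 3 ^ n) k * 'C(k, i))%N.
Proof.
move=> h; rewrite sum_mulbin dvdn_add// dvdn_mull// prime_dvd_bin_pow//=.
exact: ltnW.
Qed.

(** The sum is (i + 1) + i 3^n, and i + 1 = 3^n - 1 is prime to 3. *)
Lemma sum_mulbin_ndvd (n i : nat) : (0 < n)%N -> (i.+2 = 3 ^ n)%N -> ~~ (3 %| \sum_(k < 3 ^ n) k * 'C(k, i))%N.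
Proof.
move=> n0 h; rewrite sum_mulbin -h binn binSn muln1.
have : (3 %| i.+2)%N by rewrite h -(prednK n0) expnS dvdn_mulr//.
move=> /dvdnP[t e]; have -> : i = (3 * t - 2)%N by lia.
apply/negP => /dvdnP[u]; nia.
Qed.

Lemma T_coefsE (M : nat -> rat) N i :
  T_coefs (\sum_(k < N) M k *: 'X^k) i = \sum_(k < N) M k * 'C(k, i)%:R.
Proof.
rewrite /T_coefs rmorph_sum/= coef_sum; apply: eq_bigr => k _.
rewrite linearZ/= coefZ rmorphXn/= comp_polyX addrC exprDn coef_sum.
congr (_ * _); under eq_bigr do rewrite expr1n mul1r coefMn coefXn.
have [ik|ki] := leqP i k.
  rewrite (bigD1 (Ordinal (ik : (i < k.+1)%N)))//= eqxx big1 ?addr0// => j ji.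
  by rewrite (_ : (i == j) = false) ?mul0rn//; apply: contraNF ji => /eqP ij; apply/eqP/val_inj.
rewrite bin_small// big1// => j _; rewrite (_ : (i == j) = false) ?mul0rn//.
by apply/negbTE; rewrite gtn_eqF// (leq_ltn_trans _ ki)// -ltnS.
Qed.

Lemma ord3_frac (p q : int) : p != 0 -> q != 0 ->
  ord3 (p%:~R / q%:~R) = (logn 3 `|p|)%:Z - (logn 3 `|q|)%:Z.
Proof.
move=> p0 q0; set r : rat := _ / _.
have qn : q%:~R != 0 :> rat by rewrite intr_eq0.
have r0 : r != 0 by rewrite mulf_neq0 ?invr_eq0 ?intr_eq0.
have e : numq r * q = p * denq r.
  apply: (@intr_inj rat); rewrite !intrM numqE mulrAC; congr (_ * _).
  by rewrite /r divfK.
have /(congr1 (logn 3)) := congr1 absz e.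
rewrite !abszM !lognM ?absz_gt0 ?numq_eq0 ?denq_neq0// /ord3; lia.
Qed.

(** The common factor 27 x / (691 y) has valuation 3, so mu is 3 and is first attained at the first
    [z i] prime to 3. *)
Lemma lambda_inv_frac (a : nat -> rat) (z : nat -> int) (x y : int) (L N : nat) :
  (forall i, a i = (27 * x * z i)%:~R / (691 * y)%:~R) ->
  ~~ (3 %| x)%Z -> ~~ (3 %| y)%Z -> (L < N)%N -> ~~ (3 %| z L)%Z ->
  (forall i, (i < L)%N -> (3 %| z i)%Z) -> lambda_inv a N = Some L.
Proof.
move=> ha x3 y3 LN zL zi.
have x0 : x != 0 by apply: contraNneq x3 => ->.
have y0 : y != 0 by apply: contraNneq y3 => ->.
have zL0 : z L != 0 by apply: contraNneq zL => ->.
have l0 (t : int) : ~~ (3 %| t)%Z -> logn 3 `|t| = 0%N.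
  move=> h; have t0 : t != 0 by apply: contraNneq h => ->.
  by apply/eqP; rewrite -leqn0 leqNgt -pfactor_dvdn ?absz_gt0// expn1.
have oE i : z i != 0 -> ord3 (a i) = 3 + (logn 3 `|z i|)%:Z.
  move=> i0; have p0 : 27 * x * z i != 0 by rewrite !mulf_eq0 !negb_or x0 i0.
  have q0 : 691 * y != 0 by rewrite mulf_eq0 negb_or y0.
  rewrite ha (ord3_frac p0 q0) !abszM; move: i0 x0 y0 (l0 x x3) (l0 y y3).
  rewrite -!absz_gt0; move: (absz x) (absz y) (absz (z i)) => x' y' z' h1 h2 h3 e1 e2.
  have l27 : logn 3 `|27| = 3%N by exact: (pfactorK 3).
  have l691 : logn 3 `|691| = 0%N by rewrite lognE.
  have p27 : (0 < `|27|)%N by []. have p691 : (0 < `|691|)%N by [].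
  move: l27 l691 p27 p691; move: (absz 27) (absz 691) => u v hu hv pu pv.
  rewrite !lognM ?muln_gt0 ?pu ?h1 ?h2//; lia.
have aE i : (a i != 0) = (z i != 0).
  by rewrite ha mulf_eq0 invr_eq0 !intr_eq0 !mulf_eq0 (negbTE x0) (negbTE y0)/= !orbF.
have oL : ord3 (a L) = 3 by rewrite oE// l0.
rewrite /lambda_inv; set P := fun i : nat => _.
suff -> : find P (iota 0 N) = L by rewrite LN.
have PL : P L.
  rewrite /P aE zL0/=; apply/allP => j _; apply/implyP; rewrite aE => j0.
  by rewrite oL oE//; lia.
have Pi i : (i < L)%N -> ~~ P i.
  move=> iL; rewrite /P aE; apply/negP => /andP[i0 /allP/(_ L)].
  rewrite mem_iota add0n LN => /(_ isT); rewrite aE zL0/= oL oE//.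
  have : (0 < logn 3 `|z i|)%N by rewrite -pfactor_dvdn ?absz_gt0// expn1; exact: zi.
  by lia.
have -> : N = (L + (N - L))%N by rewrite subnKC// ltnW.
rewrite iotaD find_cat size_iota ifN; last first.
  by apply/hasPn => i; rewrite mem_iota add0n => /Pi.
have : (0 < N - L)%N by rewrite subn_gt0.
by case: (N - L)%N => //= k _; rewrite add0n PL addn0.
Qed.

(** * Residues modulo 9 and the coefficients of the Mazur-Tate element *)

Lemma modn_int (m a b : nat) : (9 %| m)%N -> a = b %[mod m] -> exists z : int, a%:Z = b%:Z + 9 * z.
Proof.
move=> /dvdnP[t ->] e.
exists ((a %/ (t * 9))%:Z * t - (b %/ (t * 9))%:Z * t).
rewrite {1}(divn_eq a (t * 9)) {1}(divn_eq b (t * 9)) e; lia.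
Qed.

Lemma expr13_mod9 (s : int) k : exists q : int, (1 + 3 * s) ^+ k = 1 + 3 * s * k%:Z + 9 * q.
Proof.
elim: k => [|k [q e]]; first by exists 0; rewrite expr0; ring.
exists (q + s ^+ 2 * k%:Z + 3 * s * q); rewrite exprS e intS; ring.
Qed.

Section MazurTate.
Variables (n g : nat).
Hypothesis n1 : (1 <= n)%N.
Hypothesis hg : is_generator_class n g.
Let m := (3 ^ n.+1)%N.

Lemma nine_dvd_level : (9 %| m)%N.
Proof. by rewrite /m -(prednK n1) !expnS mulnA dvdn_mulr. Qed.

Lemma expz_nat (x k : nat) : (x ^ k)%N%:Z = x%:Z ^+ k.
Proof. by elim: k => // k IH; rewrite expnS PoszM IH exprS. Qed.

(** Squares do not see the sign that is lost in passing to the quotient by sigma_{-1}. *)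
Lemma residue_sqr (a k : nat) : a = g ^ k %[mod m] \/ a + g ^ k = 0 %[mod m] ->
  exists z : int, a%:Z ^+ 2 = (g%:Z ^+ 2) ^+ k + 9 * z.
Proof.
rewrite exprAC -(expz_nat g k) => -[]/(modn_int nine_dvd_level)[z]; set G := (g ^ k)%N => e.
  by exists (2 * G%:Z * z + 9 * z ^+ 2); rewrite e; ring.
exists (9 * z ^+ 2 - 2 * G%:Z * z); have -> : a%:Z = 9 * z - G%:Z by lia.
by ring.
Qed.

(** The class of 2 is a power of the generator, so 4 = 1 + 3 s k modulo 9 for some k, which forces 3
    not to divide s. *)
Lemma generator_sqr : coprime g 3 /\ exists2 s : int, ~~ (3 %| s)%Z & g%:Z ^+ 2 = 1 + 3 * s.
Proof.
have [k [_ hk]] := hg (isT : coprime 2 3).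
have [z hz] := residue_sqr hk.
have g3 : ~~ (3 %| g%:Z)%Z.
  apply/negP => /dvdzP[t et]; move: hz; rewrite et; case: (k) => [|k'].
    by rewrite expr0; lia.
  by rewrite (exprS (_ ^+ 2)); move: (_ ^+ k') => u; nia.
split; first by rewrite coprime_sym prime_coprime.
have [s es] := sqr_mod3 g3; exists s => //.
have [q eq] := expr13_mod9 s k; rewrite es eq in hz.
apply/negP => /dvdzP[t et]; rewrite et in hz; lia.
Qed.

(** Modulo 9, d^2 is the inverse of a^2 = 1 + 3 s k, that is 1 - 3 s k. *)
Lemma inverse_sqr (s : int) (a b d : int) k : g%:Z ^+ 2 = 1 + 3 * s ->
  (exists z : int, a ^+ 2 = (g%:Z ^+ 2) ^+ k + 9 * z) -> a * d - b * m = 1 ->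
  exists v : int, d ^+ 2 - 1 = - (3 * s * k%:Z) + 9 * v.
Proof.
move=> es [z hz]; have [q eq] := expr13_mod9 s k; rewrite es eq in hz => h.
have /dvdnP[t mt] := nine_dvd_level.
have e : a * d = 1 + 9 * (b * t) by rewrite -[a * d](subrK (b * m)) h mt PoszM; ring.
have e2 : a ^+ 2 * d ^+ 2 = (1 + 9 * (b * t)) ^+ 2 by rewrite -exprMn e.
exists (2 * (b * t) + 9 * (b * t) ^+ 2 - 3 * s * k%:Z * (2 * (b * t) + 9 * (b * t) ^+ 2)
  + d ^+ 2 * (s * k%:Z) ^+ 2 - d ^+ 2 * (q + z) * (1 - 3 * s * k%:Z)).
have : (1 - 3 * s * k%:Z) * (a ^+ 2 * d ^+ 2) = (1 - 3 * s * k%:Z) * (1 + 9 * (b * t)) ^+ 2 by rewrite e2.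
rewrite hz; move: (d ^+ 2) (k%:Z) (b * t) => D K B h1.
have -> : D - 1 = (1 - 3 * s * K) * ((1 + 3 * s * K + 9 * q + 9 * z) * D) - 1
  + 9 * (D * (s * K) ^+ 2) - 9 * (D * (q + z) * (1 - 3 * s * K)) by ring.
rewrite h1; ring.
Qed.

Lemma coprime3E a : coprime a 3 = ~~ (3 %| a)%N.
Proof. by rewrite coprime_sym prime_coprime. Qed.

Lemma level_gt0 : (0 < m)%N. Proof. by rewrite expn_gt0. Qed.

Lemma residue_coprime (k : nat) (r := (g ^ k %% m)%N) : coprime g 3 ->
  [/\ (0 < r)%N, (r < m)%N, ~~ (3 %| r)%N & ~~ (3 %| m - r)%N].
Proof.
move=> g3; have rm : (r < m)%N by rewrite ltn_mod level_gt0.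
have d3 : (3 %| m)%N by rewrite /m expnS dvdn_mulr.
have r3 : ~~ (3 %| r)%N.
  by rewrite /dvdn (modn_dvdm _ d3) -/(dvdn _ _) -prime_coprime// coprime_sym coprimeXl.
have r0 : (0 < r)%N by case: (r) r3.
by split => //; rewrite dvdn_subr// ltnW.
Qed.

(** The fibre over gamma^k consists of the two classes g^k and - g^k, distinct because 3 does not
    divide 2 g^k. *)
Lemma residue_pair (c : nat -> rat) k : coprime g 3 ->
  MT_coef n g c k = c (g ^ k %% m)%N + c (m - g ^ k %% m)%N.
Proof.
move=> /(residue_coprime k); set r := (g ^ k %% m)%N; move=> [r0 rm r3 mr3].
have d3 : (3 %| m)%N by rewrite /m expnS dvdn_mulr.
have r2m : (m - r < m)%N by rewrite ltn_subrL r0 level_gt0.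
have ne : (m - r)%N != r.
  apply: contra r3 => /eqP e; have : (3 %| 2 * r)%N by rewrite mul2n -addnn -{1}e subnK ?(ltnW rm).
  by rewrite Gauss_dvdr.
rewrite /MT_coef -/m (eq_bigl (fun a : 'I_m => (a == Ordinal rm) || (a == Ordinal r2m))); last first.
  move=> a; rewrite -!val_eqE/= coprime3E; have am := ltn_ord a.
  rewrite mod0n (modn_small am) -/r.
  have -> : ((a + g ^ k) %% m == 0)%N = (a == m - r :> nat)%N.
    rewrite -modnDmr -/r; have [ar|ar] := ltnP (a + r) m.
      by rewrite modn_small//; apply/idP/idP; lia.
    have -> : (a + r = (a + r - m) + m)%N by rewrite subnK.
    by rewrite modnDr modn_small; [apply/idP/idP; lia|lia].
  have [-> |_] := eqVneq (a : nat) r; first by rewrite r3.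
  by have [-> |_] := eqVneq (a : nat) (m - r)%N; rewrite ?mr3 ?andbF.
rewrite (bigD1 (Ordinal rm)) ?eqxx//= (bigD1 (Ordinal r2m))/=.
  rewrite big1 ?addr0// => i /andP[/andP[/orP[/eqP ->|/eqP ->]]]; rewrite ?eqxx//.
by rewrite eqxx orbT/= -val_eqE.
Qed.

Lemma lambda_MT (c : nat -> rat) (x y : int) : ~~ (3 %| x)%Z -> ~~ (3 %| y)%Z ->
  (forall a : nat, (a < m)%N -> coprime a 3 -> exists b d w : int,
      a%:Z * d - b * m = 1 /\
      c a = (x * (9 * 691 * (d ^+ 2 - 1) + 81 * w))%:~R / (691 * y)%:~R) ->
  lambda_inv (T_coefs (MT_poly_gamma n g c)) (3 ^ n) = Some (3 ^ n - 2)%N.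
Proof.
move=> x3 y3 hc; have [g3 [s s3 es]] := generator_sqr.
have n3 : (3 <= 3 ^ n)%N by rewrite -(prednK n1) expnS leq_pmulr// expn_gt0.
pose K : rat := 1 / (691 * y)%:~R.
have val (a k : nat) : (a < m)%N -> coprime a 3 -> a = g ^ k %[mod m] \/ a + g ^ k = 0 %[mod m] ->
    exists w : int, c a = (27 * x * (- 691 * s * k%:Z + 3 * w))%:~R * K.
  move=> am a3 hk; have [b [d [w [hd ->]]]] := hc a am a3.
  have [v hv] := inverse_sqr es (residue_sqr hk) hd.
  (* 9 * 691 (d^2 - 1) = 27 (- 691 s k + 3 * 691 v); the two elements of a fibre then add up to -
     1382 s k. *)
  exists (691 * v + w); rewrite hv /K mul1r; congr (_%:~R * _); ring.
have coef k : exists w : int, MT_coef n g c k = (27 * x * (- 1382 * s * k%:Z + 3 * w))%:~R * K.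
  have [r0 rm r3 mr3] := residue_coprime k g3; rewrite residue_pair//.
  have [||u ->] := val (g ^ k %% m)%N k rm; first by rewrite coprime3E.
    by left; rewrite modn_mod.
  have [|||v ->] := val (m - g ^ k %% m)%N k; rewrite ?coprime3E ?ltn_subrL ?r0 ?level_gt0//.
    by right; rewrite -modnDmr subnK ?modnn ?mod0n// ltnW.
  exists (u + v); rewrite -mulrDl -rmorphD/=; congr (_%:~R * _); ring.
have sums N i : exists w : int, \sum_(k < N) MT_coef n g c k * 'C(k, i)%:R =
    (27 * x * (- 1382 * s * (\sum_(k < N) k * 'C(k, i))%N%:Z + 3 * w))%:~R * K.
  elim: N => [|N [w IH]].
    by exists 0; rewrite !big_ord0 !mulr0 mul0r.
  have [u hu] := coef N; exists (w + u * 'C(N, i)%:Z).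
  rewrite !big_ord_recr/= IH hu PoszD PoszM; ring.
have [w hw] := choice (sums (3 ^ n)%N).
apply: (@lambda_inv_frac _ (fun i => - 1382 * s * (\sum_(k < 3 ^ n) k * 'C(k, i))%N%:Z + 3 * w i) x y) => //.
- by move=> i; rewrite T_coefsE hw /K mul1r.
- by lia.
- have := @sum_mulbin_ndvd n (3 ^ n - 2) n1; rewrite -addn2 subnK ?(ltnW n3)// => /(_ erefl).
  move: (\sum_(k < _) _)%N (w _) => S v; apply: contra => /dvdzP[t ht].
  (* As - 1382 = 1 - 3 * 461, the coefficient is s S modulo 3. *)
  have : (3 %| s * S%:Z)%Z by apply/dvdzP; exists (461 * s * S%:Z + t - v); lia.
  by rewrite Gauss_dvdzr// coprimezE prime_coprime.
- move=> i iL; have : (3 %| \sum_(k < 3 ^ n) k * 'C(k, i))%N by apply: sum_mulbin_dvd; lia.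
  move=> /dvdnP[t ->]; apply/dvdzP; exists (- 1382 * s * t%:Z + w i); rewrite PoszM; ring.
Qed.
End MazurTate.

Theorem theorem4p9 (Omega : R) (hOmega : cohomological_period Omega)
  (n : nat) (hn : (1 <= n)%N)
  (c : nat -> rat)
  (hc : forall a : nat, (a < 3 ^ n.+1)%N -> coprime a 3 ->
          ratr (c a) =
          phiplus_coef None (Some ((a%:Q) / ((3 ^ n.+1)%N)%:Q)) 0 / Omega)
  (g : nat) (hg : is_generator_class n g) :
  lambda_inv (T_coefs (MT_poly_gamma n g c)) (3 ^ n) = Some (3 ^ n - 2)%N.
Proof.
have [x [y [x3 y3 values]]] := MT_values hOmega hn hc.
exact: (lambda_MT hn hg x3 y3 values).
Qed.
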